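(* Start with a non-degenerate triangle $T_0$ and let $T_0,T_1,T_2,\dots$ be the random sequence of triangles in which the vertices of $T_{n+1}$ are three points chosen independently and uniformly at random, one on each side of $T_n$ (with choices at different steps independent). Then the limiting triangle shape is almost surely flat, i.e. the maximum angle of $T_n$ converges to $\pi$ almost surely as $n\to\infty$. Moreover, for any $c<1+\frac{\log 4}{3}-\frac{\pi^2}{9}$ $(=0.365\dots)$, almost surely $$y_n\le e^{-cn}\quad\text{for all sufficiently large } n,$$ where $y_n$ is the ratio of the height of $T_n$ corresponding to its largest side and the length of this side.
   Context: Precisely, if $T_n$ is the triangle $ABC$, then $T_{n+1}$ is the triangle $A_1B_1C_1$ with $A_1\in BC$, $B_1\in CA$, $C_1\in AB$, where $|BA_1|/|BC|$, $|CB_1|/|CA|$, $|AC_1|/|AB|$ are independent random variables uniformly distributed on $[0,1]$, independent of the previous steps. *)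

(* Defs.v *)
From HB Require Import structures.
From mathcomp Require Export all_boot all_order all_algebra finmap.
From mathcomp Require Export all_classical all_reals all_analysis.
Export Order.TTheory GRing.Theory Num.Theory.
Export numFieldNormedType.Exports.

Set Implicit Arguments.
Unset Strict Implicit.
Unset Printing Implicit Defensive.

Local Open Scope classical_set_scope.
Local Open Scope ring_scope.

Section Geometry.
Variable R : realType.

Definition dotrv (n : nat) (u v : 'rV[R]_n) : R := (u *m v^T) 0 0.

(* The library norm on matrices is the sup norm, hence this Euclidean one. *)
Definition enorm (n : nat) (u : 'rV[R]_n) : R := Num.sqrt (dotrv u u).

(* The vertices 0, 1, 2 are A, B, C.  As [ordS] and [ord_pred] are the cyclic
   successor and predecessor on 'I_3, the side opposite to vertex i runs from
   vertex [ordS i] to vertex [ord_pred i]: BC for A, CA for B, AB for C. *)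
Definition triangle := 'I_3 -> 'rV[R]_2.

Definition nondegenerate (T : triangle) : Prop :=
  row_free (col_mx (T (inord 1) - T (inord 0)) (T (inord 2) - T (inord 0))).

Definition side (T : triangle) (i : 'I_3) : R :=
  enorm (T (ord_pred i) - T (ordS i)).

Definition angle (T : triangle) (i : 'I_3) : R :=
  let u := T (ordS i) - T i in
  let v := T (ord_pred i) - T i in
  acos (dotrv u v / (enorm u * enorm v)).

(* The base value 0 is harmless, since angles are nonnegative. *)
Definition max_angle (T : triangle) : R := \big[Num.max/0]_(i < 3) angle T i.

Definition altitude_foot (T : triangle) (i : 'I_3) : 'rV[R]_2 :=
  let e := T (ord_pred i) - T (ordS i) in
  T (ordS i) + (dotrv (T i - T (ordS i)) e / dotrv e e) *: e.

Definition height (T : triangle) (i : 'I_3) : R :=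
  enorm (T i - altitude_foot T i).

(* If several sides are largest, the choice made by [arg max] is immaterial:
   the corresponding heights agree. *)
Definition largest_side (T : triangle) : 'I_3 :=
  [arg max_(i > ord0) side T i]%O.

Definition flatness (T : triangle) : R :=
  height T (largest_side T) / side T (largest_side T).

(* The new vertices A1, B1, C1 divide BC, CA, AB so that
   |BA1|/|BC| = u 0, |CB1|/|CA| = u 1, |AC1|/|AB| = u 2. *)
Definition inscribed (T : triangle) (u : 'I_3 -> R) : triangle :=
  fun i => T (ordS i) + u i *: (T (ord_pred i) - T (ordS i)).

Fixpoint triangle_seq (T0 : triangle) (u : nat -> 'I_3 -> R) (n : nat)
    : triangle :=
  if n is m.+1 then inscribed (triangle_seq T0 u m) (u m) else T0.

End Geometry.

Section Independence.
Context d (Omega : measurableType d) (R : realType) (P : probability Omega R).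

Definition mutually_independent (I : choiceType) (X : I -> {RV P >-> R})
    : Prop :=
  forall (J : {fset I}) (B : I -> set R),
    (forall i, measurable (B i)) ->
    P (\bigcap_(i in [set` J]) (X i @^-1` B i)) =
      (\prod_(i <- J) P (X i @^-1` B i))%E.

Definition uniform01 (X : {RV P >-> R}) : Prop :=
  forall B : set R, measurable B ->
    distribution P X B = uniform_prob (@ltr01 R) B.

End Independence.

(* Main.v *)
(* An affine functional whose values at the vertices of T_0 are 0, 1, 2 turns the
   sequence into a Markov chain of "flat triangles" x_n in R^3, and the area of T_n into
   A_n |T_0| with A_n a product of i.i.d. ratios D = uvw + (1-u)(1-v)(1-w).  With r_n the
   range and g_n the smallest gap of x_n, the flatness of T_n and the sine of its largest
   angle are O(A_n / g_n^2).

   The constant is the drift E[-ln D] - 2 E[-ln(r_{n+1}/r_n)]: the first term is at least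
   8/3 - pi^2/9 (shear s = u + v - 1 and the bound sum 1/k^2 <= pi^2/6), and the second
   expectation is at most 5/6 - ln 2 / 3 whatever the shape of x_n, with equality when
   the middle point is the midpoint.  Since D^(-1/2) and (r_{n+1}/r_n)^(-1/2) have bounded
   moments, A^p / r^(2p) shrinks in mean by 1 - p (drift) + O(p^2) at each step, while one
   further step costs at most a constant factor for replacing r by g.  Markov's inequality
   and summability over n give A_n / g_n^2 <= e^(-cn) eventually, almost surely. *)

Require Import Defs.
From HB Require Import structures.
From mathcomp Require Import zify ring lra measurable_realfun.

Set Implicit Arguments.
Unset Strict Implicit.
Unset Printing Implicit Defensive.

Local Open Scope classical_set_scope.
Local Open Scope ring_scope.

(** * Elementary inequalities *)

(** The law of the shape of [x_n] is not explicit, so every one-step bound is proved uniformly in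
    the shape. The area ratio D and the length ratio rho = r_{n+1}/r_n depend on the same three
    uniforms; to use only their separate means, D^p rho^(-2p) is replaced by (D^(2p) + rho^(-4p))/2,
    which keeps the first order in p and only enlarges the quadratic error. That error comes from
    y^2 <= C e^(y/2) with y = -ln D or y = -ln rho, so a moment of order -1/2 does the work of a
    second moment of the logarithm; for an affine form in a uniform variable such a moment is
    bounded in terms of the slope alone. The gap enters because it bounds every side of T_n from
    below, the range because its mean logarithmic contraction can be computed. All means are
    integrals of functions with values in [0, +oo], so that Tonelli applies without integrability:
    negative terms are moved across inequalities, and null degenerate sets are discarded by adding a
    term that is +oo on them. *)

Section Basel.
Variable R : realType.

Lemma sin_le (x : R) : 0 <= x -> sin x <= x.
Proof.
move=> x0; rewrite -subr_ge0.
have -> : 0 = 0 - sin 0 :> R by rewrite sin0 subrr.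
pose f (y : R) := y - sin y.
have df (y : R) : is_derive y 1 f (1 - cos y) by apply: is_deriveB.
have [c _] : exists2 c, c \in `[0, x]%R & f x - f 0 = (1 - cos c) * (x - 0).
  apply: (MVT_segment x0 (fun y _ => df y)).
  by apply: continuous_subspaceT => y; apply/differentiable_continuous/derivable1_diffP/ex_derive.
rewrite /f sin0 !subr0 => ->.
by rewrite mulr_ge0// subr_ge0 cos_le1.
Qed.

(** As sin(pi/2 - z) = cos z, this is 1/sin^2 + 1/cos^2 = 4/sin^2(2z): two complementary angles
    merge into the doubled one, which drives the induction in [sum_csc_sq]. *)
Lemma csc_sq_duplication (z : R) : sin z != 0 -> cos z != 0 ->
  (sin z ^+ 2)^-1 + (sin (pi / 2 - z) ^+ 2)^-1 = 4 * (sin (z *+ 2) ^+ 2)^-1.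
Proof.
move=> s0 c0.
have -> : sin (pi / 2 - z) = cos z.
  by rewrite sinB sin_pihalf cos_pihalf mul1r mul0r subr0.
rewrite sin_mulr2n -mulr_natr.
have := cos2Dsin2 z; set s := sin z; set c := cos z => cs.
have -> : (s ^+ 2)^-1 + (c ^+ 2)^-1 = (c ^+ 2 + s ^+ 2) / (s ^+ 2 * c ^+ 2).
  by field; rewrite s0 c0.
by rewrite cs; field; rewrite s0 c0.
Qed.

(** The angles are the odd multiples of pi/2^(n+2) below pi/2. In the sum for n+1, pairing each
    angle with its complement (the second half, reversed) gives four times the sum for n. *)
Lemma sum_csc_sq (n : nat) :
  \sum_(k < 2 ^ n) (sin ((k.*2.+1)%:R * pi / 2 ^+ n.+2) ^+ 2)^-1
  = 2 * 4 ^+ n :> R.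
Proof.
elim: n => [|n IHn].
  rewrite big_ord1 /= mul1r expr0 mulr1.
  have := sin_mulr2n (pi / 4 : R).
  have -> : (pi / 4 *+ 2 : R) = pi / 2 by rewrite -mulr_natr; field.
  rewrite sin_pihalf => h.
  have := cos2Dsin2 (pi / 4 : R).
  have -> : (2 ^+ 2 : R) = 4 by ring.
  move: h; set s := sin _; set c := cos _ => h1 h2.
  have e : (c - s) ^+ 2 = 0.
    have -> : (c - s) ^+ 2 = c ^+ 2 + s ^+ 2 - c * s *+ 2 by ring.
    by rewrite h2 -h1 subrr.
  move/eqP: e; rewrite expf_eq0 /= subr_eq0 => /eqP e.
  have -> : s ^+ 2 = 2^-1 by rewrite e in h2; lra.
  by rewrite invrK.
rewrite expnS mul2n -addnn big_split_ord /=.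
rewrite [X in _ + X](reindex_inj rev_ord_inj) /= -big_split /=.
have -> : 2 * 4 ^+ n.+1 = 4 * (2 * 4 ^+ n) :> R by rewrite exprS; ring.
rewrite -IHn mulr_sumr; apply: eq_bigr => k _.
set z := ((nat_of_ord k).*2.+1)%:R * pi / 2 ^+ n.+3 : R.
have p2 m : (2 ^+ m : R) != 0 by rewrite expf_neq0.
have -> : ((2 ^ n + (2 ^ n - k.+1)).*2.+1)%:R * pi / 2 ^+ n.+3 = pi / 2 - z.
  apply/eqP; rewrite eq_sym subr_eq /z -mulrDl -mulrDl -natrD.
  have -> : ((2 ^ n + (2 ^ n - k.+1)).*2.+1 + k.*2.+1 = 2 ^ n.+2)%N.
    have := ltn_ord k; rewrite !expnS; lia.
  by rewrite natrX !exprS; apply/eqP; field; rewrite p2.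
have -> : k.*2.+1%:R * pi / 2 ^+ n.+2 = z *+ 2 :> R.
  by rewrite /z -mulr_natr !exprS; field; rewrite ?p2.
have zlt : 0 < z < pi / 2.
  apply/andP; split; first by rewrite divr_gt0 ?exprn_gt0 ?mulr_gt0 ?ltr0n ?pi_gt0.
  rewrite /z ltr_pdivrMr ?exprn_gt0// [ltRHS](_ : _ = pi * 2 ^+ n.+2); last by rewrite !exprS; field.
  rewrite mulrC ltr_pM2l ?pi_gt0// -natrX ltr_nat.
  have := ltn_ord k; rewrite !expnS; lia.
apply: csc_sq_duplication.
  by rewrite gt_eqF// sin_gt0_pihalf.
rewrite gt_eqF// cos_gt0_pihalf//; move: zlt => /andP[z0 ->]; rewrite andbT.
by rewrite (lt_trans _ z0)// oppr_lt0 divr_gt0 ?pi_gt0.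
Qed.

(** From 1/y^2 <= 1/sin^2 y at the angles of [sum_csc_sq], after extending the sum to 2^n terms. The
    factor (pi/2^(n+2))^2 turns 2 * 4^n into pi^2/8. *)
Lemma sum_inv_odd_sq_le (n : nat) :
  \sum_(k < n) ((k.*2.+1)%:R ^+ 2)^-1 <= pi ^+ 2 / 8 :> R.
Proof.
have nn : (n <= 2 ^ n)%N by rewrite ltnW// ltn_expl.
apply: (@le_trans _ _ (\sum_(k < 2 ^ n) ((k.*2.+1)%:R ^+ 2)^-1)).
  rewrite (big_ord_widen _ (fun k => ((k.*2.+1)%:R ^+ 2)^-1) nn).
  by rewrite [leRHS](bigID (fun k : 'I__ => (k < n)%N)) /= lerDl sumr_ge0.
have p2 m : (2 ^+ m : R) != 0 by rewrite expf_neq0.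
have c0 : 0 < pi ^+ 2 / (2 ^+ n.+2) ^+ 2 :> R.
  by rewrite divr_gt0 ?exprn_gt0 ?pi_gt0.
have -> : pi ^+ 2 / 8 = pi ^+ 2 / (2 ^+ n.+2) ^+ 2 * (2 * 4 ^+ n) :> R.
  have -> : (4 : R) = 2 ^+ 2 by ring.
  by rewrite -exprM mulnC exprM !exprS; field; rewrite ?p2.
rewrite -sum_csc_sq mulr_sumr; apply: ler_sum => k _.
set a := (_.+1%:R : R).
have a0 : 0 < a by rewrite /a ltr0n.
set y := a * pi / 2 ^+ n.+2.
have y0 : 0 < y by rewrite divr_gt0 ?exprn_gt0 ?mulr_gt0 ?pi_gt0.
have ylt : y < pi.
  rewrite /y ltr_pdivrMr ?exprn_gt0// mulrC ltr_pM2l ?pi_gt0// /a -natrX ltr_nat.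
  have := ltn_ord k; rewrite !expnS; lia.
have -> : (a ^+ 2)^-1 = pi ^+ 2 / (2 ^+ n.+2) ^+ 2 * (y ^+ 2)^-1.
  have E (b p q : R) : b != 0 -> p != 0 -> q != 0 ->
      (b ^+ 2)^-1 = p ^+ 2 / q ^+ 2 * ((b * p / q) ^+ 2)^-1.
    by move=> b0 p0 q0; field; rewrite b0 p0 q0.
  by apply: E; rewrite ?p2 ?lt0r_neq0 ?pi_gt0.
rewrite ler_pM2l// lef_pV2 ?posrE ?exprn_gt0// ?sin_gt0_pi ?y0//.
by rewrite ler_sqr ?nnegrE ?sin_le ?ltW// sin_gt0_pi ?y0.
Qed.

(** Separating odd and even terms, S(2n) is an odd sum plus S(n)/4; with S(n) <= S(2n) this gives
    (3/4) S(n) <= pi^2/8. *)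
Lemma sum_inv_sq_le (n : nat) :
  \sum_(k < n) ((k.+1)%:R ^+ 2)^-1 <= pi ^+ 2 / 6 :> R.
Proof.
pose S n : R := \sum_(k < n) ((k.+1)%:R ^+ 2)^-1.
have split_parity m : S m.*2 = \sum_(k < m) ((k.*2.+1)%:R ^+ 2)^-1 + S m / 4.
  rewrite /S; elim: m => [|m IHm]; first by rewrite !big_ord0 mul0r addr0.
  rewrite doubleS !big_ord_recr /= IHm mulrDl.
  have -> : m.*2.+2%:R = 2 * m.+1%:R :> R by rewrite -doubleS -mul2n natrM.
  have m0 : m.+1%:R != 0 :> R by rewrite pnatr_eq0.
  have o0 : m.*2.+1%:R != 0 :> R by rewrite pnatr_eq0.
  move: m0 o0; move: m.+1%:R m.*2.+1%:R => q o q0 o0.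
  by field; rewrite q0 o0.
have Smono : S n <= S n.*2.
  rewrite /S (big_ord_widen n.*2 (fun k => ((k.+1)%:R ^+ 2)^-1)); last by rewrite -addnn leq_addr.
  by rewrite [leRHS](bigID (fun k : 'I__ => (k < n)%N)) /= lerDl sumr_ge0.
have := sum_inv_odd_sq_le n; have := split_parity n; rewrite -/(S n).
set o := \sum_(_ < _) _ => h1 h2; lra.
Qed.

(** Serves to show that the decay rate is positive. The number t = tan(pi/8) satisfies 2t = 1 - t^2,
    hence t < 21/50, and pi/8 <= t. *)
Lemma pi_lt : pi < 17 / 5 :> R.
Proof.
have p4 : 0 < (pi / 8 : R) < pi / 2 by have := pi_gt0 R; lra.
have c8 : 0 < cos (pi / 8) :> R by apply: cos_gt0_pihalf; have := pi_gt0 R; lra.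
have s8 : 0 < sin (pi / 8) :> R by apply: sin_gt0_pihalf.
have := @tan_mulr2n R (pi / 8) (lt0r_neq0 c8).
have -> : (pi / 8 *+ 2 : R) = pi / 4 by rewrite -mulr_natr; field.
rewrite tan_piquarter.
have t0 : 0 < tan (pi / 8) :> R by rewrite /tan divr_gt0.
have le_tan : pi / 8 <= tan (pi / 8) :> R.
  rewrite -[leLHS](@tanK R); last by rewrite in_itv /=; have := pi_gt0 R; lra.
  set t := tan _; have := ltW t0; rewrite -/t => {}t0.
  pose f (y : R) := y - atan y.
  have df (y : R) : is_derive y 1 f (1 - (1 + y ^+ 2)^-1) by apply: is_deriveB.
  have [c _] : exists2 c, c \in `[0, t]%R & f t - f 0 = (1 - (1 + c ^+ 2)^-1) * (t - 0).
    apply: (MVT_segment t0 (fun y _ => df y)).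
    by apply: continuous_subspaceT => y; apply/differentiable_continuous/derivable1_diffP/ex_derive.
  rewrite /f atan0 !subr0 -subr_ge0 => ->; rewrite mulr_ge0// subr_ge0.
  by rewrite invf_le1 ?lerDl ?sqr_ge0// ltr_wpDr ?sqr_ge0.
move: le_tan t0; set t := tan _ => le_tan t0 h.
have n0 : 1 - t ^+ 2 != 0.
  by apply/eqP => e; move: h; rewrite e invr0 mulr0 => /eqP; rewrite oner_eq0.
have h2 : t *+ 2 = 1 - t ^+ 2.
  by apply/eqP; rewrite -subr_eq0; apply/eqP; move/(congr1 ( *%R^~ (1 - t ^+ 2))): h; rewrite mul1r divfK// => ->; ring.
suff : t < 21 / 50 by lra.
rewrite ltNge; apply/negP => t42.
nra.
Qed.

End Basel.

(** * Monotonicity from derivatives, t ln t at 0, and an improper fundamental theorem of calculus *)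

Section RealAnalysis.
Variable R : realType.
Implicit Types (f F df g : R -> R).

Lemma is_derive_continuous F (x d : R) : is_derive x 1 F d -> {for x, continuous F}.
Proof. by move=> h; apply/differentiable_continuous/derivable1_diffP/ex_derive. Qed.

Lemma is_derive_ln_comp g (x dg : R) : 0 < g x ->
  is_derive x 1 g dg -> is_derive x 1 (fun y => ln (g y)) (dg / g x).
Proof.
move=> g0 hg; rewrite mulrC.
have := is_derive1_comp (is_derive1_ln g0) hg.
exact.
Qed.

Lemma is_derive_ge0_le F dF (a b : R) : a <= b ->
  (forall x, a <= x <= b -> is_derive x 1 F (dF x)) ->
  (forall x, a <= x <= b -> 0 <= dF x) -> F a <= F b.
Proof.
move=> ab hF dF0.
have [||c cab] := @MVT_segment R F dF a b ab.
- by move=> x; rewrite in_itv /= => /andP[ax xb]; apply: hF; rewrite !ltW.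
- apply: continuous_in_subspaceT => x; rewrite inE /= in_itv /= => xab.
  exact: is_derive_continuous (hF _ xab).
- rewrite -subr_ge0 => ->; rewrite mulr_ge0 ?subr_ge0//; apply: dF0.
  by move: cab; rewrite in_itv.
Qed.

(** With s = sqrt t, ln t = 2 ln s and -ln s <= 1/s. *)
Lemma xlnx_le_sqrt (t : R) : 0 < t -> t < 1 -> `|t * ln t| <= 2 * Num.sqrt t.
Proof.
move=> t0 t1; have s0 : 0 < Num.sqrt t by rewrite sqrtr_gt0.
have -> : ln t = 2 * ln (Num.sqrt t).
  by rewrite -[in LHS](sqr_sqrtr (ltW t0)) lnXn// mulr_natl.
have lt0 : ln (Num.sqrt t) <= 0 by rewrite ln_le0// -sqrtr1 ler_wsqrtr// ltW.
have hV : - ln (Num.sqrt t) <= (Num.sqrt t)^-1.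
  by rewrite -lnV ?posrE// ltW// ln_sublinear// invr_gt0.
rewrite normrM normrM gtr0_norm// ger0_norm// ler0_norm//.
rewrite mulrCA ler_pM2l// -[X in X * _](sqr_sqrtr (ltW t0)) expr2 -mulrA.
by rewrite ger_pMr// mulrC -ler_pdivlMr// mul1r.
Qed.

(** [ln] is 0 on nonpositive arguments, so t ln t vanishes there and the delicate point is 0.
    Continuity at 0 lets primitives be evaluated at singular endpoints. *)
Lemma continuous_xlnx : continuous (fun t : R => t * ln t).
Proof.
move=> x; have [x0|x0|->] := ltgtP x 0.
- apply/cvgrPdist_le => e e0; near=> t.
  by rewrite !ln0 ?mulr0 ?subrr ?normr0 ?ltW//; near: t; exact: lt_nbhsl.
- by apply: continuousM => //; exact: continuous_ln.
apply/cvgrPdist_le => e e0; near=> t.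
rewrite mul0r sub0r normrN; have [t0|t0] := leP t 0.
  by rewrite ln0// mulr0 normr0 ltW.
have t1 : t < 1 by near: t; apply: lt_nbhsl.
have te : t < (e / 2) ^+ 2 by near: t; apply: lt_nbhsl; rewrite exprn_gt0// divr_gt0.
rewrite (le_trans (xlnx_le_sqrt t0 t1))// mulrC -ler_pdivlMr//.
have := ler_wsqrtr (ltW te); rewrite sqrtr_sqr ger0_norm// divr_ge0// ltW.
Unshelve. all: by end_near. Qed.

(** An improper form: the integrand may blow up at a and b as long as the primitive is continuous
    there. The formula on [a + d_n, b - d_n] passes to the limit by monotone convergence, whence f
    >= 0. *)
Lemma integral_itvoo_FTC f F (a b : R) : a < b ->
  (forall x, a < x < b -> 0 <= f x) ->
  (forall x, a < x < b -> {for x, continuous f}) ->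
  (forall x, a < x < b -> is_derive x 1 F (f x)) ->
  {for a, continuous F} -> {for b, continuous F} ->
  (\int[lebesgue_measure]_(x in `]a, b[) (f x)%:E = (F b - F a)%:E)%E.
Proof.
move=> ab f0 cf dF Fa Fb.
(* A third of the length keeps every trimmed interval nondegenerate, including n = 0. *)
pose e : R := (b - a) / 3.
have e0 : 0 < e by rewrite /e; lra.
pose d (n : nat) := e / n.+1%:R.
have d0 n : 0 < d n by rewrite divr_gt0.
have de n : d n <= e by rewrite /d ler_pdivrMr// ler_peMr ?ler1n// ltW.
pose J (n : nat) : set R := `[a + d n, b - d n]%classic.
have cvgd : d n @[n --> \oo] --> 0.
  rewrite -(mulr0 e); apply: cvgMr; exact: cvg_harmonic.
have JS n x : J n x -> a < x < b.
  rewrite /J /= in_itv /= => /andP[h1 h2]; have := d0 n; lra.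
have UJ : `]a, b[%classic = \bigcup_n J n.
  apply/seteqP; split => [x /=|x [n _ /JS]]; last by rewrite /= in_itv.
  rewrite in_itv /= => /andP[ax xb].
  have m0 : 0 < Num.min (x - a) (b - x) by rewrite lt_min !subr_gt0 ax.
  have [n _ /(_ n (leqnn n)) /= hn] : \forall n \near \oo, `|0 - d n| < Num.min (x - a) (b - x).
    by move/cvgrPdist_lt: cvgd; apply.
  exists n => //; rewrite /J /= in_itv /=; move: hn.
  rewrite sub0r normrN gtr0_norm// lt_min => /andP[h1 h2].
  by apply/andP; split; lra.
have ndJ : nondecreasing_seq J.
  move=> m n mn; apply/subsetPset => x; rewrite /J /= !in_itv /=.
  have : d n <= d m by rewrite /d ler_pM2l// lef_pV2 ?posrE// ler_nat ltnS.
  by move=> h /andP[h1 h2]; apply/andP; split; lra.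
have mf n : measurable_fun (J n) f.
  apply: (@measurable_funS _ _ _ _ `]a, b[%classic) => //.
    by move=> x /JS; rewrite /= in_itv.
  apply: open_continuous_measurable_fun; first exact: interval_open.
  by move=> x; rewrite inE /= in_itv /= => /cf.
have := @ge0_nondecreasing_set_cvg_integral _ (measurableTypeR R) R J (EFin \o f) lebesgue_measure ndJ
  (fun n => measurable_itv _) (fun n => (measurable_EFinP _ _).2 (mf n)) (fun n x h => f0 _ (JS n x h)).
rewrite -UJ /=.
have -> : (fun n => \int[lebesgue_measure]_(x in J n) (f x)%:E)%E =
    (fun n => (F (b - d n) - F (a + d n))%:E).
  apply/funext => n; rewrite EFinB; apply: continuous_FTC2.
  - have := de n; have := d0 n; rewrite /e; lra.
  - by apply: continuous_in_subspaceT => x; rewrite inE => /JS; exact: cf.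
  - split.
    + move=> x; rewrite in_itv /= => /andP[h1 h2].
      by apply: ex_derive; apply: dF; have := d0 n; lra.
    + apply: cvg_at_right_filter; apply: is_derive_continuous (dF _ _).
      by have := d0 n; have := de n; rewrite /e => h1 h2; apply/andP; split; lra.
    + apply: cvg_at_left_filter; apply: is_derive_continuous (dF _ _).
      by have := d0 n; have := de n; rewrite /e => h1 h2; apply/andP; split; lra.
  - move=> x; rewrite in_itv /= => /andP[h1 h2]; rewrite derive1E.
    by apply: derive_val; apply: dF; have := d0 n; lra.
move=> h; apply: (cvg_unique _ h) => //.
apply: cvg_EFin; first by near=> n.
apply: cvgB.
- apply: continuous_cvg; first by rewrite /prop_for.
  rewrite -[X in _ --> X]subr0; apply: cvgB => //; exact: cvg_cst.
- apply: continuous_cvg => //.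
  rewrite -[X in _ --> X]addr0; apply: cvgD => //; exact: cvg_cst.
Unshelve. all: by end_near. Qed.

End RealAnalysis.

(** * The midpoint inequality, and exponential bounds with a quadratic error *)

Section Inequalities.
Variable R : realType.

(** With s = 2x - 1, the midpoint inequality [xlnx_midpoint_le] becomes k(s) <= 8 ln 2 s^2. [k1],
    [k2], [k3] are the successive derivatives of [k]. *)
Let k (s : R) := (1 + s) ^+ 3 * ln (1 + s) + (1 - s) ^+ 3 * ln (1 - s).
Let k1 (s : R) := 3 * (1 + s) ^+ 2 * ln (1 + s) - 3 * (1 - s) ^+ 2 * ln (1 - s)
  + (1 + s) ^+ 2 - (1 - s) ^+ 2.
Let k2 (s : R) := 6 * (1 + s) * ln (1 + s) + 6 * (1 - s) * ln (1 - s) + 10.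
Let k3 (s : R) := 6 * ln (1 + s) - 6 * ln (1 - s).

Let derive_ln1D (s : R) : -1 < s -> is_derive s 1 (fun s => ln (1 + s)) (1 / (1 + s)).
Proof.
move=> s1; apply: is_derive_ln_comp; first lra.
by apply: is_derive_eq; rewrite ?add0r ?scaler1 ?mulN1r ?mul1r; ring.
Qed.

Let derive_ln1B (s : R) : s < 1 -> is_derive s 1 (fun s => ln (1 - s)) (- 1 / (1 - s)).
Proof.
move=> s1; apply: is_derive_ln_comp; first lra.
by apply: is_derive_eq; rewrite ?add0r ?scaler1 ?mulN1r ?mul1r; ring.
Qed.

Let derive_k (s : R) : -1 < s < 1 -> is_derive s 1 k (k1 s).
Proof.
move=> /andP[s0 s1]; have h1 := derive_ln1D s0; have h2 := derive_ln1B s1.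
rewrite /k; apply: is_derive_eq; rewrite /GRing.scale /= /k1.
by field; apply/andP; split; apply/eqP; lra.
Qed.

Let derive_k1 (s : R) : -1 < s < 1 -> is_derive s 1 k1 (k2 s).
Proof.
move=> /andP[s0 s1]; have h1 := derive_ln1D s0; have h2 := derive_ln1B s1.
rewrite /k1; apply: is_derive_eq; rewrite /GRing.scale /= /k2.
by field; apply/andP; split; apply/eqP; lra.
Qed.

Let derive_k2 (s : R) : -1 < s < 1 -> is_derive s 1 k2 (k3 s).
Proof.
move=> /andP[s0 s1]; have h1 := derive_ln1D s0; have h2 := derive_ln1B s1.
rewrite /k2; apply: is_derive_eq; rewrite /GRing.scale /= /k3.
by field; apply/andP; split; apply/eqP; lra.
Qed.

(** This is the sign of the derivative of k(s)/s^2. Both s k1 - 2k and its derivative s k2 - k1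
    vanish at 0, and the latter has derivative s k3 >= 0. *)
Let k_homogeneous_le (s : R) : 0 <= s < 1 -> 2 * k s <= s * k1 s.
Proof.
move=> /andP[s0 s1].
have hk2 (t : R) : 0 <= t < 1 -> k1 t <= t * k2 t.
  move=> /andP[t0 t1]; pose F t := t * k2 t - k1 t.
  have F0 : F 0 = 0 by rewrite /F /k1 !addr0 !subr0 ln1; ring.
  rewrite -subr_ge0 -/(F t) -F0.
  apply: (@is_derive_ge0_le _ F (fun t => t * k3 t) 0 t t0).
    move=> x /andP[x0 xt]; have x1 : -1 < x < 1 by apply/andP; split; lra.
    have h1 := derive_k1 x1; have h2 := derive_k2 x1.
    by rewrite /F; apply: is_derive_eq; rewrite /GRing.scale /=; ring.
  move=> x /andP[x0 xt]; rewrite mulr_ge0// subr_ge0 ler_pM2l//.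
  by rewrite (@le_trans _ _ 0)// ?ln_le0 ?ln_ge0//; lra.
pose F t := t * k1 t - 2 * k t.
have F0 : F 0 = 0 by rewrite /F /k !addr0 !subr0 ln1; ring.
rewrite -subr_ge0 -/(F s) -F0.
apply: (@is_derive_ge0_le _ F (fun t => t * k2 t - k1 t) 0 s s0).
  move=> x /andP[x0 xt]; have x1 : -1 < x < 1 by apply/andP; split; lra.
  have h1 := derive_k x1; have h2 := derive_k1 x1.
  by rewrite /F; apply: is_derive_eq; rewrite /GRing.scale /=; ring.
by move=> x /andP[x0 xt]; rewrite subr_ge0 hk2// x0 /=; lra.
Qed.

(* [k s / s ^+ 2] is nondecreasing, and at most [8 * ln 2] near [s = 1]. *)
Let k_le (s : R) : 0 <= s < 1 -> k s <= 8 * ln 2 * s ^+ 2.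
Proof.
move=> /andP[]; rewrite le_eqVlt => /predU1P[<- _|s0 s1].
  by rewrite /k !addr0 !subr0 ln1 expr0n /= !mulr0 addr0.
have mono t : s <= t < 1 -> k s / s ^+ 2 <= k t / t ^+ 2.
  move=> /andP[st t1].
  apply: (@is_derive_ge0_le _ (fun t => k t / t ^+ 2)
    (fun t => (t * k1 t - 2 * k t) / t ^+ 3)) => //.
    move=> x /andP[sx xt]; have x1 : -1 < x < 1 by apply/andP; split; lra.
    have x0 : x != 0 by rewrite gt_eqF// (lt_le_trans s0).
    have h1 := derive_k x1.
    have h2 : is_derive x 1 (fun t : R => (t ^+ 2)^-1) (- (x ^+ 2) ^- 2 *: (2 * x)).
      apply: is_deriveV; first by rewrite expf_neq0.
      by apply: is_derive_eq; rewrite /GRing.scale /=; ring.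
    by apply: is_derive_eq; rewrite /GRing.scale /=; field.
  move=> x /andP[sx xt]; rewrite divr_ge0 ?exprn_ge0 ?subr_ge0 ?k_homogeneous_le//; lra.
have bound t : s < t < 1 -> k s * t ^+ 2 <= 8 * ln 2 * s ^+ 2.
  move=> /andP[st t1].
  have := mono t; rewrite (ltW st) t1 => /(_ isT).
  rewrite ler_pdivrMr ?exprn_gt0// mulrAC ler_pdivlMr ?exprn_gt0//; last lra.
  move=> /le_trans; apply; apply: ler_wpM2r; first by rewrite sqr_ge0.
  rewrite /k -[leRHS]addr0 lerD//.
    rewrite (@le_trans _ _ ((1 + t) ^+ 3 * ln 2))//.
      by rewrite ler_wpM2l ?exprn_ge0 ?ler_ln ?posrE//; lra.
    rewrite ler_wpM2r ?ln_ge0 ?ler1n//.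
    have -> : 8 = 2 ^+ 3 :> R by ring.
    by rewrite lerXn2r ?nnegrE//; lra.
  by rewrite mulr_ge0_le0 ?exprn_ge0 ?ln_le0//; lra.
have [k0|k0] := leP (k s) 0.
  by rewrite (le_trans k0)// mulr_ge0 ?sqr_ge0// mulr_ge0// ln_ge0// ler1n.
rewrite leNgt; apply/negP => kgt.
pose M := 8 * ln 2 * s ^+ 2.
(* Stands in for the limit t -> 1: with m = M / k(s) < 1, any t >= (1 + m)/2 has t^2 > m, which
   contradicts [bound t]. *)
pose t := Num.max ((1 + s) / 2) ((1 + M / k s) / 2).
have Mk : M / k s < 1 by rewrite ltr_pdivrMr// mul1r.
have M0 : 0 <= M / k s.
  by rewrite divr_ge0 ?(ltW k0)// /M mulr_ge0 ?sqr_ge0// mulr_ge0// ln_ge0// ler1n.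
have ht : s < t < 1 by rewrite /t lt_max gt_max; apply/and3P; split; lra.
have Mt : (1 + M / k s) / 2 <= t by rewrite /t le_max lexx orbT.
have := bound t ht; rewrite -/M -ler_pdivlMl// mulrC.
move: Mk M0 Mt; set m := M / k s => Mk M0 Mt; nra.
Qed.

(* The difference of the two sides vanishes at [x = 1/2]: the flat triangle with
   its middle vertex at the midpoint has the smallest expected log-length ratio. *)
Lemma xlnx_midpoint_le (x : R) : 0 < x < 1 ->
  x ^+ 3 * ln x + (1 - x) ^+ 3 * ln (1 - x) <= - (x * (1 - x) * ln 2).
Proof.
wlog x12 : x / 2^-1 <= x.
  move=> H /andP[x0 x1]; have [|xlt] := leP 2^-1 x; first by move=> /H; apply; rewrite x0.
  have := H (1 - x); rewrite subKr [_ + (1 - x) ^+ 3 * _]addrC (mulrC x).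
  by apply; lra.
move=> /andP[x0 x1]; pose s := 2 * x - 1.
have := @k_le s; rewrite /k.
have -> : 1 + s = 2 * x by rewrite /s; ring.
have -> : 1 - s = 2 * (1 - x) by rewrite /s; ring.
rewrite !lnM ?posrE//; [|lra..] => /(_ ltac:(rewrite /s; lra)).
rewrite /s; set a := ln x; set b := ln (1 - x); set c := ln 2; nra.
Qed.

Lemma expRN_le_quadratic (z : R) : 0 <= z -> expR (- z) <= 1 - z + z ^+ 2 / 2.
Proof.
move=> z0; pose F (z : R) := 1 - z + z ^+ 2 / 2 - expR (- z).
have F0 : F 0 = 0 by rewrite /F oppr0 expR0; ring.
rewrite -subr_ge0 -/(F z) -F0.
apply: (@is_derive_ge0_le _ F (fun z => expR (- z) - (1 - z)) 0 z z0).
  by move=> x _; rewrite /F; apply: is_derive_eq; rewrite /GRing.scale /=; field.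
by move=> x _; rewrite subr_ge0 expR_ge1Dx.
Qed.

Lemma expR_le_quadratic (z : R) : 0 <= z -> expR z <= 1 + z + z ^+ 2 / 2 * expR z.
Proof.
move=> z0; pose F (z : R) := 1 + z + z ^+ 2 / 2 * expR z - expR z.
have F0 : F 0 = 0 by rewrite /F expR0; ring.
rewrite -subr_ge0 -/(F z) -F0.
apply: (@is_derive_ge0_le _ F
  (fun z => 1 - (1 - z) * expR z + z ^+ 2 / 2 * expR z) 0 z z0).
  by move=> x _; rewrite /F; apply: is_derive_eq; rewrite /GRing.scale /=; field.
move=> x /andP[x0 _]; rewrite addr_ge0//.
  rewrite subr_ge0 -ler_pdivlMr ?expR_gt0// mul1r -expRN.
  exact: expR_ge1Dx.
by rewrite mulr_ge0 ?expR_ge0// divr_ge0// sqr_ge0.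
Qed.

Lemma sqr_le_expR (z : R) : 0 <= z -> z ^+ 2 <= 2 * expR z.
Proof.
by move=> z0; have := expR_ge1Dxn 1 z0; rewrite (_ : 2`! = 2)%N//; lra.
Qed.

(** The remainder t^2 y^2 / 2 is absorbed through (y/2)^2 <= 2 e^(y/2). With y = -ln D the last
    factor is D^(-1/2), whose mean is bounded. *)
Lemma expRN_le_linear (t y : R) : 0 <= t -> 0 <= y ->
  expR (- (t * y)) <= 1 - t * y + 4 * t ^+ 2 * expR (y / 2).
Proof.
move=> t0 y0; rewrite (le_trans (expRN_le_quadratic (mulr_ge0 t0 y0)))// lerD2l.
have := @sqr_le_expR (y / 2); rewrite divr_ge0// => /(_ isT) h.
rewrite exprMn; move: h; set e := expR _; have := sqr_ge0 t.
set q := t ^+ 2; nra.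
Qed.

(** One factor e^(y/4) bounds e^(t y), which is where t <= 1/4 enters, and another absorbs y^2;
    together they make e^(y/2). *)
Lemma expR_le_linear (t y : R) : 0 <= t <= 4^-1 -> 0 <= y ->
  expR (t * y) <= 1 + t * y + 16 * t ^+ 2 * expR (y / 2).
Proof.
move=> /andP[t0 t4] y0; rewrite (le_trans (expR_le_quadratic (mulr_ge0 t0 y0)))// lerD2l.
have := @sqr_le_expR (y / 4); rewrite divr_ge0// => /(_ isT) h.
have -> : expR (y / 2) = expR (y / 4) * expR (y / 4) by rewrite -expRD; congr expR; field.
have : expR (t * y) <= expR (y / 4) by rewrite ler_expR mulrC ler_wpM2l.
rewrite exprMn; move: h; have := expR_ge0 (y / 4); set e := expR (y / 4).
move=> e0 h he.
set x := expR (t * y).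
have -> : t ^+ 2 * y ^+ 2 / 2 * x = t ^+ 2 * (y ^+ 2 / 2 * x) by ring.
have -> : 16 * t ^+ 2 * (e * e) = t ^+ 2 * (16 * e * e) by ring.
apply: ler_wpM2l; first exact: sqr_ge0.
apply: (@le_trans _ _ (y ^+ 2 / 2 * e)); first by rewrite ler_wpM2l// divr_ge0 ?sqr_ge0.
rewrite ler_wpM2r//; move: h; rewrite expr_div_n; lra.
Qed.

End Inequalities.

(** * Integration against the uniform law *)

Section UniformIntegral.
Variable R : realType.
Local Notation mR := (measurableTypeR R).
Local Notation mu := (@lebesgue_measure R).
Local Notation unif := (uniform_prob (@ltr01 R)).
Implicit Types (f g : mR -> \bar R) (a b c s t : R).

Lemma unifE f : measurable_fun setT f -> (forall x, 0 <= f x)%E ->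
  (\int[unif]_x f x = \int[mu]_(x in `]0%R, 1%R[) f x)%E.
Proof.
move=> mf f0; rewrite integral_uniform// subr0 invr1 mul1e.
by rewrite integral_itv_bndoo//; exact: measurable_funTS.
Qed.

Lemma unif_le01 f g : measurable_fun setT f -> measurable_fun setT g ->
  (forall x, 0 <= f x)%E -> (forall x, 0 <= g x)%E ->
  (forall x : R, 0 < x < 1 -> (f x <= g x)%E) ->
  (\int[unif]_x f x <= \int[unif]_x g x)%E.
Proof.
move=> mf mg f0 g0 fg; rewrite !unifE//; by apply: ge0_le_integral => //; exact: measurable_funTS.
Qed.

Lemma unif_le01_except f g (p : R) : measurable_fun setT f -> measurable_fun setT g ->
  (forall x, 0 <= f x)%E -> (forall x, 0 <= g x)%E ->
  (forall x : R, 0 < x < 1 -> x != p -> (f x <= g x)%E) ->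
  (\int[unif]_x f x <= \int[unif]_x g x)%E.
Proof.
move=> mf mg f0 g0 fg; rewrite !unifE//; apply: ae_ge0_le_integral => //.
- exact: measurable_funTS.
- exact: measurable_funTS.
exists [set p]; split; [exact: measurable_set1|exact: lebesgue_measure_set1|].
move=> x /= h; apply: contrapT => xp; apply: h; rewrite in_itv /= => x01.
by apply: fg => //; exact/eqP.
Qed.

Lemma unif_add (f g : mR -> \bar R) : measurable_fun setT f -> measurable_fun setT g ->
  (forall x, 0 <= f x)%E -> (forall x, 0 <= g x)%E ->
  (\int[unif]_x (f x + g x) = \int[unif]_x f x + \int[unif]_x g x)%E.
Proof. by move=> mf mg f0 g0; rewrite ge0_integralD. Qed.

Lemma unif_cst (c : \bar R) : (\int[unif]_x c = c)%E.
Proof.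
by rewrite integral_cst// [X in (_ * X)%E](@probability_setT _ _ _ unif) mule1.
Qed.

Lemma unif_le_cst f (c : R) : measurable_fun setT f -> (forall x, 0 <= f x)%E ->
  0 <= c -> (forall x : R, 0 < x < 1 -> (f x <= c%:E)%E) -> (\int[unif]_x f x <= c%:E)%E.
Proof. by move=> mf f0 c0 fc; rewrite -[leRHS]unif_cst unif_le01. Qed.

Lemma lebesgue_measure_onem (c : R) (A : set mR) : measurable A ->
  pushforward mu (fun x : mR => c - x : mR) A = mu A.
Proof.
move=> mA; apply/esym/lebesgue_measure_unique => //= [|_ _ [[a b]] _ <-].
  exact: measurable_funB.
rewrite /pushforward.
have -> : (fun x : mR => c - x) @^-1` `]a, b]%classic = `[c - b, c - a[%classic.
  by apply/seteqP; split => x /=; rewrite !in_itv /= => /andP[h1 h2]; apply/andP; split; lra.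
rewrite !lebesgue_measure_itv /= !lte_fin.
have -> : (c - b < c - a) = (a < b) by rewrite ltrD2l ltrN2.
by case: ifP => // _; congr EFin; ring.
Qed.

Lemma lebesgue_measure_shift (c : R) (A : set mR) : measurable A ->
  pushforward mu (fun x : mR => x + c : mR) A = mu A.
Proof.
move=> mA; apply/esym/lebesgue_measure_unique => //= [|_ _ [[a b]] _ <-].
  exact: measurable_funD.
rewrite /pushforward.
have -> : (fun x : mR => x + c) @^-1` `]a, b]%classic = `]a - c, b - c]%classic.
  by apply/seteqP; split => x /=; rewrite !in_itv /= => /andP[h1 h2]; apply/andP; split; lra.
rewrite !lebesgue_measure_itv /= !lte_fin.
have -> : (a - c < b - c) = (a < b) by rewrite ltrD2r.
by case: ifP => // _; congr EFin; ring.
Qed.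

Lemma unif_onem f : measurable_fun setT f -> (forall x, 0 <= f x)%E ->
  (\int[unif]_x f (1 - x)%R = \int[unif]_x f x)%E.
Proof.
move=> mf f0; have m1 : measurable_fun setT (fun x : mR => 1 - x : mR).
  by apply: measurable_funB.
rewrite !unifE//; last exact: (measurableT_comp mf m1).
have E : `]0, 1[%classic = (fun x : mR => 1 - x : mR) @^-1` `]0, 1[%classic.
  by apply/seteqP; split => x /=; rewrite !in_itv /= => /andP[h1 h2]; apply/andP; split; lra.
rewrite [in LHS]E -[LHS](ge0_integral_pushforward m1 mu (f := f))//.
  by apply: eq_measure_integral => A mA _; exact: lebesgue_measure_onem.
exact: measurable_funTS.
Qed.

Lemma integral_shift f (a b c : R) : measurable_fun setT f -> (forall x, 0 <= f x)%E ->
  (\int[mu]_(x in `]a, b[) f x = \int[mu]_(x in `](a - c)%R, (b - c)%R[) f (x + c)%R)%E.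
Proof.
move=> mf f0; have m1 : measurable_fun setT (fun x : mR => x + c : mR).
  by apply: measurable_funD.
have -> : `]a - c, b - c[%classic = (fun x : mR => x + c : mR) @^-1` `]a, b[%classic.
  by apply/seteqP; split => x /=; rewrite !in_itv /= => /andP[h1 h2]; apply/andP; split; lra.
rewrite -[RHS](ge0_integral_pushforward m1 mu (f := f))//.
  by apply: eq_measure_integral => A mA _; apply/esym/lebesgue_measure_shift.
exact: measurable_funTS.
Qed.

Lemma integral_itvoo_split f (a b c : R) : a < b < c -> measurable_fun setT f ->
  (forall x, 0 <= f x)%E ->
  (\int[mu]_(x in `]a, c[) f x =
   \int[mu]_(x in `]a, b[) f x + \int[mu]_(x in `]b, c[) f x)%E.
Proof.
move=> /andP[ab bc] mf f0.
have -> : `]a, c[%classic = `]a, b] `|` `]b, c[%classic :> set R.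
  apply/seteqP; split => x /=; rewrite !in_itv /=.
    by move=> /andP[h1 h2]; have [h|h] := leP x b; [left|right]; apply/andP; split.
  by case=> /andP[h1 h2]; apply/andP; split; lra.
rewrite ge0_integral_setU//; last 2 first.
- exact: measurable_funTS.
- apply/disj_setPS => x [] /=; rewrite !in_itv /= => /andP[_ h1] /andP[h2 _].
  by move: (le_lt_trans h1 h2); rewrite ltxx.
by rewrite integral_itv_bndoo//; exact: measurable_funTS.
Qed.

(** [f] has to agree with [h] only inside (0, 1), so a truncated or iterated integrand can be
    replaced by its closed form there. *)
Lemma unif_FTC f (h F : R -> R) : measurable_fun setT f -> (forall x, 0 <= f x)%E ->
  (forall x : R, 0 < x < 1 -> f x = (h x)%:E) ->
  (forall x : R, 0 < x < 1 -> {for x, continuous h}) ->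
  (forall x : R, 0 < x < 1 -> is_derive x 1 F (h x)) ->
  {for 0, continuous F} -> {for 1, continuous F} ->
  (\int[unif]_x f x = (F 1 - F 0)%:E)%E.
Proof.
move=> mf f0 fh ch dF F0 F1; rewrite unifE//.
rewrite -(@integral_itvoo_FTC _ h F 0 1)//.
  by apply: eq_integral => x; rewrite inE /= in_itv /=; exact: fh.
by move=> x x01; rewrite -lee_fin -fh.
Qed.

End UniformIntegral.

(** * Measurability of compound integrands *)

Section MeasurableClosure.
Context d (T : measurableType d) (R : realType).
Implicit Types f g : T -> R.

(** Truncated at 0 so that the integrand is nonnegative on the whole line; on (0, 1], where the
    ratios of interest lie, it is -ln x. *)
Definition nln (x : R) : R := Num.max 0 (- ln x).
(** This is |x|^(-1/2) for x != 0. Written with [expR] and [ln], it is positive everywhere and takes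
    the value 1 at 0. *)
Definition isqrt (x : R) : R := expR (- ln `|x| / 2).
Definition range3 (a b c : R) : R :=
  Num.max a (Num.max b c) - Num.min a (Num.min b c).

Lemma measurable_add f g : measurable_fun setT f -> measurable_fun setT g ->
  measurable_fun setT (fun x => f x + g x).
Proof. exact: measurable_funD. Qed.

Lemma measurable_sub f g : measurable_fun setT f -> measurable_fun setT g ->
  measurable_fun setT (fun x => f x - g x).
Proof. exact: measurable_funB. Qed.

Lemma measurable_mul f g : measurable_fun setT f -> measurable_fun setT g ->
  measurable_fun setT (fun x => f x * g x).
Proof. exact: measurable_funM. Qed.

Lemma measurable_neg f : measurable_fun setT f -> measurable_fun setT (fun x => - f x).
Proof. exact: measurable_funN. Qed.

Lemma measurable_max f g : measurable_fun setT f -> measurable_fun setT g ->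
  measurable_fun setT (fun x => Num.max (f x) (g x)).
Proof. exact: measurable_maxr. Qed.

Lemma measurable_min f g : measurable_fun setT f -> measurable_fun setT g ->
  measurable_fun setT (fun x => Num.min (f x) (g x)).
Proof. exact: measurable_minr. Qed.

Lemma measurable_lncomp f : measurable_fun setT f -> measurable_fun setT (fun x => ln (f x)).
Proof. by move=> mf; apply: measurableT_comp mf; exact: measurable_ln. Qed.

Lemma measurable_expcomp f : measurable_fun setT f -> measurable_fun setT (fun x => expR (f x)).
Proof. by move=> mf; apply: measurableT_comp mf; exact: measurable_expR. Qed.

Lemma measurable_normcomp f : measurable_fun setT f -> measurable_fun setT (fun x => `|f x|).
Proof. by move=> mf; apply: measurableT_comp mf; exact: normr_measurable. Qed.

Lemma measurable_fstcomp d1 (T1 : measurableType d1) d2 (T2 : measurableType d2)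
    (h : T -> T1 * T2) :
  measurable_fun setT h -> measurable_fun setT (fun x => (h x).1).
Proof. by move=> mh; apply: measurableT_comp mh; exact: measurable_fst. Qed.

Lemma measurable_sndcomp d1 (T1 : measurableType d1) d2 (T2 : measurableType d2)
    (h : T -> T1 * T2) :
  measurable_fun setT h -> measurable_fun setT (fun x => (h x).2).
Proof. by move=> mh; apply: measurableT_comp mh; exact: measurable_snd. Qed.

End MeasurableClosure.

(** Syntax-directed on the operation under the binder. The preceding lemmas restate closure
    properties in pointwise form so that they unify with integrands written as lambda terms; goals
    of any other shape are left open. *)
Ltac meas := rewrite ?/nln ?/isqrt ?/range3; meas_rec
with meas_rec := lazymatch goal with
  | |- measurable_fun _ (fun _ => ?c) => exact: measurable_cst
  | |- measurable_fun _ (fun x => x) => exact: measurable_id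
  | |- measurable_fun _ (fun x => EFin (@?f x)) => apply/measurable_EFinP; meas_rec
  | |- measurable_fun _ (EFin \o (fun x => @?f x)) => apply/measurable_EFinP; meas_rec
  | |- measurable_fun _ (fun x => @?f x - @?g x) => apply: (@measurable_sub _ _ _ f g); meas_rec
  | |- measurable_fun _ (fun x => @?f x + @?g x) => apply: (@measurable_add _ _ _ f g); meas_rec
  | |- measurable_fun _ (fun x => @?f x * @?g x) => apply: (@measurable_mul _ _ _ f g); meas_rec
  | |- measurable_fun _ (fun x => - @?f x) => apply: (@measurable_neg _ _ _ f); meas_rec
  | |- measurable_fun _ (fun x => Num.max (@?f x) (@?g x)) => apply: (@measurable_max _ _ _ f g); meas_rec
  | |- measurable_fun _ (fun x => Num.min (@?f x) (@?g x)) => apply: (@measurable_min _ _ _ f g); meas_rec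
  | |- measurable_fun _ (fun x => ln (@?f x)) => apply: (@measurable_lncomp _ _ _ f); meas_rec
  | |- measurable_fun _ (fun x => expR (@?f x)) => apply: (@measurable_expcomp _ _ _ f); meas_rec
  | |- measurable_fun _ (fun x => Num.norm (@?f x)) => apply: (@measurable_normcomp _ _ _ f); meas_rec
  | |- measurable_fun _ (fun x => (@?f x, @?g x)) => apply: (@measurable_fun_pair _ _ _ _ _ _ f g); meas_rec
  | |- measurable_fun _ (fun x => fst x) => exact: measurable_fst
  | |- measurable_fun _ (fun x => snd x) => exact: measurable_snd
  | |- measurable_fun _ (fun x => fst (@?f x)) => apply: (@measurable_fstcomp _ _ _ _ _ _ f); meas_rec
  | |- measurable_fun _ (fun x => snd (@?f x)) => apply: (@measurable_sndcomp _ _ _ _ _ _ f); meas_rec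
  | |- _ => idtac
  end.

(** * Iterated integrals over three independent uniform variables *)

Section TripleIntegral.
Variable R : realType.
Local Notation mR := (measurableTypeR R).
Local Notation unif := (uniform_prob (@ltr01 R)).
Implicit Types F G : mR -> mR -> mR -> \bar R.
Local Open Scope ereal_scope.

Definition uniform3 F : \bar R :=
  \int[unif]_u \int[unif]_v \int[unif]_w F u v w.

(** Joint measurability and nonnegativity are what Tonelli needs to permute the three integrals. *)
Definition nonneg_measurable3 F : Prop :=
  measurable_fun setT (fun p : mR * mR * mR => F p.1.1 p.1.2 p.2) /\
  forall u v w, 0 <= F u v w.

Lemma measurable_unif d (T : measurableType d) (f : T -> mR -> \bar R) :
  measurable_fun setT (fun p : T * mR => f p.1 p.2) ->
  (forall t w, 0 <= f t w) -> measurable_fun setT (fun t => \int[unif]_w f t w).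
Proof.
move=> mf f0.
exact: (@measurable_fun_fubini_tonelli_F _ _ _ _ _ unif (fun p : T * mR => f p.1 p.2)).
Qed.

Lemma unif_swap (f : mR -> mR -> \bar R) :
  measurable_fun setT (fun p : mR * mR => f p.1 p.2) -> (forall u v, 0 <= f u v) ->
  \int[unif]_u \int[unif]_v f u v = \int[unif]_v \int[unif]_u f u v.
Proof.
by move=> mf f0; apply: (@fubini_tonelli _ _ _ _ _ unif unif (fun p : mR * mR => f p.1 p.2)).
Qed.

Lemma measurable_section (d : measure_display) (T : measurableType d) (f : T -> mR -> \bar R) t :
  measurable_fun setT (fun p : T * mR => f p.1 p.2) -> measurable_fun setT (f t).
Proof. by move=> mf; exact: (measurableT_comp mf (pair1_measurable t)). Qed.

Lemma measurable_section3 F u : nonneg_measurable3 F ->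
  measurable_fun setT (fun p : mR * mR => F u p.1 p.2).
Proof.
move=> [mF _]; apply: (measurableT_comp mF (g := fun p : mR * mR => (u, p.1, p.2))).
by meas.
Qed.

Lemma measurable_inner F u v : nonneg_measurable3 F -> measurable_fun setT (F u v).
Proof.
by move=> /(measurable_section3 u) mF; apply: (@measurable_section _ _ (F u)).
Qed.

Lemma measurable_unif1 F : nonneg_measurable3 F ->
  measurable_fun setT (fun p : mR * mR => \int[unif]_w F p.1 p.2 w).
Proof.
move=> [mF F0].
by apply: (@measurable_unif _ _ (fun (p : mR * mR) w => F p.1 p.2 w)).
Qed.

Lemma measurable_unif1_section F u : nonneg_measurable3 F ->
  measurable_fun setT (fun v => \int[unif]_w F u v w).
Proof.
move=> nF; apply: (@measurable_section _ _ (fun u v => \int[unif]_w F u v w)).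
exact: measurable_unif1.
Qed.

Lemma measurable_unif2 F : nonneg_measurable3 F ->
  measurable_fun setT (fun u => \int[unif]_v \int[unif]_w F u v w).
Proof.
move=> nF; apply: (@measurable_unif _ _ (fun u v => \int[unif]_w F u v w)).
  exact: measurable_unif1.
by move=> u v; apply: integral_ge0 => w _; exact: nF.2.
Qed.

Lemma unif1_ge0 F u v : nonneg_measurable3 F -> 0 <= \int[unif]_w F u v w.
Proof. by move=> nF; apply: integral_ge0 => w _; exact: nF.2. Qed.

Lemma unif2_ge0 F u : nonneg_measurable3 F -> 0 <= \int[unif]_v \int[unif]_w F u v w.
Proof. by move=> nF; apply: integral_ge0 => v _; exact: unif1_ge0. Qed.

Lemma uniform3_ge0 F : nonneg_measurable3 F -> 0 <= uniform3 F.
Proof. by move=> nF; apply: integral_ge0 => u _; exact: unif2_ge0. Qed.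

Lemma uniform3_swap23 F : nonneg_measurable3 F ->
  uniform3 F = uniform3 (fun u w v => F u v w).
Proof.
move=> nF; apply: eq_integral => u _.
by apply: unif_swap => [|v w]; [exact: measurable_section3|exact: nF.2].
Qed.

Lemma uniform3_swap12 F : nonneg_measurable3 F ->
  uniform3 F = uniform3 (fun v u w => F u v w).
Proof.
move=> nF; apply: (unif_swap (f := fun u v => \int[unif]_w F u v w)).
  exact: measurable_unif1.
by move=> u v; exact: unif1_ge0.
Qed.

Lemma nonneg_measurable3_swap12 F : nonneg_measurable3 F ->
  nonneg_measurable3 (fun v u w => F u v w).
Proof.
move=> [mF F0]; split => //.
apply: (measurableT_comp mF (g := fun p : mR * mR * mR => (p.1.2, p.1.1, p.2))).
by meas.
Qed.

Lemma uniform3_le F G : nonneg_measurable3 F -> nonneg_measurable3 G ->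
  (forall u v w : R, (0 < u < 1)%R -> (0 < v < 1)%R -> (0 < w < 1)%R ->
    F u v w <= G u v w) -> uniform3 F <= uniform3 G.
Proof.
move=> nF nG FG; apply: unif_le01.
- exact: measurable_unif2.
- exact: measurable_unif2.
- by move=> u; exact: unif2_ge0.
- by move=> u; exact: unif2_ge0.
move=> u u01; apply: unif_le01.
- exact: measurable_unif1_section.
- exact: measurable_unif1_section.
- by move=> v; exact: unif1_ge0.
- by move=> v; exact: unif1_ge0.
move=> v v01; apply: unif_le01.
- exact: measurable_inner.
- exact: measurable_inner.
- by move=> w; exact: nF.2.
- by move=> w; exact: nG.2.
by move=> w w01; exact: FG.
Qed.

Lemma uniform3_cst (c : \bar R) : uniform3 (fun _ _ _ => c) = c.
Proof. by rewrite /uniform3 !unif_cst. Qed.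

Lemma uniform3D F G : nonneg_measurable3 F -> nonneg_measurable3 G ->
  uniform3 (fun u v w => F u v w + G u v w) = uniform3 F + uniform3 G.
Proof.
move=> nF nG; rewrite /uniform3 -ge0_integralD//.
- apply: eq_integral => u _; rewrite -ge0_integralD//.
  + apply: eq_integral => v _; rewrite ge0_integralD//.
    * by move=> w _; exact: nF.2.
    * exact: measurable_inner.
    * by move=> w _; exact: nG.2.
    * exact: measurable_inner.
  + by move=> v _; exact: unif1_ge0.
  + exact: measurable_unif1_section.
  + by move=> v _; exact: unif1_ge0.
  + exact: measurable_unif1_section.
- by move=> u _; exact: unif2_ge0.
- exact: measurable_unif2.
- by move=> u _; exact: unif2_ge0.
- exact: measurable_unif2.
Qed.

Lemma uniform3Z F (c : R) : (0 <= c)%R -> nonneg_measurable3 F ->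
  uniform3 (fun u v w => c%:E * F u v w) = c%:E * uniform3 F.
Proof.
move=> c0 nF; rewrite /uniform3 -ge0_integralZl_EFin//.
- apply: eq_integral => u _; rewrite -ge0_integralZl_EFin//.
  + apply: eq_integral => v _; rewrite ge0_integralZl_EFin//.
    * by move=> w _; exact: nF.2.
    * exact: measurable_inner.
  + by move=> v _; exact: unif1_ge0.
  + exact: measurable_unif1_section.
- by move=> u _; exact: unif2_ge0.
- exact: measurable_unif2.
Qed.

Lemma nonneg_measurable3D F G : nonneg_measurable3 F -> nonneg_measurable3 G ->
  nonneg_measurable3 (fun u v w => F u v w + G u v w).
Proof.
move=> [mF F0] [mG G0]; split; first exact: emeasurable_funD.
by move=> *; rewrite adde_ge0.
Qed.

Lemma nonneg_measurable3Z F (c : R) : (0 <= c)%R -> nonneg_measurable3 F ->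
  nonneg_measurable3 (fun u v w => c%:E * F u v w).
Proof.
move=> c0 [mF F0]; split; first exact: emeasurable_funM.
by move=> *; rewrite mule_ge0.
Qed.

Lemma nonneg_measurable3_cst (c : R) : (0 <= c)%R ->
  nonneg_measurable3 (fun _ _ _ => c%:E).
Proof. by move=> c0; split => // *; rewrite lee_fin. Qed.

Lemma uniform3_le_cst F (c : R) : nonneg_measurable3 F -> (0 <= c)%R ->
  (forall u v : R, (0 < u < 1)%R -> (0 < v < 1)%R -> \int[unif]_w F u v w <= c%:E) ->
  uniform3 F <= c%:E.
Proof.
move=> nF c0 Fc; apply: unif_le_cst => //.
- exact: measurable_unif2.
- by move=> u; exact: unif2_ge0.
move=> u u01; apply: unif_le_cst => //.
- exact: measurable_unif1_section.
- by move=> v; exact: unif1_ge0.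
by move=> v; exact: Fc.
Qed.

(** Serves to reverse the direction in which the three sides are parametrised. *)
Lemma uniform3_onem F : nonneg_measurable3 F ->
  uniform3 (fun u v w => F (1 - u)%R (1 - v)%R (1 - w)%R) = uniform3 F.
Proof.
move=> nF; rewrite /uniform3.
rewrite -[RHS]unif_onem; last 2 first.
- exact: measurable_unif2.
- by move=> u; exact: unif2_ge0.
apply: eq_integral => u _; rewrite -[RHS]unif_onem; last 2 first.
- exact: measurable_unif1_section.
- by move=> v; exact: unif1_ge0.
apply: eq_integral => v _; rewrite -[RHS]unif_onem//.
- exact: measurable_inner.
- by move=> w; exact: nF.2.
Qed.

Lemma uniform3_onem12 F : nonneg_measurable3 F ->
  uniform3 (fun u v w => F (1 - u)%R (1 - v)%R w) = uniform3 F.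
Proof.
move=> nF; rewrite /uniform3.
rewrite -[RHS]unif_onem; last 2 first.
- exact: measurable_unif2.
- by move=> u; exact: unif2_ge0.
apply: eq_integral => u _; rewrite -[RHS]unif_onem//.
- exact: measurable_unif1_section.
- by move=> v; exact: unif1_ge0.
Qed.

End TripleIntegral.

(** * Inverse square roots of affine forms in a uniform variable *)

Section InverseSquareRoot.
Variable R : realType.
Local Notation mR := (measurableTypeR R).
Local Notation mu := (@lebesgue_measure R).
Local Notation unif := (uniform_prob (@ltr01 R)).

Lemma isqrt_gt0 (x : R) : 0 < isqrt x.
Proof. exact: expR_gt0. Qed.

Lemma isqrt1 : isqrt 1 = 1 :> R.
Proof. by rewrite /isqrt normr1 ln1 oppr0 mul0r expR0. Qed.

Lemma isqrtN (x : R) : isqrt (- x) = isqrt x.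
Proof. by rewrite /isqrt normrN. Qed.

Lemma isqrtM (x y : R) : x != 0 -> y != 0 -> isqrt (x * y) = isqrt x * isqrt y.
Proof.
move=> x0 y0; rewrite /isqrt normrM lnM ?posrE ?normr_gt0// -expRD.
by congr expR; field.
Qed.

Lemma isqrt_le (x y : R) : 0 < x -> x <= `|y| -> isqrt y <= isqrt x.
Proof.
move=> x0 xy; rewrite /isqrt ler_expR ler_pM2r// lerN2 (gtr0_norm x0).
by rewrite ler_ln ?posrE// (lt_le_trans x0).
Qed.

Lemma isqrtE (x : R) : 0 < x -> isqrt x = (Num.sqrt x)^-1.
Proof.
move=> x0; have s0 : 0 < Num.sqrt x by rewrite sqrtr_gt0.
rewrite /isqrt gtr0_norm// -{1}(sqr_sqrtr (ltW x0)) lnXn//.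
rewrite (_ : - (ln (Num.sqrt x) *+ 2) / 2 = - ln (Num.sqrt x)); last by field.
by rewrite expRN lnK.
Qed.

Lemma isqrt_half_le : isqrt 2^-1 <= 2 :> R.
Proof.
rewrite isqrtE// -sqrtrV// invrK.
by rewrite -[leRHS](@ger0_norm R)// -sqrtr_sqr ler_wsqrtr//; lra.
Qed.

Lemma measurable_isqrt_shift (c : R) :
  measurable_fun setT (fun u : mR => (isqrt (u + c))%:E).
Proof. by meas. Qed.

Lemma integral_isqrt_right (c p q : R) : p < q -> 0 <= p + c ->
  (\int[mu]_(u in `]p, q[) (isqrt (u + c))%:E =
   (2 * Num.sqrt (q + c) - 2 * Num.sqrt (p + c))%:E)%E.
Proof.
move=> pq pc.
have cs : continuous (fun u : R => 2 * Num.sqrt (u + c)).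
  move=> x; apply: cvgM; first exact: cvg_cst.
  apply: (@continuous_comp _ _ _ (fun u : R => u + c) Num.sqrt).
    by apply: continuousD => //; exact: cvg_cst.
  exact: sqrt_continuous.
have dF (x : R) : p < x < q -> is_derive x 1 (fun u : R => 2 * Num.sqrt (u + c)) (isqrt (x + c)).
  move=> /andP[px xq]; have xc : 0 < x + c by lra.
  have h := is_derive1_sqrt xc.
  have h2 : is_derive x 1 (fun u : R => u + c) 1 by apply: is_derive_eq; rewrite addr0.
  have h3 := @is_derive1_comp _ Num.sqrt (fun u : R => u + c) x _ _ h h2.
  have h4 : is_derive x 1 (fun u : R => Num.sqrt (u + c)) ((2 * Num.sqrt (x + c))^-1 * 1) by exact: h3.
  apply: is_derive_eq; rewrite isqrtE// /GRing.scale /=.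
  by field; rewrite lt0r_neq0 // sqrtr_gt0.
apply: (@integral_itvoo_FTC _ (fun u => isqrt (u + c))) => //.
- by move=> x _; exact/ltW/isqrt_gt0.
- move=> x /andP[px xq]; have xc : 0 < x + c by lra.
  rewrite /isqrt; apply: continuous_comp; last exact: continuous_expR.
  apply: continuousM; last exact: cvg_cst.
  apply: continuousN; apply: (@continuous_comp _ _ _ (fun u : R => `|u + c|) (@ln R)); last first.
    by apply: continuous_ln; rewrite gtr0_norm.
  apply: (@continuous_comp _ _ _ (fun u : R => u + c) (@Num.norm R R)); last exact: norm_continuous.
  by apply: continuousD => //; exact: cvg_cst.
- exact: cs.
- exact: cs.
Qed.

Lemma integral_isqrt_left (c p q : R) : p < q -> q + c <= 0 ->
  (\int[mu]_(u in `]p, q[) (isqrt (u + c))%:E =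
   (2 * Num.sqrt (- p - c) - 2 * Num.sqrt (- q - c))%:E)%E.
Proof.
move=> pq qc.
have qp : - q < - p by rewrite ltrN2.
have qc' : 0 <= - q - c by lra.
rewrite -(integral_isqrt_right qp qc').
have m1 : measurable_fun setT (fun x : mR => 0 - x : mR) by meas.
have -> : `]p, q[%classic = (fun x : mR => 0 - x : mR) @^-1` `]- q, - p[%classic.
  by apply/seteqP; split => x /=; rewrite !in_itv /= => /andP[h1 h2]; apply/andP; split; lra.
have -> : (\int[mu]_(u in `](- q)%R, (- p)%R[) (isqrt (u - c))%:E =
    \int[pushforward mu (fun x : mR => 0 - x : mR)%R]_(u in `](- q)%R, (- p)%R[) (isqrt (u - c))%:E)%E.
  by apply: eq_measure_integral => A mA _; apply/esym/lebesgue_measure_onem.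
rewrite (ge0_integral_pushforward m1 mu); first last.
- by move=> x _; rewrite lee_fin ltW// isqrt_gt0.
- by apply: measurable_funTS; exact: measurable_isqrt_shift.
- exact: measurable_itv.
by apply: eq_integral => x _ /=; rewrite -isqrtN; congr (isqrt _)%:E; ring.
Qed.

Lemma sqrt_le_shift (x : R) : 0 <= x -> Num.sqrt (1 + x) <= 1 + Num.sqrt x.
Proof.
move=> x0; have s0 := sqrtr_ge0 x.
rewrite -[leRHS]ger0_norm ?addr_ge0// -sqrtr_sqr ler_wsqrtr//.
by rewrite sqrrD sqr_sqrtr// expr1n mul1r; lra.
Qed.

(** The bound is uniform in c: the singularity -c lies left of, right of or inside (0, 1), and on
    either side of it the primitive 2 sqrt|u + c| varies by at most 2. *)
Lemma unif_isqrt_shift_le (c : R) : (\int[unif]_u (isqrt (u + c))%:E <= 4%:E)%E.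
Proof.
have i0 (u : R) : (0 <= (isqrt (u + c))%:E)%E by rewrite lee_fin ltW// isqrt_gt0.
have mi := measurable_isqrt_shift c.
rewrite unifE//.
have [c0|c0] := leP 0 c.
  rewrite integral_isqrt_right ?add0r// lee_fin.
  by have := sqrt_le_shift c0; lra.
have [c1|c1] := leP (1 + c) 0.
  rewrite integral_isqrt_left// lee_fin oppr0 sub0r.
  have h : 0 <= - 1 - c by lra.
  have := sqrt_le_shift h; rewrite (_ : 1 + (- 1 - c) = - c); last by ring.
  by lra.
rewrite (@integral_itvoo_split _ _ 0 (- c) 1) => //; last by apply/andP; split; lra.
rewrite integral_isqrt_left//; [|lra..].
rewrite integral_isqrt_right//; [|lra..].
rewrite -EFinD lee_fin.
rewrite (_ : - - c - c = 0); last by ring.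
rewrite (_ : - c + c = 0); last by ring.
rewrite sqrtr0.
have h1 : Num.sqrt (- 0 - c) <= 1 by rewrite -[leRHS]sqrtr1 ler_wsqrtr//; lra.
have h2 : Num.sqrt (1 + c) <= 1 by rewrite -[leRHS]sqrtr1 ler_wsqrtr//; lra.
lra.
Qed.

(** The form is a times u + b/a, and [isqrt] is multiplicative away from its zero, which is a single
    null point. *)
Lemma unif_isqrt_affine_le (a b : R) : a != 0 ->
  (\int[unif]_u (isqrt (b + a * u))%:E <= (4 * isqrt a)%:E)%E.
Proof.
move=> a0.
have m1 (c : R) := measurable_isqrt_shift c.
pose c := b / a.
have mpt : measurable_fun setT (fun u : mR => (isqrt a * isqrt (u + c))%:E) by meas.
rewrite mulrC EFinM; apply: (@le_trans _ _ ((isqrt a)%:E * \int[unif]_u (isqrt (u + c))%:E)%E); last first.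
  by apply: lee_wpmul2l; [rewrite lee_fin ltW// isqrt_gt0|exact: unif_isqrt_shift_le].
rewrite -ge0_integralZl_EFin//; last 2 first.
- by move=> x _; rewrite lee_fin ltW// isqrt_gt0.
- by rewrite ltW// isqrt_gt0.
apply: (@unif_le01_except _ _ _ (- c)) => //.
- by meas.
- by move=> x; rewrite lee_fin ltW// isqrt_gt0.
- by move=> x; rewrite -EFinM lee_fin mulr_ge0// ltW// isqrt_gt0.
move=> x _ xc; have xc0 : x + c != 0 by rewrite addr_eq0.
rewrite -EFinM lee_fin -isqrtM // /c; rewrite (_ : b + a * x = a * (x + b / a))//.
by field.
Qed.

Lemma unif_point_eq0 (a b : R) : a != 0 ->
  (\int[unif]_u (if (b + a * u == 0)%R then +oo else 0) = 0)%E.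
Proof.
move=> a0.
apply/eqP; rewrite eq_le; apply/andP; split; last first.
  by apply: integral_ge0 => u _; case: ifP.
rewrite -[leRHS](@integral0 _ _ _ unif setT).
apply: (@unif_le01_except _ _ _ (- (b / a))) => //.
- apply: (@measurable_fun_ifT _ _ _ _ (cst +oo%E) (cst 0%E) (fun u : mR => b + a * u == 0)) => //.
  by apply: measurable_fun_eqr => //; meas.
- by move=> u; case: ifP.
move=> x _ xc; case: ifPn => // /eqP e; case/eqP: xc.
have -> : x = (b + a * x) / a - b / a by field.
by rewrite e mul0r sub0r.
Qed.

End InverseSquareRoot.

(** * Mean logarithmic contraction of the range *)

Section XLogX.
Variable R : realType.

(** Primitives on (0, +oo) of ln t, t ln t, [xi1] and t^2 ln t respectively. Each is a polynomial
    times t ln t plus a polynomial, hence continuous at 0. *)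
Definition xi0 (t : R) : R := t * ln t - t.
Definition xi1 (t : R) : R := t ^+ 2 / 2 * ln t - t ^+ 2 / 4.
Definition xi2 (t : R) : R := t ^+ 3 / 6 * ln t - 5 * t ^+ 3 / 36.
Definition xi3 (t : R) : R := t ^+ 3 / 3 * ln t - t ^+ 3 / 9.

Lemma is_derive_xi0 (t : R) : 0 < t -> is_derive t 1 xi0 (ln t).
Proof.
move=> t0; have h := is_derive1_ln t0; rewrite /xi0.
by apply: is_derive_eq; rewrite /GRing.scale /=; field; rewrite lt0r_neq0.
Qed.

Lemma is_derive_xi1 (t : R) : 0 < t -> is_derive t 1 xi1 (t * ln t).
Proof.
move=> t0; have h := is_derive1_ln t0; rewrite /xi1.
by apply: is_derive_eq; rewrite /GRing.scale /=; field; rewrite lt0r_neq0.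
Qed.

Lemma is_derive_xi2 (t : R) : 0 < t -> is_derive t 1 xi2 (xi1 t).
Proof.
move=> t0; have h := is_derive1_ln t0; rewrite /xi2 /xi1.
by apply: is_derive_eq; rewrite /GRing.scale /=; field; rewrite lt0r_neq0.
Qed.

Lemma is_derive_xi3 (t : R) : 0 < t -> is_derive t 1 xi3 (t ^+ 2 * ln t).
Proof.
move=> t0; have h := is_derive1_ln t0; rewrite /xi3.
by apply: is_derive_eq; rewrite /GRing.scale /=; field; rewrite lt0r_neq0.
Qed.

Let continuous_poly_xlnx (p q : R -> R) : continuous p -> continuous q ->
  continuous (fun t => p t * (t * ln t) + q t).
Proof.
move=> cp cq t; apply: cvgD; last exact: cq.
by apply: cvgM; [exact: cp|exact: continuous_xlnx].
Qed.

Let continuous_mulrX (c : R) n : continuous (fun t : R => c * t ^+ n).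
Proof. by move=> t; apply: cvgM; [exact: cvg_cst|exact: exprn_continuous]. Qed.

Lemma continuous_xi0 : continuous xi0.
Proof.
have -> : xi0 = fun t => 1 * t ^+ 0 * (t * ln t) + -1 * t ^+ 1.
  by apply/funext => t; rewrite /xi0 expr0; ring.
exact: continuous_poly_xlnx.
Qed.

Lemma continuous_xi1 : continuous xi1.
Proof.
have -> : xi1 = fun t => 2^-1 * t ^+ 1 * (t * ln t) + (- 4^-1) * t ^+ 2.
  by apply/funext => t; rewrite /xi1; field.
exact: continuous_poly_xlnx.
Qed.

Lemma continuous_xi2 : continuous xi2.
Proof.
have -> : xi2 = fun t => 6^-1 * t ^+ 2 * (t * ln t) + (- (5 / 36)) * t ^+ 3.
  by apply/funext => t; rewrite /xi2; field.
exact: continuous_poly_xlnx.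
Qed.

Lemma continuous_xi3 : continuous xi3.
Proof.
have -> : xi3 = fun t => 3^-1 * t ^+ 2 * (t * ln t) + (- 9^-1) * t ^+ 3.
  by apply/funext => t; rewrite /xi3; field.
exact: continuous_poly_xlnx.
Qed.

(** Inner arguments are kept in the literal form c + k * y, even as W + -1 * u or 0 + 1 * u, so that
    this lemma and [continuous_affine_comp] apply by unification. *)
Lemma is_derive_affine_comp (G : R -> R) (c k x d : R) :
  is_derive (c + k * x) 1 G d -> is_derive x 1 (fun y => G (c + k * y)) (d * k).
Proof.
move=> dG; have h2 : is_derive x 1 (fun y : R => c + k * y) k.
  by apply: is_derive_eq; rewrite /GRing.scale /=; ring.
exact: (@is_derive1_comp _ G (fun y : R => c + k * y) x _ _ dG h2).
Qed.

Lemma continuous_affine_comp (G : R -> R) (c k : R) :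
  continuous G -> continuous (fun y => G (c + k * y)).
Proof.
move=> cG x; apply: (@continuous_comp _ _ _ (fun y : R => c + k * y) G); last exact: cG.
by apply: cvgD; [exact: cvg_cst|apply: cvgM; [exact: cvg_cst|exact: cvg_id]].
Qed.

(** The derivative is an implicit class argument: continuity of a compound expression is inferred
    from the [is_derive] facts in context. *)
Lemma ex_derive_continuous (G : R -> R) (x d : R) {h : is_derive x 1 G d} :
  {for x, continuous G}.
Proof. exact: is_derive_continuous h. Qed.

End XLogX.

(** * Mean logarithm of the new range for a normalised flat triangle *)

Section FlatLength.
Variable R : realType.
Local Notation mR := (measurableTypeR R).
Local Notation mu := (@lebesgue_measure R).
Local Notation unif := (uniform_prob (@ltr01 R)).

Lemma nlnE (x : R) : x <= 1 -> nln x = - ln x.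
Proof. by move=> x1; rewrite /nln; apply: max_r; rewrite oppr_ge0 ln_le0. Qed.

Lemma nln_ge0 (x : R) : 0 <= nln x.
Proof. by rewrite /nln le_max lexx. Qed.

Lemma measurable_nln_range3 (a b : R) :
  measurable_fun setT (fun u : mR => (nln (range3 a b u))%:E).
Proof. by meas. Qed.

(** For fixed V < W and a third point u, the range is W - u, W - V or u - V according as u lies left
    of, between or right of them. *)
Lemma unif_nln_range3 (V W : R) : 0 < V -> V < W -> W < 1 ->
  (\int[unif]_u (nln (range3 W V u))%:E =
  (1 - (W - V) - W * ln W - (1 - V) * ln (1 - V) + (W - V) * ln (W - V))%:E)%E.
Proof.
move=> V0 VW W1; have mf := measurable_nln_range3 W V.
have f0 (u : R) : (0 <= (nln (range3 W V u))%:E)%E by rewrite lee_fin nln_ge0.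
rewrite unifE// (@integral_itvoo_split _ _ 0 V 1) //; last by rewrite V0 (lt_trans VW).
rewrite (@integral_itvoo_split _ _ V W 1) //; last by rewrite VW.
pose F u := xi0 (W + -1 * u).
have -> : (\int[mu]_(u in `]0%R, V[) (nln (range3 W V u))%:E = (F V - F 0)%:E)%E.
  transitivity (\int[mu]_(u in `]0%R, V[) (- ln (W + -1 * u))%:E)%E; last first.
    apply: (@integral_itvoo_FTC _ (fun u => - ln (W + -1 * u)) F).
    - exact: V0.
    - by move=> u /andP[u0 uV]; rewrite oppr_ge0 ln_le0//; lra.
    - move=> u /andP[u0 uV]; have p : 0 < W + -1 * u by lra.
      have h := is_derive_affine_comp (is_derive1_ln p); exact: ex_derive_continuous.
    - move=> u /andP[u0 uV]; have p : 0 < W + -1 * u by lra.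
      have h := is_derive_affine_comp (is_derive_xi0 p).
      by rewrite /F; apply: is_derive_eq; ring.
    - exact/continuous_affine_comp/continuous_xi0.
    - exact/continuous_affine_comp/continuous_xi0.
  apply: eq_integral => u; rewrite inE /= in_itv /= => /andP[u0 uV].
    rewrite /range3 (max_l (ltW uV)) (max_l (ltW VW)) (min_r (ltW uV)) min_r; last lra.
    by rewrite nlnE; [congr (- ln _)%:E; ring|lra].
have -> : (\int[mu]_(u in `]V, W[) (nln (range3 W V u))%:E =
    (- ln (W - V) * (W - V))%:E)%E.
  rewrite EFinM -[X in (_ = _ * X)%E](_ : mu `]V, W[%classic = (W - V)%:E)%E; last first.
    by rewrite lebesgue_measure_itv /= lte_fin VW.
  rewrite -integral_cst//; apply: eq_integral => u.
  rewrite inE /= in_itv /= => /andP[Vu uW].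
  rewrite /range3 (max_r (ltW Vu)) (max_l (ltW uW)) (min_l (ltW Vu)) (min_r (ltW VW)).
  by rewrite nlnE //; lra.
pose G u := - xi0 (- V + 1 * u).
have -> : (\int[mu]_(u in `]W, 1%R[) (nln (range3 W V u))%:E = (G 1 - G W)%:E)%E.
  transitivity (\int[mu]_(u in `]W, 1%R[) (- ln (- V + 1 * u))%:E)%E; last first.
    apply: (@integral_itvoo_FTC _ (fun u => - ln (- V + 1 * u)) G).
    - exact: W1.
    - by move=> u /andP[u0 uV]; rewrite oppr_ge0 ln_le0//; lra.
    - move=> u /andP[u0 uV]; have p : 0 < - V + 1 * u by lra.
      have h := is_derive_affine_comp (is_derive1_ln p); exact: ex_derive_continuous.
    - move=> u /andP[u0 uV]; have p : 0 < - V + 1 * u by lra.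
      have h := is_derive_affine_comp (is_derive_xi0 p).
      by rewrite /G; apply: is_derive_eq; ring.
    - by move=> u; apply: cvgN; exact/continuous_affine_comp/continuous_xi0.
    - by move=> u; apply: cvgN; exact/continuous_affine_comp/continuous_xi0.
  apply: eq_integral => u; rewrite inE /= in_itv /= => /andP[Wu u1].
    have Vu : V < u by lra.
    rewrite /range3 (max_r (ltW Vu)) (max_r (ltW Wu)) (min_l (ltW Vu)) (min_r (ltW VW)).
    by rewrite nlnE; [congr (- ln _)%:E; ring|lra].
rewrite -!EFinD; congr _%:E; rewrite /F /G.
rewrite (_ : W + -1 * V = W - V); last ring.
rewrite (_ : - V + 1 * W = W - V); last ring.
rewrite (_ : W + -1 * 0 = W); last ring.
rewrite (_ : - V + 1 * 1 = 1 - V); last ring.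
by rewrite /xi0; ring.
Qed.

Lemma unif_unif_nln_range3 (x W : R) : 0 < x -> x < W -> W < 1 ->
  (\int[unif]_v \int[unif]_u (nln (range3 W (x * v) u))%:E =
  (- (W * ln W) + (xi1 (1 - x) + 4^-1 - xi1 (W - x) + xi1 W) / x
    + 1 - W + x / 2)%:E)%E.
Proof.
move=> x0 xW W1.
pose h v := 1 - (W + - x * v) - W * ln W - (1 + - x * v) * ln (1 + - x * v)
  + (W + - x * v) * ln (W + - x * v).
pose F v := (1 - W - W * ln W) * v + x / 2 * v ^+ 2
  + x^-1 * xi1 (1 + - x * v) - x^-1 * xi1 (W + - x * v).
have p1 (v : R) : 0 <= v <= 1 -> 0 < 1 + - x * v.
  by move=> /andP[v0 v1]; have := ler_wpM2l (ltW x0) v1; lra.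
have pW (v : R) : 0 <= v <= 1 -> 0 < W + - x * v.
  by move=> /andP[v0 v1]; have := ler_wpM2l (ltW x0) v1; lra.
have dF (v : R) : 0 <= v <= 1 -> is_derive v 1 F (h v).
  move=> v01.
  have h1 := is_derive_affine_comp (is_derive_xi1 (p1 v v01)).
  have h2 := is_derive_affine_comp (is_derive_xi1 (pW v v01)).
  rewrite /F; apply: is_derive_eq; rewrite /GRing.scale /= /h.
  by field; rewrite lt0r_neq0.
transitivity ((F 1 - F 0)%:E); last first.
  congr (_%:E); rewrite /F !mulr1 !mulr0 !addr0.
  rewrite (_ : xi1 1 = - 4^-1); last by rewrite /xi1 ln1; field.
  by field; rewrite lt0r_neq0.
apply: (@unif_FTC _ _ h F).
- apply: (@measurable_unif _ _ _ (fun v u : mR => (nln (range3 W (x * v) u))%:E)).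
    by meas.
  by move=> v u; rewrite lee_fin nln_ge0.
- by move=> v; apply: integral_ge0 => u _; rewrite lee_fin nln_ge0.
- move=> v /andP[v0 v1].
  have xv : x * v < x by rewrite gtr_pMr.
  rewrite unif_nln_range3 ?mulr_gt0//; last exact: lt_trans xv xW.
  by congr (_%:E); rewrite /h !mulNr; ring.
- move=> v /andP[v0 v1]; have v01 : 0 <= v <= 1 by rewrite !ltW.
  have h1 := is_derive_affine_comp (is_derive1_ln (p1 v v01)).
  have h2 := is_derive_affine_comp (is_derive1_ln (pW v v01)).
  rewrite /h; exact: ex_derive_continuous.
- by move=> v /andP[v0 v1]; apply: dF; rewrite !ltW.
- by apply: is_derive_continuous (dF 0 _); rewrite lexx ler01.
- by apply: is_derive_continuous (dF 1 _); rewrite lexx ler01.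
Qed.

(** The vertices are normalised to 0 < x < 1, and the new points x + (1 - x) w, x v and u lie on the
    three sides. The mean is exactly 5/6 + (x^3 ln x + y^3 ln y) / (3 x y) with y = 1 - x, and
    [xlnx_midpoint_le] bounds it. *)
Lemma uniform3_nln_range3_sorted (x : R) : 0 < x < 1 ->
  (uniform3 (fun w v u : mR => (nln (range3 (x + (1 - x) * w) (x * v) u))%:E)
   <= (5 / 6 - ln 2 / 3)%:E)%E.
Proof.
move=> /andP[x0 x1]; pose y := 1 - x.
have y0 : 0 < y by rewrite /y; lra.
have xy1 : x + y = 1 by rewrite /y; ring.
pose W w := x + y * w.
pose h w := - (W w * ln (W w)) + x^-1 * (xi1 y + 4^-1 - xi1 (0 + y * w) + xi1 (W w))
  + 1 - W w + x / 2.
pose F w := y^-1 * (- xi1 (x + y * w)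
  + x^-1 * ((xi1 y + 4^-1) * (x + y * w) - xi2 (0 + y * w) + xi2 (x + y * w))
  + (x + y * w) - (x + y * w) ^+ 2 / 2 + x / 2 * (x + y * w)).
have -> : uniform3 (fun w v u : mR => (nln (range3 (x + (1 - x) * w) (x * v) u))%:E)
    = (F 1 - F 0)%:E.
  have nF : nonneg_measurable3 (fun w v u : mR => (nln (range3 (x + (1 - x) * w) (x * v) u))%:E).
    by split; [meas|move=> *; rewrite lee_fin nln_ge0].
  apply: (@unif_FTC _ _ h F).
  - exact: (measurable_unif2 nF).
  - by move=> w; exact: (unif2_ge0 _ nF).
  - move=> w /andP[w0 w1].
    have yw : 0 < y * w < y by rewrite mulr_gt0//= gtr_pMr.
    rewrite unif_unif_nln_range3 //; [|rewrite -/y; lra|rewrite -/y -[ltRHS]xy1; lra].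
    congr (_%:E); rewrite /h /W -/y.
    rewrite (_ : x + y * w - x = 0 + y * w); last ring.
    by field; rewrite lt0r_neq0.
  - move=> w /andP[w0 w1].
    have p1 : 0 < x + y * w by rewrite addr_gt0// mulr_gt0.
    have p2 : 0 < 0 + y * w by rewrite add0r mulr_gt0.
    have h1 := is_derive_affine_comp (is_derive1_ln p1).
    have h2 := is_derive_affine_comp (is_derive_xi1 p1).
    have h3 := is_derive_affine_comp (is_derive_xi1 p2).
    rewrite /h /W; exact: ex_derive_continuous.
  - move=> w /andP[w0 w1].
    have p1 : 0 < x + y * w by rewrite addr_gt0// mulr_gt0.
    have p2 : 0 < 0 + y * w by rewrite add0r mulr_gt0.
    have h1 := is_derive_affine_comp (is_derive_xi1 p1).
    have h2 := is_derive_affine_comp (is_derive_xi2 p1).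
    have h3 := is_derive_affine_comp (is_derive_xi2 p2).
    rewrite /F; apply: is_derive_eq; rewrite /GRing.scale /= /h /W.
    by field; rewrite !lt0r_neq0.
  - have cl (c k : R) : {for 0, continuous (fun w => c + k * w)}.
      by apply: cvgD; [exact: cvg_cst|apply: cvgM; [exact: cvg_cst|exact: cvg_id]].
    apply: cvgM; first exact: cvg_cst.
    apply: cvgD; last by apply: cvgM; [exact: cvg_cst|exact: cl].
    apply: cvgB; last by apply: cvgM; [apply: cvgM; exact: cl|exact: cvg_cst].
    apply: cvgD; last exact: cl.
    apply: cvgD; first by apply: cvgN; exact/continuous_affine_comp/continuous_xi1.
    apply: cvgM; first exact: cvg_cst.
    apply: cvgD; last exact/continuous_affine_comp/continuous_xi2.
    apply: cvgB; last exact/continuous_affine_comp/continuous_xi2.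
    by apply: cvgM; [exact: cvg_cst|exact: cl].
  - have p1 : 0 < x + y * 1 by rewrite addr_gt0// mulr_gt0.
    have p2 : 0 < 0 + y * 1 by rewrite add0r mulr_gt0.
    have h1 := is_derive_affine_comp (is_derive_xi1 p1).
    have h2 := is_derive_affine_comp (is_derive_xi2 p1).
    have h3 := is_derive_affine_comp (is_derive_xi2 p2).
    rewrite /F; exact: ex_derive_continuous.
rewrite lee_fin.
have key := @xlnx_midpoint_le R x; rewrite x0 x1 -/y in key.
have {}key := key isT.
have -> : F 1 - F 0 = 5 / 6 + (x ^+ 3 * ln x + y ^+ 3 * ln y) / (3 * (x * y)).
  rewrite /F !mulr1 !mulr0 !addr0 !add0r.
  rewrite xy1.
  rewrite /xi1 /xi2 ln1 (ln0 (lexx 0)); move: (ln x) (ln y) => a b.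
  by rewrite /y; field; rewrite lt0r_neq0//=; apply/eqP; lra.
have xy0 : 0 < 3 * (x * y) by rewrite mulr_gt0// mulr_gt0.
rewrite lerD2l -mulNr ler_pdivrMr// (le_trans key)//.
by rewrite le_eqVlt; apply/orP; left; apply/eqP; field.
Qed.

End FlatLength.

(** * Flat triangles in arbitrary position and order *)

Section FlatChain.
Variable R : realType.
Local Notation mR := (measurableTypeR R).
Local Notation unif := (uniform_prob (@ltr01 R)).
Implicit Types a b c k r x : R.

Definition seg (p q u : R) : R := p + u * (q - p).

Lemma range3C12 a b c : range3 a b c = range3 b a c.
Proof. by rewrite /range3 maxCA minCA. Qed.

Lemma range3C23 a b c : range3 a b c = range3 a c b.
Proof. by rewrite /range3 (maxC b) (minC b). Qed.

Lemma range3_affine x r a b c : 0 <= r ->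
  range3 (x + r * a) (x + r * b) (x + r * c) = r * range3 a b c.
Proof.
move=> r0; rewrite /range3 -!addr_maxr -!addr_minr -!maxr_pMr// -!minr_pMr//.
by rewrite mulrBr; ring.
Qed.

Lemma range3_ge a b c : `|a - b| <= range3 a b c.
Proof.
have h1 : a <= Num.max a (Num.max b c) by rewrite le_max lexx.
have h2 : b <= Num.max a (Num.max b c) by rewrite !le_max lexx orbT.
have h3 : Num.min a (Num.min b c) <= a by rewrite ge_min lexx.
have h4 : Num.min a (Num.min b c) <= b by rewrite !ge_min lexx orbT.
rewrite /range3 ler_norml; move: h1 h2 h3 h4; set M := Num.max _ _; set m := Num.min _ _.
by move=> *; apply/andP; split; lra.
Qed.

Lemma range3_le a b c k : `|a - b| <= k -> `|b - c| <= k -> `|a - c| <= k ->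
  range3 a b c <= k.
Proof.
rewrite !ler_norml /range3 => /andP[h1 h2] /andP[h3 h4] /andP[h5 h6].
rewrite lerBlDr !addr_minr !ge_max !le_min.
by apply/and3P; split; apply/and3P; split; lra.
Qed.

Lemma range3_le_add a b c : range3 a b c <= `|a - b| + `|b - c|.
Proof.
by apply: range3_le; rewrite ?lerDl ?lerDr// -[a - c](subrKA b) ler_normD.
Qed.

Lemma range3_gt0 a b c : a != b -> 0 < range3 a b c.
Proof. by move=> ab; rewrite (lt_le_trans _ (range3_ge a b c))// normr_gt0 subr_eq0. Qed.

Section Symmetry.
Variable G : R -> R -> R -> \bar R.
Hypothesis nG : nonneg_measurable3 (G : mR -> mR -> mR -> \bar R).
Hypothesis G12 : forall a b c, G a b c = G b a c.
Hypothesis G23 : forall a b c, G a b c = G a c b.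

Let Q x0 x1 x2 := uniform3 (fun u v w : mR => G (seg x1 x2 u) (seg x2 x0 v) (seg x0 x1 w)).

Let nQ x0 x1 x2 : nonneg_measurable3
  (fun u v w : mR => G (seg x1 x2 u) (seg x2 x0 v) (seg x0 x1 w)).
Proof.
split; last by move=> *; exact: nG.2.
apply: (measurableT_comp nG.1
  (g := fun p : mR * mR * mR => (seg x1 x2 p.1.1, seg x2 x0 p.1.2, seg x0 x1 p.2))).
by rewrite /seg; meas.
Qed.

Let seg_onem p q u : seg p q (1 - u) = seg q p u.
Proof. by rewrite /seg; ring. Qed.

(** Exchanging two vertices exchanges two sides and reverses the direction of all three; Tonelli,
    the reflection u -> 1 - u and the symmetry of [G] undo this. *)
Lemma uniform3_seg_swap12 x0 x1 x2 : Q x0 x1 x2 = Q x1 x0 x2.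
Proof.
rewrite /Q (uniform3_swap12 (nQ x0 x1 x2)) -(uniform3_onem (nQ x1 x0 x2)) /uniform3.
apply: eq_integral => u _; apply: eq_integral => v _; apply: eq_integral => w _.
by rewrite !seg_onem G12.
Qed.

Lemma uniform3_seg_swap23 x0 x1 x2 : Q x0 x1 x2 = Q x0 x2 x1.
Proof.
rewrite /Q (uniform3_swap23 (nQ x0 x1 x2)) -(uniform3_onem (nQ x0 x2 x1)) /uniform3.
apply: eq_integral => u _; apply: eq_integral => v _; apply: eq_integral => w _.
by rewrite !seg_onem G23.
Qed.

End Symmetry.

Lemma nonneg_measurable3_nln_range3 k :
  nonneg_measurable3 (fun a b c : mR => (nln (range3 a b c / k))%:E).
Proof. by split; [meas|move=> *; rewrite lee_fin nln_ge0]. Qed.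

(** An affine change of coordinate treats the case where a < m < b are listed as a, b, m; the other
    five orders follow by transpositions. *)
Lemma uniform3_nln_range3 x0 x1 x2 : x0 != x1 -> x1 != x2 -> x0 != x2 ->
  (uniform3 (fun u v w : mR =>
     (nln (range3 (seg x1 x2 u) (seg x2 x0 v) (seg x0 x1 w) / range3 x0 x1 x2))%:E)
   <= (5 / 6 - ln 2 / 3)%:E)%E.
Proof.
pose Q k x0 x1 x2 := uniform3 (fun u v w : mR =>
  (nln (range3 (seg x1 x2 u) (seg x2 x0 v) (seg x0 x1 w) / k))%:E).
have Q12 k a b c : Q k a b c = Q k b a c.
  apply: (uniform3_seg_swap12 (G := fun a b c => (nln (range3 a b c / k))%:E)).
    exact: nonneg_measurable3_nln_range3.
  by move=> *; rewrite range3C12.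
have Q23 k a b c : Q k a b c = Q k a c b.
  apply: (uniform3_seg_swap23 (G := fun a b c => (nln (range3 a b c / k))%:E)).
    exact: nonneg_measurable3_nln_range3.
  by move=> *; rewrite range3C23.
have base a m b : a < m -> m < b -> (Q (range3 a b m) a b m <= (5 / 6 - ln 2 / 3)%:E)%E.
  move=> am mb; pose r := b - a; have r0 : 0 < r by rewrite /r; lra.
  pose x := (m - a) / r.
  have x01 : 0 < x < 1.
    rewrite /x; apply/andP; split; first by rewrite divr_gt0// subr_gt0.
    by rewrite ltr_pdivrMr// mul1r /r; lra.
  have rE : range3 a b m = r.
    have ab : a <= b by lra.
    by rewrite /range3 (max_l (ltW mb)) (max_r ab) (min_r (ltW mb)) (min_l (ltW am)).
  (* The sides from b to m and from m to a are parametrised downwards; reflecting u and v turns them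
     round. *)
  rewrite rE /Q -uniform3_onem12; last first.
    have [h1 h2] := nonneg_measurable3_nln_range3 r.
    by split; [rewrite /seg; meas|move=> *; rewrite lee_fin nln_ge0].
  apply: le_trans (uniform3_nln_range3_sorted x01).
  rewrite le_eqVlt; apply/orP; left; apply/eqP; rewrite /uniform3.
  apply: eq_integral => u _; apply: eq_integral => v _; apply: eq_integral => w _.
  congr ((nln _)%:E).
  have -> : seg b m (1 - u) = a + r * (x + (1 - x) * u).
    by rewrite /seg /x /r; field; rewrite lt0r_neq0.
  have -> : seg m a (1 - v) = a + r * (x * v).
    by rewrite /seg /x /r; field; rewrite lt0r_neq0.
  have -> : seg a b w = a + r * w by rewrite /seg /r; ring.
  by rewrite range3_affine ?(ltW r0)// mulrC mulKf// lt0r_neq0.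
move=> x01 x12 x02; rewrite -/(Q (range3 x0 x1 x2) x0 x1 x2).
have all6 a m b : a < m -> m < b ->
  [/\ (Q (range3 a b m) a b m <= (5 / 6 - ln 2 / 3)%:E)%E,
      (Q (range3 b a m) b a m <= (5 / 6 - ln 2 / 3)%:E)%E,
      (Q (range3 a m b) a m b <= (5 / 6 - ln 2 / 3)%:E)%E &
   [/\ (Q (range3 m a b) m a b <= (5 / 6 - ln 2 / 3)%:E)%E,
      (Q (range3 b m a) b m a <= (5 / 6 - ln 2 / 3)%:E)%E &
      (Q (range3 m b a) m b a <= (5 / 6 - ln 2 / 3)%:E)%E]].
  move=> am mb; have h1 := base a m b am mb.
  have h2 := h1; rewrite Q12 range3C12 in h2.
  have h3 := h1; rewrite Q23 range3C23 in h3.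
  have h4 := h3; rewrite Q12 range3C12 in h4.
  have h5 := h2; rewrite Q23 range3C23 in h5.
  by have h6 := h5; rewrite Q12 range3C12 in h6.
case: (ltgtP x0 x1) x01 => // x01 _; case: (ltgtP x1 x2) x12 => // x12 _;
  case: (ltgtP x0 x2) x02 => // x02 _.
- by case: (all6 _ _ _ x01 x12) => _ _ ? [].
- by move: (lt_trans x01 (lt_trans x12 x02)); rewrite ltxx.
- by case: (all6 _ _ _ x02 x12).
- by case: (all6 _ _ _ x02 x01) => _ _ _ [].
- by case: (all6 _ _ _ x01 x02) => _ _ _ [].
- by case: (all6 _ _ _ x12 x02) => _ ? _ [].
- by move: (lt_trans x01 (lt_trans x02 x12)); rewrite ltxx.
- by case: (all6 _ _ _ x12 x01) => _ _ _ [].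
Qed.

End FlatChain.

(** * Affine forms in three uniforms, and the gaps between the new vertices *)

Section AffineForms.
Variable R : realType.
Local Notation mR := (measurableTypeR R).
Local Notation unif := (uniform_prob (@ltr01 R)).
Implicit Types a b c k : R.

Lemma nonneg_measurable3_isqrt (f : mR -> mR -> mR -> R) :
  measurable_fun setT (fun p : mR * mR * mR => f p.1.1 p.1.2 p.2) ->
  nonneg_measurable3 (fun u v w : mR => (isqrt (f u v w))%:E).
Proof.
move=> mf; split; first by rewrite /isqrt; meas.
by move=> *; rewrite lee_fin ltW// isqrt_gt0.
Qed.

(** Tonelli lets a variable with slope at least 1/2 in absolute value be integrated first. There the
    bound 4 |slope|^(-1/2) is at most 8, whatever the other variables. *)
Lemma uniform3_isqrt_affine_le k a b c :
  [\/ 2^-1 <= `|a|, 2^-1 <= `|b| | 2^-1 <= `|c|] ->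
  (uniform3 (fun u v w : mR => (isqrt (k + a * u + b * v + c * w))%:E) <= 8%:E)%E.
Proof.
have bound (x y : R) : 2^-1 <= `|y| -> (\int[unif]_u (isqrt (x + y * u))%:E <= 8%:E)%E.
  move=> y2; have y0 : y != 0 by rewrite -normr_gt0 (lt_le_trans _ y2)// invr_gt0.
  rewrite (le_trans (unif_isqrt_affine_le x y0))// lee_fin.
  have h : isqrt y <= 2 by rewrite (le_trans _ (@isqrt_half_le R))// isqrt_le// invr_gt0.
  by lra.
have nF k' a' b' c' : nonneg_measurable3
    (fun u v w : mR => (isqrt (k' + a' * u + b' * v + c' * w))%:E).
  by apply: nonneg_measurable3_isqrt; meas.
have H k' a' b' c' : 2^-1 <= `|c'| ->
    (uniform3 (fun u v w : mR => (isqrt (k' + a' * u + b' * v + c' * w))%:E) <= 8%:E)%E.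
  move=> hc; apply: uniform3_le_cst; first exact: nF.
    by [].
  by move=> u v _ _; exact: bound.
case=> [ha|hb|hc]; last exact: H.
- rewrite (uniform3_swap12 (nF k a b c)) uniform3_swap23; last first.
    exact: (nonneg_measurable3_swap12 (nF k a b c)).
  apply: le_trans (H k b c a ha).
  rewrite le_eqVlt; apply/orP; left; apply/eqP; rewrite /uniform3.
  apply: eq_integral => u _; apply: eq_integral => v _; apply: eq_integral => w _.
  by congr ((isqrt _)%:E); ring.
- rewrite (uniform3_swap23 (nF k a b c)).
  apply: le_trans (H k a c b hb).
  rewrite le_eqVlt; apply/orP; left; apply/eqP; rewrite /uniform3.
  apply: eq_integral => u _; apply: eq_integral => v _; apply: eq_integral => w _.
  by congr ((isqrt _)%:E); ring.
Qed.

(** Added to an upper bound, it makes the bound trivial where x vanishes, at no cost when that set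
    is null. It thus carries an almost-everywhere condition through inequalities of iterated
    integrals. *)
Definition infty_at0 (x : R) : \bar R := if x == 0 then +oo%E else 0%E.

Lemma infty_at0_ge0 (x : R) : (0 <= infty_at0 x)%E.
Proof. by rewrite /infty_at0; case: ifP. Qed.

Lemma nonneg_measurable3_infty_at0 (f : mR -> mR -> mR -> R) :
  measurable_fun setT (fun p : mR * mR * mR => f p.1.1 p.1.2 p.2) ->
  nonneg_measurable3 (fun u v w : mR => infty_at0 (f u v w)).
Proof.
move=> mf; split; last by move=> *; exact: infty_at0_ge0.
apply: (@measurable_fun_ifT _ _ _ _ (cst +oo%E) (cst 0%E)
  (fun p : mR * mR * mR => f p.1.1 p.1.2 p.2 == 0)) => //.
by apply: measurable_fun_eqr => //; meas.
Qed.

Lemma uniform3_infty_at0_affine k a b c : [\/ a != 0, b != 0 | c != 0] ->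
  (uniform3 (fun u v w : mR => infty_at0 (k + a * u + b * v + c * w)) = 0)%E.
Proof.
have nF k' a' b' c' : nonneg_measurable3
    (fun u v w : mR => infty_at0 (k' + a' * u + b' * v + c' * w)).
  by apply: nonneg_measurable3_infty_at0; meas.
have H k' a' b' c' : c' != 0 ->
    (uniform3 (fun u v w : mR => infty_at0 (k' + a' * u + b' * v + c' * w)) = 0)%E.
  move=> hc; apply/eqP; rewrite eq_le (uniform3_ge0 (nF _ _ _ _)) andbT.
  apply: uniform3_le_cst; first exact: nF.
    by [].
  by move=> u v _ _; rewrite unif_point_eq0.
case=> [ha|hb|hc]; last exact: H.
- rewrite (uniform3_swap12 (nF k a b c)) uniform3_swap23; last first.
    exact: (nonneg_measurable3_swap12 (nF k a b c)).
  rewrite -[RHS](H k b c a ha) /uniform3.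
  apply: eq_integral => u _; apply: eq_integral => v _; apply: eq_integral => w _.
  by congr infty_at0; ring.
- rewrite (uniform3_swap23 (nF k a b c)).
  rewrite -[RHS](H k a c b hb) /uniform3.
  apply: eq_integral => u _; apply: eq_integral => v _; apply: eq_integral => w _.
  by congr infty_at0; ring.
Qed.

Lemma seg_sub_affine1 (x0 x1 x2 r u v w : R) : (seg x1 x2 u - seg x2 x0 v) / r =
  (x1 - x2) / r + (x2 - x1) / r * u + (x2 - x0) / r * v + 0 * w.
Proof. by rewrite /seg; ring. Qed.

Lemma seg_sub_affine2 (x0 x1 x2 r u v w : R) : (seg x2 x0 v - seg x0 x1 w) / r =
  (x2 - x0) / r + 0 * u + (x0 - x2) / r * v + (x0 - x1) / r * w.
Proof. by rewrite /seg; ring. Qed.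

Lemma seg_sub_affine3 (x0 x1 x2 r u v w : R) : (seg x0 x1 w - seg x1 x2 u) / r =
  (x0 - x1) / r + (x1 - x2) / r * u + 0 * v + (x1 - x0) / r * w.
Proof. by rewrite /seg; ring. Qed.

Lemma uniform3_ext (F G : mR -> mR -> mR -> \bar R) :
  (forall u v w, F u v w = G u v w) -> uniform3 F = uniform3 G.
Proof.
move=> FG; congr uniform3.
by apply/funext => u; apply/funext => v; apply/funext => w.
Qed.

(* Two new vertices lie on sides sharing a vertex, and of two sides of a flat
   triangle one is at least half of the longest side. *)
Lemma uniform3_isqrt_gap_le x0 x1 x2 : x0 != x1 ->
  [/\ (uniform3 (fun u v w : mR =>
        (isqrt ((seg x1 x2 u - seg x2 x0 v) / range3 x0 x1 x2))%:E) <= 8%:E)%E,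
      (uniform3 (fun u v w : mR =>
        (isqrt ((seg x2 x0 v - seg x0 x1 w) / range3 x0 x1 x2))%:E) <= 8%:E)%E &
      (uniform3 (fun u v w : mR =>
        (isqrt ((seg x0 x1 w - seg x1 x2 u) / range3 x0 x1 x2))%:E) <= 8%:E)%E].
Proof.
move=> x01; have := range3_gt0 x2 x01.
have h1 : range3 x0 x1 x2 <= `|x2 - x1| + `|x2 - x0|.
  by rewrite range3C12 range3C23 [X in X + _]distrC range3_le_add.
have h2 : range3 x0 x1 x2 <= `|x0 - x2| + `|x0 - x1|.
  by rewrite range3C23 range3C12 [X in X + _]distrC range3_le_add.
have h3 : range3 x0 x1 x2 <= `|x1 - x0| + `|x1 - x2|.
  by rewrite [X in X + _]distrC range3_le_add.
move: h1 h2 h3; set r := range3 x0 x1 x2 => h1 h2 h3 r0.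
have half (y z : R) : r <= `|y| + `|z| -> 2^-1 <= `|y / r| \/ 2^-1 <= `|z / r|.
  rewrite !normrM normfV (gtr0_norm r0) !ler_pdivlMr// => h.
  by have [hy|hy] := leP (2^-1 * r) `|y|; [left|right; lra].
split.
- rewrite (uniform3_ext (fun u v w => congr1 (fun z : R => (isqrt z)%:E) (seg_sub_affine1 x0 x1 x2 r u v w))).
  by apply: uniform3_isqrt_affine_le; case: (half _ _ h1) => h; [apply: Or31|apply: Or32].
- rewrite (uniform3_ext (fun u v w => congr1 (fun z : R => (isqrt z)%:E) (seg_sub_affine2 x0 x1 x2 r u v w))).
  by apply: uniform3_isqrt_affine_le; case: (half _ _ h2) => h; [apply: Or32|apply: Or33].
- rewrite (uniform3_ext (fun u v w => congr1 (fun z : R => (isqrt z)%:E) (seg_sub_affine3 x0 x1 x2 r u v w))).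
  by apply: uniform3_isqrt_affine_le; case: (half _ _ h3) => h; [apply: Or33|apply: Or31].
Qed.

(** The division by 1 lets the affine expansions stated for a general r be reused with r = 1. *)
Lemma uniform3_infty_at0_gap x0 x1 x2 : x0 != x1 -> x1 != x2 ->
  [/\ (uniform3 (fun u v w : mR => infty_at0 ((seg x1 x2 u - seg x2 x0 v) / 1)) = 0)%E,
      (uniform3 (fun u v w : mR => infty_at0 ((seg x2 x0 v - seg x0 x1 w) / 1)) = 0)%E &
      (uniform3 (fun u v w : mR => infty_at0 ((seg x0 x1 w - seg x1 x2 u) / 1)) = 0)%E].
Proof.
move=> x01 x12; split.
- rewrite (uniform3_ext (fun u v w => congr1 infty_at0 (seg_sub_affine1 x0 x1 x2 1 u v w))).
  by apply: uniform3_infty_at0_affine; apply: Or31; rewrite divr1 subr_eq0 eq_sym.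
- rewrite (uniform3_ext (fun u v w => congr1 infty_at0 (seg_sub_affine2 x0 x1 x2 1 u v w))).
  by apply: uniform3_infty_at0_affine; apply: Or33; rewrite divr1 subr_eq0.
- rewrite (uniform3_ext (fun u v w => congr1 infty_at0 (seg_sub_affine3 x0 x1 x2 1 u v w))).
  by apply: uniform3_infty_at0_affine; apply: Or31; rewrite divr1 subr_eq0.
Qed.
End AffineForms.

(** * Mean logarithm of the area ratio *)

Section Shear.
Variable R : realType.
Local Notation mR := (measurableTypeR R).
Local Notation mu := (@lebesgue_measure R).
Local Notation unif := (uniform_prob (@ltr01 R)).
Variable I : mR -> mR -> \bar R.
Hypothesis I_ge0 : forall u v, (0 <= I u v)%E.
Hypothesis measurable_I : measurable_fun setT (fun p : mR * mR => I p.1 p.2).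
Hypothesis I_onem : forall u v : R, I (1 - u) (1 - v) = I u v.

(* The integrand after the shear [s = u + v - 1]. *)
Definition sheared (u s : mR) : \bar R := if (0 < s) && (s < u) then I u (1 + s - u) else 0%E.

Lemma sheared_ge0 u s : (0 <= sheared u s)%E.
Proof. by rewrite /sheared; case: ifP => // _; exact: I_ge0. Qed.

Let measurable_I_comp d (T : measurableType d) (f g : T -> mR) :
  measurable_fun setT f -> measurable_fun setT g ->
  measurable_fun setT (fun p => I (f p) (g p)).
Proof.
move=> mf mg; apply: (measurableT_comp measurable_I (g := fun p => (f p, g p))).
by meas.
Qed.

Lemma measurable_sheared : measurable_fun setT (fun p : mR * mR => sheared p.1 p.2).
Proof.
apply: (@measurable_fun_ifT _ _ _ _ (fun p : mR * mR => I p.1 (1 + p.2 - p.1)) (cst 0%E)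
  (fun p : mR * mR => (0 < p.2) && (p.2 < p.1))) => //.
- by apply: measurable_and; apply: measurable_fun_ltr; meas.
- by apply: measurable_I_comp; meas.
Qed.

(** The half of the square on which the shear variable s = u + v - 1 is positive. *)
Let K (u v : mR) : \bar R := if 1 < u + v then I u v else 0%E.

Let K_ge0 u v : (0 <= K u v)%E.
Proof. by rewrite /K; case: ifP => // _; exact: I_ge0. Qed.

Let measurable_K : measurable_fun setT (fun p : mR * mR => K p.1 p.2).
Proof.
apply: (@measurable_fun_ifT _ _ _ _ (fun p : mR * mR => I p.1 p.2) (cst 0%E)
  (fun p : mR * mR => 1 < p.1 + p.2)) => //.
by apply: measurable_fun_ltr; meas.
Qed.

Let measurable_K' : measurable_fun setT (fun p : mR * mR => K (1 - p.1) (1 - p.2)).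
Proof.
apply: (measurableT_comp measurable_K (g := fun p : mR * mR => ((1 - p.1, 1 - p.2) : mR * mR))).
by meas.
Qed.

(** The point reflection (u, v) -> (1 - u, 1 - v) preserves [I] and exchanges the disjoint halves u
    + v > 1 and u + v < 1, which therefore contribute equally. *)
Let two_K_le : (2%:E * \int[unif]_u \int[unif]_v K u v <= \int[unif]_u \int[unif]_v I u v)%E.
Proof.
have mK1 : measurable_fun setT (fun u => \int[unif]_v K u v)%E.
  exact: (measurable_unif measurable_K K_ge0).
have K1 u : (0 <= \int[unif]_v K u v)%E by apply: integral_ge0 => v _; exact: K_ge0.
have mK'1 : measurable_fun setT (fun u : mR => \int[unif]_v K (1 - u)%R (1 - v)%R)%E.
  exact: (measurable_unif (f := fun u v : mR => K (1 - u) (1 - v))).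
have K'1 (u : mR) : (0 <= \int[unif]_v K (1 - u)%R (1 - v)%R)%E.
  by apply: integral_ge0 => v _; exact: K_ge0.
have e1 : (\int[unif]_u \int[unif]_v K u v =
    \int[unif]_u \int[unif]_v K (1 - u)%R (1 - v)%R)%E.
  rewrite -(unif_onem mK1 K1); apply: eq_integral => u _.
  by rewrite -(unif_onem (measurable_section (1 - u) measurable_K) (K_ge0 (1 - u))).
have e2 : (2%:E * \int[unif]_u \int[unif]_v K u v =
    \int[unif]_u \int[unif]_v (K u v + K (1 - u)%R (1 - v)%R))%E.
  transitivity (\int[unif]_u \int[unif]_v K u v + \int[unif]_u \int[unif]_v K u v)%E.
    by rewrite mule_natl mule2n.
  rewrite [X in (_ + X)%E]e1 -(unif_add mK1 mK'1 K1 K'1).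
  apply: eq_integral => u _; rewrite unif_add.
  - by [].
  - exact: (measurable_section u measurable_K).
  - exact: (measurable_section (f := fun u v : mR => K (1 - u) (1 - v)) u measurable_K').
  - exact: K_ge0.
  - by move=> v; exact: K_ge0.
rewrite e2.
have mKK : measurable_fun setT (fun p : mR * mR => K p.1 p.2 + K (1 - p.1)%R (1 - p.2)%R)%E.
  exact: emeasurable_funD.
have KK0 u v : (0 <= K u v + K (1 - u)%R (1 - v)%R)%E by rewrite adde_ge0.
apply: unif_le01.
- exact: (measurable_unif (f := fun u v : mR => (K u v + K (1 - u)%R (1 - v)%R)%E)).
- exact: (measurable_unif measurable_I I_ge0).
- by move=> u; apply: integral_ge0 => v _; exact: KK0.
- by move=> u; apply: integral_ge0 => v _; exact: I_ge0.
move=> u _; apply: unif_le01.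
- exact: (measurable_section (f := fun u v : mR => (K u v + K (1 - u)%R (1 - v)%R)%E)).
- exact: (measurable_section (f := I)).
- exact: KK0.
- exact: I_ge0.
move=> v _; rewrite /K I_onem; case: ifPn => h1; case: ifPn => h2.
- by exfalso; clear e1 e2; lra.
- by rewrite adde0.
- by rewrite add0e.
- by rewrite adde0; exact: I_ge0.
Qed.

(** For fixed u, the substitution v = s + (1 - u) is a translation taking 0 < s < u to 1 - u < v <
    1. *)
Let shear : (\int[unif]_s \int[unif]_u sheared u s <= \int[unif]_u \int[unif]_v K u v)%E.
Proof.
rewrite -(unif_swap measurable_sheared sheared_ge0).
apply: unif_le01.
- exact: (measurable_unif measurable_sheared sheared_ge0).
- exact: (measurable_unif measurable_K K_ge0).
- by move=> u; apply: integral_ge0 => v _; exact: sheared_ge0.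
- by move=> u; apply: integral_ge0 => v _; exact: K_ge0.
move=> u /andP[u0 u1].
have mDu : measurable_fun setT (sheared u) by exact: (measurable_section u measurable_sheared).
have mKu : measurable_fun setT (K u) by exact: (measurable_section u measurable_K).
rewrite (unifE mDu (sheared_ge0 u)) (unifE mKu (K_ge0 u)).
rewrite (@integral_itvoo_split _ _ 0 u 1) ?u0 ?u1 //; last exact: sheared_ge0.
rewrite [X in (_ + X)%E]integral0_eq ?adde0; last first.
  move=> s /=; rewrite in_itv /= => /andP[us _].
  by rewrite /sheared (lt_gtF us) andbF.
rewrite (@integral_shift _ (K u) 0 1 (1 - u))//.
have mKs : measurable_fun setT (fun x : mR => K u (x + (1 - u))).
  by apply: (measurableT_comp mKu (g := fun x : mR => x + (1 - u) : mR)); meas.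
have -> : (\int[mu]_(x in `]0%R, u[) sheared u x = \int[mu]_(x in `]0%R, u[) K u (x + (1 - u))%R)%E.
  apply: eq_integral => s; rewrite inE /= in_itv /= => s01; rewrite /sheared s01 /K.
  move: s01 => /andP[s0 su]; rewrite ifT; last lra.
  by congr I; ring.
apply: ge0_subset_integral => //.
- exact: measurable_funTS.
- by move=> x /=; rewrite !in_itv /= => /andP[h1 h2]; apply/andP; split; lra.
Qed.

Lemma sheared_integral_le :
  (2%:E * \int[unif]_s \int[unif]_u sheared u s <= \int[unif]_u \int[unif]_v I u v)%E.
Proof. by apply: le_trans two_K_le; apply: lee_wpmul2l => //; exact: shear. Qed.

End Shear.

(** * The area ratio: its moment of order -1/2 and its mean logarithm *)

Section AreaRatio.
Variable R : realType.
Local Notation mR := (measurableTypeR R).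
Local Notation mu := (@lebesgue_measure R).
Local Notation unif := (uniform_prob (@ltr01 R)).
Implicit Types s u v w : R.

(** Area of the inscribed triangle relative to the original one, by [signed_area_inscribed]. It is
    affine in each variable, with slope u + v - 1 in w. *)
Definition area_ratio u v w : R := u * v * w + (1 - u) * (1 - v) * (1 - w).

Lemma area_ratio_gt0 u v w : 0 < u < 1 -> 0 < v < 1 -> 0 < w < 1 ->
  0 < area_ratio u v w.
Proof.
move=> /andP[u0 u1] /andP[v0 v1] /andP[w0 w1].
by rewrite /area_ratio addr_gt0// !mulr_gt0// subr_gt0.
Qed.

Lemma area_ratio_le1 u v w : 0 < u < 1 -> 0 < v < 1 -> 0 < w < 1 ->
  area_ratio u v w <= 1.
Proof.
move=> /andP[u0 u1] /andP[v0 v1] /andP[w0 w1].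
have h1 : u * v * w <= w by rewrite ger_pMl// mulr_ile1// ltW.
have h2 : (1 - u) * (1 - v) * (1 - w) <= 1 - w.
  by rewrite ger_pMl ?subr_gt0//; apply: mulr_ile1; lra.
by rewrite /area_ratio; lra.
Qed.

Lemma nonneg_measurable3_nln_area :
  nonneg_measurable3 (fun u v w : mR => (nln (area_ratio u v w))%:E).
Proof. by split; [rewrite /area_ratio; meas|move=> *; rewrite lee_fin nln_ge0]. Qed.

(** Averaging over w gives at most 4 |u + v - 1|^(-1/2). Its argument is again affine, now in v with
    slope 1, and averaging it costs another factor 4. *)
Lemma uniform3_isqrt_area_le :
  (uniform3 (fun u v w : mR => (isqrt (area_ratio u v w))%:E) <= 16%:E)%E.
Proof.
have nF : nonneg_measurable3 (fun u v w : mR => (isqrt (area_ratio u v w))%:E).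
  by apply: nonneg_measurable3_isqrt; rewrite /area_ratio; meas.
apply: unif_le_cst.
- exact: (measurable_unif2 nF).
- by move=> u; exact: (unif2_ge0 _ nF).
- by [].
move=> u u01.
have h := @unif_isqrt_affine_le R 1 (u - 1) (oner_neq0 R).
have m1 : measurable_fun setT (fun v : mR => (4 * isqrt (u - 1 + 1 * v))%:E).
  by rewrite /isqrt; meas.
apply: (@le_trans _ _ (\int[unif]_v (4 * isqrt (u - 1 + 1 * v))%:E)%E).
  apply: (@unif_le01_except _ _ _ (1 - u)).
  - exact: (measurable_unif1_section u nF).
  - exact: m1.
  - by move=> v; exact: (unif1_ge0 _ _ nF).
  - by move=> v; rewrite lee_fin mulr_ge0// ltW// isqrt_gt0.
  move=> v v01 vu.
  have c0 : u - 1 + 1 * v != 0 by apply/eqP => e; case/eqP: vu; lra.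
  apply: le_trans (unif_isqrt_affine_le ((1 - u) * (1 - v)) c0).
  rewrite le_eqVlt; apply/orP; left; apply/eqP; apply: eq_integral => w _.
  by congr ((isqrt _)%:E); rewrite /area_ratio; ring.
under eq_integral do rewrite EFinM.
rewrite ge0_integralZl_EFin//.
- rewrite isqrt1 mulr1 in h; apply: (@le_trans _ _ (4%:E * 4%:E)%E).
    by apply: lee_wpmul2l.
  by rewrite -EFinM lee_fin; lra.
- by move=> v _; rewrite lee_fin ltW// isqrt_gt0.
- by rewrite /isqrt; meas.
Qed.

(** The ratio runs linearly in w from (1 - u)(1 - v) to u v, with difference u + v - 1, and [xi0] is
    a primitive of ln. *)
Lemma unif_nln_area u v : 0 < u < 1 -> 0 < v < 1 -> 1 < u + v ->
  (\int[unif]_w (nln (area_ratio u v w))%:E =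
   (1 - (u + v - 1)^-1 * (u * v * ln (u * v) - (1 - u) * (1 - v) * ln ((1 - u) * (1 - v))))%:E)%E.
Proof.
move=> u01 v01 uv; move: (u01) (v01) => /andP[u0 u1] /andP[v0 v1].
pose b := (1 - u) * (1 - v); pose s := u + v - 1.
have s0 : 0 < s by rewrite /s; lra.
have b0 : 0 < b by rewrite /b mulr_gt0// subr_gt0.
pose F w := - (s^-1 * xi0 (b + s * w)).
have pos (w : R) : 0 <= w -> 0 < b + s * w by move=> w0; rewrite ltr_pwDl// mulr_ge0// ltW.
have dF (w : R) : 0 <= w -> is_derive w 1 F (- ln (b + s * w)).
  move=> w0; have h := is_derive_affine_comp (is_derive_xi0 (pos w w0)).
  rewrite /F; apply: is_derive_eq; rewrite /GRing.scale /=.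
  by field; rewrite lt0r_neq0.
transitivity ((F 1 - F 0)%:E); last first.
  rewrite -/b -/s; congr (_%:E); rewrite /F mulr1 mulr0 addr0.
  have -> : b + s = u * v by rewrite /b /s; ring.
  have -> : u * v = b + s by rewrite /b /s; ring.
  by rewrite /xi0; field; rewrite lt0r_neq0.
apply: (@unif_FTC _ _ (fun w => - ln (b + s * w)) F).
- exact: (measurable_inner _ _ nonneg_measurable3_nln_area).
- by move=> w; rewrite lee_fin nln_ge0.
- move=> w w01; rewrite nlnE ?area_ratio_le1//; congr (- ln _)%:E.
  by rewrite /area_ratio /b /s; ring.
- move=> w /andP[w0 _].
  have h := is_derive_affine_comp (is_derive1_ln (pos w (ltW w0))).
  exact: ex_derive_continuous.
- by move=> w /andP[w0 _]; apply: dF; rewrite ltW.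
- by apply: is_derive_continuous (dF 0 _).
- by apply: is_derive_continuous (dF 1 _).
Qed.

Let I u v := (\int[unif]_w (nln (area_ratio u v w))%:E)%E.

Let I_ge0 u v : (0 <= I u v)%E.
Proof. exact: (unif1_ge0 _ _ nonneg_measurable3_nln_area). Qed.

Let measurable_I : measurable_fun setT (fun p : mR * mR => I p.1 p.2).
Proof. exact: (measurable_unif1 nonneg_measurable3_nln_area). Qed.

Let I_onem u v : I (1 - u) (1 - v) = I u v.
Proof.
rewrite /I -[RHS]unif_onem.
- by apply: eq_integral => w _; congr ((nln _)%:E); rewrite /area_ratio; ring.
- exact: (measurable_inner _ _ nonneg_measurable3_nln_area).
- by move=> w; rewrite lee_fin nln_ge0.
Qed.

(** On the line v = 1 + s - u the two logarithms split into those of u, 1 + s - u, 1 - u and u - s,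
    with quadratic weights; [xi1] and [xi3] supply the primitives. *)
Let diagonal_integral s : 0 < s < 1 ->
  (\int[mu]_(u in `]s, 1%R[) I u (1 + s - u)%R =
  ((1 - s) - s^-1 * (2 * ((1 + s) * (xi1 1 - xi1 s) - (xi3 1 - xi3 s)
     - ((1 - s) * xi1 (1 - s) - xi3 (1 - s)))))%:E)%E.
Proof.
move=> /andP[s0 s1].
pose f u := 1 - s^-1 * (u * (1 + s + -1 * u) * (ln (0 + 1 * u) + ln (1 + s + -1 * u))
  - (1 + -1 * u) * (- s + 1 * u) * (ln (1 + -1 * u) + ln (- s + 1 * u))).
pose F u := u - s^-1 * (((1 + s) * xi1 (0 + 1 * u) - xi3 (0 + 1 * u))
  - ((1 + s) * xi1 (1 + s + -1 * u) - xi3 (1 + s + -1 * u))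
  + ((1 - s) * xi1 (1 + -1 * u) - xi3 (1 + -1 * u))
  - ((1 - s) * xi1 (- s + 1 * u) - xi3 (- s + 1 * u))).
have If u : s < u < 1 -> I u (1 + s - u) = (f u)%:E.
  move=> /andP[su u1].
  rewrite /I unif_nln_area; [|lra|lra|lra].
  rewrite (_ : u + (1 + s - u) - 1 = s); last ring.
  rewrite (_ : 1 - (1 + s - u) = u - s); last ring.
  rewrite !lnM ?posrE; [|lra..].
  rewrite /f (_ : 0 + 1 * u = u); last ring.
  rewrite (_ : 1 + s + -1 * u = 1 + s - u); last ring.
  rewrite (_ : 1 + -1 * u = 1 - u); last ring.
  by rewrite (_ : - s + 1 * u = u - s)//; ring.
transitivity ((F 1 - F s)%:E); last first.
  have z : xi1 (0 : R) = 0 /\ xi3 (0 : R) = 0 by rewrite /xi1 /xi3; split; ring.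
  congr (_%:E); rewrite /F.
  rewrite !mul1r !mulr1 !add0r.
  rewrite (_ : 1 + s + -1 = s); last ring.
  rewrite (_ : 1 + -1 = 0); last ring.
  rewrite (_ : 1 + s + -1 * s = 1); last ring.
  rewrite (_ : 1 + -1 * s = 1 - s); last ring.
  rewrite (_ : - s + 1 = 1 - s); last ring.
  rewrite (_ : - s + s = 0); last ring.
  rewrite z.1 z.2.
  by field; rewrite lt0r_neq0.
transitivity (\int[mu]_(u in `]s, 1%R[) (f u)%:E)%E.
  by apply: eq_integral => u; rewrite inE /= in_itv /=; exact: If.
have p u : s < u < 1 -> [/\ 0 < 0 + 1 * u, 0 < 1 + s + -1 * u, 0 < 1 + -1 * u & 0 < - s + 1 * u].
  by move=> /andP[su u1]; split; lra.
have cF : continuous F.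
  have c (G : R -> R) k a b : continuous G -> continuous (fun u => k * G (a + b * u)).
    by move=> cG u; apply: cvgM; [exact: cvg_cst|exact: continuous_affine_comp].
  move=> u; apply: cvgB; first exact: cvg_id.
  apply: cvgM; first exact: cvg_cst.
  apply: cvgB; last first.
    by apply: cvgB; [apply/c/continuous_xi1|apply/continuous_affine_comp/continuous_xi3].
  apply: cvgD; last first.
    by apply: cvgB; [apply/c/continuous_xi1|apply/continuous_affine_comp/continuous_xi3].
  apply: cvgB.
    by apply: cvgB; [apply/c/continuous_xi1|apply/continuous_affine_comp/continuous_xi3].
  by apply: cvgB; [apply/c/continuous_xi1|apply/continuous_affine_comp/continuous_xi3].
apply: (@integral_itvoo_FTC _ f F).
- exact: s1.
- by move=> u su; rewrite -lee_fin -If.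
- move=> u /p[p1 p2 p3 p4].
  have h1 := is_derive_affine_comp (is_derive1_ln p1).
  have h2 := is_derive_affine_comp (is_derive1_ln p2).
  have h3 := is_derive_affine_comp (is_derive1_ln p3).
  have h4 := is_derive_affine_comp (is_derive1_ln p4).
  rewrite /f; exact: ex_derive_continuous.
- move=> u /p[p1 p2 p3 p4].
  have h1 := is_derive_affine_comp (is_derive_xi1 p1).
  have h2 := is_derive_affine_comp (is_derive_xi1 p2).
  have h3 := is_derive_affine_comp (is_derive_xi1 p3).
  have h4 := is_derive_affine_comp (is_derive_xi1 p4).
  have k1 := is_derive_affine_comp (is_derive_xi3 p1).
  have k2 := is_derive_affine_comp (is_derive_xi3 p2).
  have k3 := is_derive_affine_comp (is_derive_xi3 p3).
  have k4 := is_derive_affine_comp (is_derive_xi3 p4).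
  rewrite /F; apply: is_derive_eq; rewrite /GRing.scale /= /f.
  by field; rewrite lt0r_neq0.
- exact: cF.
- exact: cF.
Qed.

Let is_derive_pow n (c t : R) :
  is_derive t 1 (fun t => c * t ^+ n.+1) (c * (n.+1%:R * t ^+ n)).
Proof.
have h : is_derive t 1 (fun t : R => t ^+ n.+1) (n.+1%:R * t ^+ n).
  apply: DeriveDef; first exact: exprn_derivable.
  by rewrite exp_derive scaler1.
apply: is_derive_eq; rewrite /GRing.scale /=; ring.
Qed.

(** Terms of the power series of -ln(1 - s)/s, the one part of the integrand in s without an
    elementary primitive. The absolute value keeps them nonnegative off (0, 1). *)
Let geom (k : nat) (s : mR) : \bar R := (`|s| ^+ k / k.+1%:R)%:E.

Let geom_ge0 k s : (0 <= geom k s)%E.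
Proof. by rewrite lee_fin divr_ge0. Qed.

Let measurable_geom k : measurable_fun setT (geom k).
Proof.
apply/measurable_EFinP; apply: measurable_mul; last exact: measurable_cst.
by apply: measurable_funX; meas.
Qed.

Let log_series (s : mR) : \bar R := (\sum_(k <oo) geom k s)%E.

Let log_series_ge0 s : (0 <= log_series s)%E.
Proof. by apply: nneseries_ge0 => k _ _; exact: geom_ge0. Qed.

Let measurable_log_series : measurable_fun setT log_series.
Proof. by apply: ge0_emeasurable_sum => [k x _ _|k _]; [exact: geom_ge0|]. Qed.

(** The remainder after n terms is at most s^n s/(1 - s), since on [0, s] the derivatives of the two
    sides differ by s^n/(1 - s) - t^n/(1 - t) >= 0. This direction suffices because the term enters
    the mean with a minus sign. *)
Let log_series_ge s : 0 < s < 1 -> ((- ln (1 - s) / s)%:E <= log_series s)%E.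
Proof.
move=> /andP[s0 s1].
pose P (n : nat) (t : R) := \sum_(k < n) t ^+ k.+1 / k.+1%:R.
have dP (n : nat) (t : R) : is_derive t 1 (P n) (\sum_(k < n) t ^+ k).
  elim: n => [|n IHn].
    have -> : P 0%N = cst 0 by apply/funext => y; rewrite /P big_ord0.
    by rewrite big_ord0; exact: is_derive_cst.
  have -> : P n.+1 = (fun t => P n t + n.+1%:R^-1 * t ^+ n.+1).
    by apply/funext => y; rewrite /P big_ord_recr /= [in RHS]mulrC.
  have := is_derive_pow n n.+1%:R^-1 t; rewrite mulKf ?pnatr_eq0// => h.
  by rewrite big_ord_recr /=; exact: is_deriveD.
have bound n : - ln (1 - s) <= P n s + s ^+ n * (s / (1 - s)).
  pose F t := P n t + s ^+ n / (1 - s) * t + ln (1 - t).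
  have F0 : F 0 = 0.
    rewrite /F subr0 ln1 mulr0 !addr0 /P big1// => k _.
    by rewrite expr0n mul0r.
  have : F 0 <= F s.
    apply: (@is_derive_ge0_le _ F (fun t => \sum_(k < n) t ^+ k + s ^+ n / (1 - s) - (1 - t)^-1)).
    - exact: ltW.
    - move=> t /andP[t0 ts]; have h1 := dP n t.
      have p : 0 < 1 + -1 * t by lra.
      have h2 := is_derive_affine_comp (is_derive1_ln p).
      have h3 : is_derive t 1 (fun t => ln (1 - t)) (- (1 - t)^-1).
        have -> : (fun t => ln (1 - t)) = (fun y : R => ln (1 + -1 * y)).
          by apply/funext => y; congr ln; ring.
        by apply: is_derive_eq; rewrite (_ : 1 + -1 * t = 1 - t); ring.
      rewrite /F; apply: is_derive_eq; rewrite /GRing.scale /=; ring.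
    - move=> t /andP[t0 ts]; have t1 : 1 - t != 0 by apply/eqP; lra.
      have -> : \sum_(k < n) t ^+ k = (1 - t ^+ n) / (1 - t).
        by rewrite -opprB subrX1 -mulNr opprB mulrAC divff// mul1r.
      have s1' : 1 - s != 0 by apply/eqP; lra.
      have -> : (1 - t ^+ n) / (1 - t) + s ^+ n / (1 - s) - (1 - t)^-1 =
          s ^+ n / (1 - s) - t ^+ n / (1 - t) by field; rewrite s1' t1.
      rewrite subr_ge0.
      apply: ler_pM; rewrite ?exprn_ge0 ?invr_ge0//; [lra| |].
        by rewrite lerXn2r ?nnegrE// (le_trans t0).
      by rewrite lef_pV2 ?posrE; lra.
  rewrite F0 /F => h; rewrite -subr_ge0; move: h; congr (_ <= _); ring.
have lim0 : s ^+ n * (s / (1 - s)) @[n --> \oo] --> 0.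
  rewrite -[X in _ --> X](mul0r (s / (1 - s))); apply: cvgMl.
  by apply: cvg_expr; rewrite gtr0_norm.
have PE n : (P n s / s)%:E = (\sum_(0 <= k < n) geom k s)%E.
  rewrite /P big_mkord /geom sumEFin mulr_suml; congr (_%:E); apply: eq_bigr => k _.
  have k0 : k.+1%:R != 0 :> R by rewrite pnatr_eq0.
  rewrite (gtr0_norm s0) exprS; move: k0; move: (k.+1%:R) (s ^+ k) => a b a0.
  by field; rewrite a0 lt0r_neq0.
apply/lee_addgt0Pr => e e0.
have : \forall n \near \oo, s ^+ n * (s / (1 - s)) < e * s.
  have es : 0 < e * s by rewrite mulr_gt0.
  by apply: cvgr_lt lim0 _ _.
case=> n _ /(_ n (leqnn n)) /= hn.
apply: (@le_trans _ _ ((P n s / s)%:E + e%:E)%E).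
  rewrite -EFinD lee_fin ler_pdivrMr// mulrDl divfK ?lt0r_neq0//.
  by rewrite (le_trans (bound n))// lerD2l ltW.
by rewrite PE leeD2r// /log_series; apply: nneseries_lim_ge => k _ _; exact: geom_ge0.
Qed.

(** Termwise, the integral of s^k/(k+1) is 1/(k+1)^2. *)
Let integral_log_series : (\int[unif]_s log_series s <= (pi ^+ 2 / 6)%:E)%E.
Proof.
rewrite /log_series integral_nneseries//.
have E k : (\int[unif]_s geom k s = ((k.+1%:R ^+ 2)^-1)%:E)%E.
  have k0 : k.+1%:R != 0 :> R by rewrite pnatr_eq0.
  pose F (s : R) := (k.+1%:R ^+ 2)^-1 * s ^+ k.+1.
  have dF (s : R) : is_derive s 1 F (s ^+ k / k.+1%:R).
    apply: is_derive_eq; first exact: is_derive_pow.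
    by move: k0; move: (k.+1%:R) (s ^+ k) => a b a0; field.
  transitivity ((F 1 - F 0)%:E); last first.
    by congr (_%:E); rewrite /F expr1n expr0n /= mulr0 subr0 mulr1.
  apply: (@unif_FTC _ _ (fun s => s ^+ k / k.+1%:R) F).
  - exact: measurable_geom.
  - by move=> s; exact: geom_ge0.
  - by move=> s /andP[s0 _]; rewrite /geom gtr0_norm.
  - by move=> s _; apply: cvgM; [exact: exprn_continuous|exact: cvg_cst].
  - exact: is_derive_continuous (dF 0).
  - exact: is_derive_continuous (dF 1).
under eq_eseriesr do rewrite E.
apply: lime_le.
  by apply: is_cvg_nneseries => n _ _; rewrite lee_fin invr_ge0 sqr_ge0.
by apply: nearW => n; rewrite sumEFin lee_fin big_mkord; exact: sum_inv_sq_le.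
Qed.

Local Notation D := (sheared I).

Let D_ge0 := sheared_ge0 I_ge0.

Let measurable_D := measurable_sheared measurable_I.

(** The part of the inner integral with an elementary primitive; the rest, -(1/3)(-ln(1 - s)/s), is
    left to the series. *)
Let E s := 7 / 3 * (1 - s) + (s + s ^+ 2 / 3) * ln s
  - (1 - s + s ^+ 2 / 3) * ln (1 - s).

Let D_integral s : 0 < s < 1 ->
  (\int[unif]_u D u s = (E s - 3^-1 * (- ln (1 - s) / s))%:E)%E.
Proof.
move=> s01; move: (s01) => /andP[s0 s1].
have mDs : measurable_fun setT (fun u : mR => D u s).
  apply: (measurableT_comp measurable_D (g := fun u : mR => ((u, s) : mR * mR))).
  by meas.
rewrite unifE// (@integral_itvoo_split _ _ 0 s 1)//.
rewrite [X in (X + _)%E]integral0_eq ?add0e; last first.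
  move=> u /=; rewrite in_itv /= => /andP[_ us].
  by rewrite /sheared (lt_gtF us) andbF.
have -> : (\int[mu]_(u in `]s, 1%R[) D u s = \int[mu]_(u in `]s, 1%R[) I u (1 + s - u)%R)%E.
  apply: eq_integral => u; rewrite inE /= in_itv /= => /andP[su _].
  by rewrite /sheared s0 su.
rewrite diagonal_integral//; congr (_%:E).
rewrite /E /xi1 /xi3 ln1; move: (ln s) (ln (1 - s)) => a b.
by field; rewrite lt0r_neq0.
Qed.

(** No calculus is involved: by [D_integral], E is the integral of a nonnegative function plus
    (1/3)(-ln(1 - s)/s) >= 0. *)
Let E_ge0 s : 0 < s < 1 -> 0 <= E s.
Proof.
move=> s01; have : (0 <= \int[unif]_u D u s)%E by apply: integral_ge0 => u _; exact: D_ge0.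
rewrite D_integral// lee_fin; move: s01 => /andP[s0 s1].
have : 0 <= - ln (1 - s) / s by rewrite divr_ge0 ?oppr_ge0 ?ln_le0//; lra.
lra.
Qed.

(** The truncation makes the integrand nonnegative off (0, 1); inside, it changes nothing by
    [E_ge0]. *)
Let integral_E : (\int[unif]_s (Num.max 0 (E s))%:E = (4 / 3)%:E)%E.
Proof.
pose F s := 7 / 3 * s - 7 / 6 * s ^+ 2 + xi1 (0 + 1 * s) + 3^-1 * xi3 (0 + 1 * s)
  + 3^-1 * (xi0 (1 + -1 * s) + xi1 (1 + -1 * s) + xi3 (1 + -1 * s)).
have cF : continuous F.
  have c (k a b : R) (G : R -> R) : continuous G -> continuous (fun u => k * G (a + b * u)).
    by move=> cG u; apply: cvgM; [exact: cvg_cst|exact: continuous_affine_comp].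
  move=> u; apply: cvgD.
    apply: cvgD; last exact/c/continuous_xi3.
    apply: cvgD; last exact/continuous_affine_comp/continuous_xi1.
    apply: cvgB; first by apply: cvgM; [exact: cvg_cst|exact: cvg_id].
    by apply: cvgM; [exact: cvg_cst|exact: exprn_continuous].
  apply: cvgM; first exact: cvg_cst.
  apply: cvgD; last exact/continuous_affine_comp/continuous_xi3.
  apply: cvgD; last exact/continuous_affine_comp/continuous_xi1.
  exact/continuous_affine_comp/continuous_xi0.
transitivity ((F 1 - F 0)%:E); last first.
  congr (_%:E); rewrite /F !mulr1 !mulr0 !addr0 !add0r.
  rewrite (_ : 1 + -1 = 0); last ring.
  rewrite /xi0 /xi1 /xi3 ln1 (ln0 (lexx 0)).
  by field.
have p s : 0 < s < 1 -> 0 < 0 + 1 * s /\ 0 < 1 + -1 * s.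
  by move=> /andP[s0 s1]; split; lra.
apply: (@unif_FTC _ _ E F).
- by rewrite /E; meas; apply: measurable_funX; meas.
- by move=> s; rewrite lee_fin le_max lexx.
- by move=> s s01; congr (_%:E); apply: max_r; exact: E_ge0.
- move=> s /p[p1 p2].
  have -> : E = fun s => 7 / 3 * (1 - s) + (s + s ^+ 2 / 3) * ln (0 + 1 * s)
      - (1 - s + s ^+ 2 / 3) * ln (1 + -1 * s).
    by apply/funext => t; rewrite /E add0r mul1r mulN1r.
  have h1 := is_derive_affine_comp (is_derive1_ln p1).
  have h2 := is_derive_affine_comp (is_derive1_ln p2).
  exact: ex_derive_continuous.
- move=> s /p[p1 p2].
  have h1 := is_derive_affine_comp (is_derive_xi1 p1).
  have h2 := is_derive_affine_comp (is_derive_xi3 p1).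
  have h3 := is_derive_affine_comp (is_derive_xi0 p2).
  have h4 := is_derive_affine_comp (is_derive_xi1 p2).
  have h5 := is_derive_affine_comp (is_derive_xi3 p2).
  rewrite /F; apply: is_derive_eq; rewrite /GRing.scale /= /E.
  rewrite (_ : 0 + 1 * s = s); last ring.
  rewrite (_ : 1 + -1 * s = 1 - s); last ring.
  by field.
- exact: cF.
- exact: cF.
Qed.

(** Twice the contribution of the half-square: 2 (4/3 - (1/3)(pi^2/6)). *)
Lemma uniform3_nln_area_ge : ((8 / 3 - pi ^+ 2 / 9)%:E <=
  uniform3 (fun u v w : mR => (nln (area_ratio u v w))%:E))%E.
Proof.
apply: le_trans (sheared_integral_le I_ge0 measurable_I I_onem).
have mD1 : measurable_fun setT (fun s => \int[unif]_u D u s)%E.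
  apply: (measurable_unif (f := fun s u => D u s)) => //.
  apply: (measurableT_comp measurable_D (g := fun p : mR * mR => ((p.2, p.1) : mR * mR))).
  by meas.
have D1 s : (0 <= \int[unif]_u D u s)%E by apply: integral_ge0 => u _; exact: D_ge0.
have mL : measurable_fun setT (fun s => (3^-1)%:E * log_series s)%E.
  exact: emeasurable_funM.
have L0 s : (0 <= (3^-1)%:E * log_series s)%E by rewrite mule_ge0.
have : ((4 / 3)%:E <= \int[unif]_s \int[unif]_u D u s + (pi ^+ 2 / 18)%:E)%E.
  apply: (@le_trans _ _ (\int[unif]_s \int[unif]_u D u s + \int[unif]_s ((3^-1)%:E * log_series s))%E).
    rewrite -integral_E -ge0_integralD//.
    apply: unif_le01.
    - by rewrite /E; meas; apply: measurable_funX; meas.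
    - exact: emeasurable_funD.
    - by move=> s; rewrite lee_fin le_max lexx.
    - by move=> s; rewrite adde_ge0.
    move=> s s01; rewrite D_integral//.
    apply: (@le_trans _ _ ((E s - 3^-1 * (- ln (1 - s) / s))%:E + (3^-1)%:E * (- ln (1 - s) / s)%:E)%E).
      rewrite -EFinM -EFinD subrK lee_fin ge_max lexx andbT.
      exact: E_ge0.
    by apply: leeD2l; apply: lee_wpmul2l => //; exact: log_series_ge.
  apply: leeD2l; rewrite ge0_integralZl_EFin//.
  apply: (@le_trans _ _ ((3^-1)%:E * (pi ^+ 2 / 6)%:E)%E).
    by apply: lee_wpmul2l.
  by rewrite -EFinM lee_fin le_eqVlt; apply/orP; left; apply/eqP; field.
rewrite -leeBlDr// -EFinB => h.
apply: (@le_trans _ _ (2%:E * (4 / 3 - pi ^+ 2 / 18)%:E)%E).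
  by rewrite -EFinM lee_fin le_eqVlt; apply/orP; left; apply/eqP; field.
by apply: lee_wpmul2l.
Qed.

End AreaRatio.

(** * One-step moments to first order in the exponent *)

Section OneStep.
Variable R : realType.
Local Notation mR := (measurableTypeR R).
Implicit Types a b c p t A x : R.

Lemma nonneg_measurable3_EFin (f : mR -> mR -> mR -> R) :
  measurable_fun setT (fun q : mR * mR * mR => f q.1.1 q.1.2 q.2) ->
  (forall u v w, 0 <= f u v w) -> nonneg_measurable3 (fun u v w : mR => (f u v w)%:E).
Proof. by move=> mf f0; split; [exact/measurable_EFinP|move=> *; rewrite lee_fin]. Qed.

(** Integrates a pointwise inequality whose negative terms have been moved across, so that nothing
    is subtracted in the extended reals. *)
Lemma uniform3_affine_le1 (X Y Z : mR -> mR -> mR -> \bar R) (s t : R) :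
  nonneg_measurable3 X -> nonneg_measurable3 Y -> nonneg_measurable3 Z ->
  0 <= s -> 0 <= t ->
  (forall u v w : R, 0 < u < 1 -> 0 < v < 1 -> 0 < w < 1 ->
    (X u v w + s%:E * Y u v w <= 1 + t%:E * Z u v w)%E) ->
  (uniform3 X + s%:E * uniform3 Y <= 1 + t%:E * uniform3 Z)%E.
Proof.
move=> nX nY nZ s0 t0 XYZ.
have nsY := nonneg_measurable3Z s0 nY; have ntZ := nonneg_measurable3Z t0 nZ.
have n1 := nonneg_measurable3_cst (@ler01 R).
rewrite -(uniform3Z s0 nY) -(uniform3Z t0 nZ) -(uniform3D nX nsY).
rewrite -[X in (_ <= X + _)%E](@uniform3_cst R 1%:E) -(uniform3D n1 ntZ).
apply: uniform3_le.
- exact: (nonneg_measurable3D nX nsY).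
- exact: (nonneg_measurable3D n1 ntZ).
- exact: XYZ.
Qed.

Lemma uniform3_affine_le2 (X Y Z N : mR -> mR -> mR -> \bar R) (s t : R) :
  nonneg_measurable3 X -> nonneg_measurable3 Y -> nonneg_measurable3 Z ->
  nonneg_measurable3 N -> 0 <= s -> 0 <= t ->
  (forall u v w : R, 0 < u < 1 -> 0 < v < 1 -> 0 < w < 1 ->
    (X u v w <= 1 + s%:E * Y u v w + (t%:E * Z u v w + N u v w))%E) ->
  (uniform3 X <= 1 + s%:E * uniform3 Y + (t%:E * uniform3 Z + uniform3 N))%E.
Proof.
move=> nX nY nZ nN s0 t0 XYZ.
have nsY := nonneg_measurable3Z s0 nY; have ntZ := nonneg_measurable3Z t0 nZ.
have n1 := nonneg_measurable3_cst (@ler01 R).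
rewrite -(uniform3Z s0 nY) -(uniform3Z t0 nZ) -(uniform3D ntZ nN).
rewrite -[X in (_ <= X + _ + _)%E](@uniform3_cst R 1%:E) -(uniform3D n1 nsY).
have n1sY := nonneg_measurable3D n1 nsY; have ntZN := nonneg_measurable3D ntZ nN.
rewrite -(uniform3D n1sY ntZN).
by apply: uniform3_le => //; exact: (nonneg_measurable3D n1sY ntZN).
Qed.

(** Integrate [expRN_le_linear] at y = -ln D. The constant is 64 = 4 * 16, where 16 bounds the mean
    of D^(-1/2). *)
Lemma area_moment_le t : 0 <= t ->
  (uniform3 (fun u v w : mR => (expR (- (t * nln (area_ratio u v w))))%:E)
   <= (1 - t * (8 / 3 - pi ^+ 2 / 9) + 64 * t ^+ 2)%:E)%E.
Proof.
move=> t0.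
have nX : nonneg_measurable3 (fun u v w : mR => (expR (- (t * nln (area_ratio u v w))))%:E).
  by apply: nonneg_measurable3_EFin => [|*]; [rewrite /area_ratio; meas|exact: expR_ge0].
have nY := nonneg_measurable3_nln_area R.
have nI : nonneg_measurable3 (fun u v w : mR => (isqrt (area_ratio u v w))%:E).
  by apply: nonneg_measurable3_isqrt; rewrite /area_ratio; meas.
have t2 : 0 <= 4 * t ^+ 2 by rewrite mulr_ge0// sqr_ge0.
have h : (uniform3 (fun u v w : mR => (expR (- (t * nln (area_ratio u v w))))%:E)
    + t%:E * uniform3 (fun u v w : mR => (nln (area_ratio u v w))%:E)
    <= 1 + (4 * t ^+ 2)%:E * uniform3 (fun u v w : mR => (isqrt (area_ratio u v w))%:E))%E.
  apply: (uniform3_affine_le1 nX nY nI t0 t2).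
  move=> u v w u01 v01 w01; rewrite -!EFinM -!EFinD lee_fin.
  have D0 := area_ratio_gt0 u01 v01 w01; have D1 := area_ratio_le1 u01 v01 w01.
  have := expRN_le_linear t0 (nln_ge0 (area_ratio u v w)).
  have -> : expR (nln (area_ratio u v w) / 2) = isqrt (area_ratio u v w).
    by rewrite nlnE// /isqrt gtr0_norm.
  lra.
have hI := uniform3_isqrt_area_le R.
have hY := uniform3_nln_area_ge R.
rewrite -(@leeD2rE _ (t * (8 / 3 - pi ^+ 2 / 9))%:E)//.
apply: (@le_trans _ _ (1 + (4 * t ^+ 2)%:E * 16%:E)%E); last first.
  by rewrite -!EFinM -!EFinD lee_fin; lra.
apply: le_trans (leeD2l _ (lee_wpmul2l _ hI)); last by rewrite lee_fin.
apply: le_trans h; apply: leeD2l; rewrite EFinM; apply: lee_wpmul2l => //.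
Qed.

Lemma range3_le_bounds (m M a b c : R) : m <= a <= M -> m <= b <= M -> m <= c <= M ->
  range3 a b c <= M - m.
Proof.
move=> /andP[h1 h2] /andP[h3 h4] /andP[h5 h6]; rewrite /range3; apply: lerB.
  by rewrite !ge_max h2 h4 h6.
by rewrite !le_min h1 h3 h5.
Qed.

Lemma seg_bounds (m M p q u : R) : m <= p <= M -> m <= q <= M -> 0 <= u <= 1 ->
  m <= seg p q u <= M.
Proof.
move=> /andP[h1 h2] /andP[h3 h4] /andP[u0 u1]; rewrite /seg.
have -> : p + u * (q - p) = (1 - u) * p + u * q by ring.
have v0 : 0 <= 1 - u by lra.
have := ler_wpM2l v0 h1; have := ler_wpM2l v0 h2.
have := ler_wpM2l u0 h3; have := ler_wpM2l u0 h4; lra.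
Qed.

Lemma range3_seg_le x0 x1 x2 u v w : 0 <= u <= 1 -> 0 <= v <= 1 -> 0 <= w <= 1 ->
  range3 (seg x1 x2 u) (seg x2 x0 v) (seg x0 x1 w) <= range3 x0 x1 x2.
Proof.
move=> u01 v01 w01.
have b0 : Num.min x0 (Num.min x1 x2) <= x0 <= Num.max x0 (Num.max x1 x2).
  by rewrite ge_min le_max lexx.
have b1 : Num.min x0 (Num.min x1 x2) <= x1 <= Num.max x0 (Num.max x1 x2).
  by rewrite !ge_min !le_max lexx !orbT.
have b2 : Num.min x0 (Num.min x1 x2) <= x2 <= Num.max x0 (Num.max x1 x2).
  by rewrite !ge_min !le_max lexx !orbT.
by apply: range3_le_bounds; exact: seg_bounds.
Qed.

Lemma expR_nln_half_le (r g : R) : g != 0 -> `|g| <= r -> r <= 1 -> expR (nln r / 2) <= isqrt g.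
Proof.
move=> g0 gr r1; have ng : 0 < `|g| by rewrite normr_gt0.
rewrite nlnE// /isqrt ler_expR ler_pM2r// lerN2 ler_ln ?posrE//.
exact: lt_le_trans ng gr.
Qed.

(** Integrate [expR_le_linear] at y = -ln rho. The range is at least any gap, so rho^(-1/2) is at
    most the inverse square root of an affine form, of mean at most 8: hence 128 = 16 * 8. The
    [infty_at0] term discards the null set where that gap vanishes. *)
Lemma range_moment_le t x0 x1 x2 : 0 <= t <= 4^-1 -> x0 != x1 -> x1 != x2 -> x0 != x2 ->
  (uniform3 (fun u v w : mR =>
     (expR (t * nln (range3 (seg x1 x2 u) (seg x2 x0 v) (seg x0 x1 w) / range3 x0 x1 x2)))%:E)
   <= (1 + t * (5 / 6 - ln 2 / 3) + 128 * t ^+ 2)%:E)%E.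
Proof.
move=> t01 x01 x12 x02; move: (t01) => /andP[t0 t4].
have r0 := range3_gt0 x2 x01; set r := range3 x0 x1 x2 in r0 *.
pose rho (u v w : mR) := range3 (seg x1 x2 u) (seg x2 x0 v) (seg x0 x1 w) / r.
pose g (u v w : mR) := (seg x1 x2 u - seg x2 x0 v) / r.
have t2 : 0 <= 16 * t ^+ 2 by rewrite mulr_ge0// sqr_ge0.
have nX : nonneg_measurable3 (fun u v w : mR => (expR (t * nln (rho u v w)))%:E).
  by apply: nonneg_measurable3_EFin => [|*]; [rewrite /rho /seg; meas|exact: expR_ge0].
have nY : nonneg_measurable3 (fun u v w : mR => (nln (rho u v w))%:E).
  by apply: nonneg_measurable3_EFin => [|*]; [rewrite /rho /seg; meas|exact: nln_ge0].
have nI : nonneg_measurable3 (fun u v w : mR => (isqrt (g u v w))%:E).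
  by apply: nonneg_measurable3_isqrt; rewrite /g /seg; meas.
have nN : nonneg_measurable3 (fun u v w : mR => infty_at0 ((seg x1 x2 u - seg x2 x0 v) / 1)).
  by apply: nonneg_measurable3_infty_at0; rewrite /seg; meas.
have [hI _ _] := uniform3_isqrt_gap_le x2 x01.
have [hN _ _] := uniform3_infty_at0_gap x01 x12.
have hY := uniform3_nln_range3 x01 x12 x02.
have := uniform3_affine_le2 nX nY nI nN t0 t2; rewrite hN adde0 => h.
apply: le_trans (h _) _.
  move=> u v w u01 v01 w01; rewrite /infty_at0 divr1.
  case: ifPn => g0.
    by rewrite !addey ?leey.
  rewrite adde0 -!EFinM -!EFinD lee_fin.
  have rho1 : rho u v w <= 1.
    rewrite /rho ler_pdivrMr// mul1r range3_seg_le//.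
    - by move: u01 => /andP[? ?]; rewrite !ltW.
    - by move: v01 => /andP[? ?]; rewrite !ltW.
    - by move: w01 => /andP[? ?]; rewrite !ltW.
  have gn0 : g u v w != 0 by rewrite /g mulf_neq0// invr_eq0 lt0r_neq0.
  have grho : `|g u v w| <= rho u v w.
    by rewrite /g /rho normrM normfV (gtr0_norm r0) ler_pM2r ?invr_gt0// range3_ge.
  have h1 := expR_nln_half_le gn0 grho rho1.
  have h2 := expR_le_linear t01 (nln_ge0 (rho u v w)).
  have h3 := ler_wpM2l t2 h1.
  by move: h2 h3; rewrite -!mulrA; lra.
apply: (@le_trans _ _ (1%:E + t%:E * (5 / 6 - ln 2 / 3)%:E + (16 * t ^+ 2)%:E * 8%:E)%E).
  apply: leeD; last by apply: lee_wpmul2l => //; rewrite lee_fin.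
  by apply: leeD2l; apply: lee_wpmul2l => //; rewrite lee_fin.
by rewrite -!EFinM -!EFinD lee_fin; lra.
Qed.

End OneStep.

(** * The Lyapunov function *)

Section Lyapunov.
Variable R : realType.
Local Notation mR := (measurableTypeR R).
Implicit Types a b c p t A x : R.

Definition gap3 a b c : R := Num.min `|a - b| (Num.min `|b - c| `|c - a|).

(** [Num.max 0 A] merges all A <= 0 into the value 0, so the first term is infinite exactly
    there. *)
Definition penalty A x0 x1 x2 : \bar R :=
  (infty_at0 (Num.max 0 A)%R +
   (infty_at0 (x0 - x1)%R + infty_at0 (x1 - x2)%R + infty_at0 (x2 - x0)%R))%E.

(* [(A / f ^ 2) ^ p]; the penalty makes it [+oo] on the degenerate states, where the
   logarithms take junk values. *)
Definition lyap p (f : R -> R -> R -> R) A x0 x1 x2 : \bar R :=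
  ((expR (p * (ln A - 2 * ln (f x0 x1 x2))))%:E + penalty A x0 x1 x2)%E.

Lemma penalty_ge0 A x0 x1 x2 : (0 <= penalty A x0 x1 x2)%E.
Proof. by rewrite /penalty !adde_ge0// infty_at0_ge0. Qed.

Lemma lyap_ge0 p f A x0 x1 x2 : (0 <= lyap p f A x0 x1 x2)%E.
Proof. by rewrite /lyap adde_ge0 ?penalty_ge0// lee_fin expR_ge0. Qed.

Lemma penaltyP A x0 x1 x2 : penalty A x0 x1 x2 = +oo%E \/
  [/\ penalty A x0 x1 x2 = 0%E, 0 < A, x0 != x1, x1 != x2 & x2 != x0].
Proof.
rewrite /penalty /infty_at0 !subr_eq0.
have -> : (Num.max 0 A == 0) = (A <= 0).
  by have [A0|A0] := leP A 0; [rewrite eqxx|rewrite gt_eqF].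
case: (leP A 0) => A0; case: (eqVneq x0 x1) => x01; case: (eqVneq x1 x2) => x12;
  case: (eqVneq x2 x0) => x20 //=; (try by left); right.
by rewrite !adde0.
Qed.

Lemma uniform3_affine_le6 (F X1 X2 X3 N1 N2 N3 : mR -> mR -> mR -> \bar R) (s1 s2 s3 : R) :
  nonneg_measurable3 F ->
  nonneg_measurable3 X1 -> nonneg_measurable3 X2 -> nonneg_measurable3 X3 ->
  nonneg_measurable3 N1 -> nonneg_measurable3 N2 -> nonneg_measurable3 N3 ->
  0 <= s1 -> 0 <= s2 -> 0 <= s3 ->
  (forall u v w : R, 0 < u < 1 -> 0 < v < 1 -> 0 < w < 1 ->
    (F u v w <= (s1%:E * X1 u v w + s2%:E * X2 u v w + s3%:E * X3 u v w)
      + (N1 u v w + N2 u v w + N3 u v w))%E) ->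
  (uniform3 F <= (s1%:E * uniform3 X1 + s2%:E * uniform3 X2 + s3%:E * uniform3 X3)
      + (uniform3 N1 + uniform3 N2 + uniform3 N3))%E.
Proof.
move=> nF nX1 nX2 nX3 nN1 nN2 nN3 s10 s20 s30 H.
have n1 := nonneg_measurable3Z s10 nX1; have n2 := nonneg_measurable3Z s20 nX2.
have n3 := nonneg_measurable3Z s30 nX3.
have n12 := nonneg_measurable3D n1 n2; have n123 := nonneg_measurable3D n12 n3.
have m12 := nonneg_measurable3D nN1 nN2; have m123 := nonneg_measurable3D m12 nN3.
apply: (@le_trans _ _ (uniform3 (fun u v w =>
  (s1%:E * X1 u v w + s2%:E * X2 u v w + s3%:E * X3 u v w)
      + (N1 u v w + N2 u v w + N3 u v w)))%E).
  by apply: uniform3_le => //; exact: (nonneg_measurable3D n123 m123).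
rewrite le_eqVlt; apply/orP; left; apply/eqP.
rewrite (uniform3D n123 m123); congr (_ + _)%E.
  rewrite (uniform3D n12 n3); congr (_ + _)%E; last exact: uniform3Z.
  by rewrite (uniform3D n1 n2); congr (_ + _)%E; exact: uniform3Z.
by rewrite (uniform3D m12 nN3); congr (_ + _)%E; exact: uniform3D.
Qed.

Lemma measurable_infty_at0 d (T : measurableType d) (f : T -> R) :
  measurable_fun setT f -> measurable_fun setT (fun z => infty_at0 (f z)).
Proof.
move=> mf; apply: (@measurable_fun_ifT _ _ _ _ (cst +oo%E) (cst 0%E) (fun z => f z == 0)) => //.
by apply: measurable_fun_eqr => //; exact: measurable_cst.
Qed.

Lemma measurable_lyap d (T : measurableType d) p (f : R -> R -> R -> R) (A x0 x1 x2 : T -> R) :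
  measurable_fun setT (fun z => f (x0 z) (x1 z) (x2 z)) -> measurable_fun setT A ->
  measurable_fun setT x0 -> measurable_fun setT x1 -> measurable_fun setT x2 ->
  measurable_fun setT (fun z => lyap p f (A z) (x0 z) (x1 z) (x2 z)).
Proof.
move=> mf mA m0 m1 m2; rewrite /lyap /penalty.
apply: emeasurable_funD; first by meas.
apply: emeasurable_funD; first by apply: measurable_infty_at0; meas.
apply: emeasurable_funD; last by apply: measurable_infty_at0; meas.
by apply: emeasurable_funD; apply: measurable_infty_at0; meas.
Qed.

Section Step.
Variables (A x0 x1 x2 : R).

Let A' (u v w : mR) : R := A * area_ratio u v w.
Let y0 (u v w : mR) : R := seg x1 x2 u.
Let y1 (u v w : mR) : R := seg x2 x0 v.
Let y2 (u v w : mR) : R := seg x0 x1 w.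

Definition lyap_step p f : \bar R :=
  uniform3 (fun u v w : mR =>
    lyap p f (A' u v w) (y0 u v w) (y1 u v w) (y2 u v w)).

Let nN01 : nonneg_measurable3 (fun u v w => infty_at0 (y0 u v w - y1 u v w)).
Proof. by apply: nonneg_measurable3_infty_at0; rewrite /y0 /y1 /seg; meas. Qed.

Let nN12 : nonneg_measurable3 (fun u v w => infty_at0 (y1 u v w - y2 u v w)).
Proof. by apply: nonneg_measurable3_infty_at0; rewrite /y1 /y2 /seg; meas. Qed.

Let nN20 : nonneg_measurable3 (fun u v w => infty_at0 (y2 u v w - y0 u v w)).
Proof. by apply: nonneg_measurable3_infty_at0; rewrite /y2 /y0 /seg; meas. Qed.

Hypotheses (x01 : x0 != x1) (x12 : x1 != x2).

Let N_eq0 : [/\ uniform3 (fun u v w => infty_at0 (y0 u v w - y1 u v w)) = 0%E,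
  uniform3 (fun u v w => infty_at0 (y1 u v w - y2 u v w)) = 0%E &
  uniform3 (fun u v w => infty_at0 (y2 u v w - y0 u v w)) = 0%E].
Proof.
have [h1 h2 h3] := uniform3_infty_at0_gap x01 x12.
split; [rewrite -[RHS]h1|rewrite -[RHS]h2|rewrite -[RHS]h3];
  by apply: uniform3_ext => u v w; rewrite divr1.
Qed.

Hypotheses (A0 : 0 < A) (x20 : x2 != x0).

Let r := range3 x0 x1 x2.
(** The current value (A / r^2)^p, to which the means after one step are compared. *)
Let c p := expR (p * (ln A - 2 * ln r)).

Let penalty_step u v w : 0 < u < 1 -> 0 < v < 1 -> 0 < w < 1 ->
  penalty (A' u v w) (y0 u v w) (y1 u v w) (y2 u v w) =
  (infty_at0 (y0 u v w - y1 u v w)%R + infty_at0 (y1 u v w - y2 u v w)%R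
   + infty_at0 (y2 u v w - y0 u v w)%R)%E.
Proof.
move=> u01 v01 w01; rewrite /penalty.
have A1 : 0 < A' u v w by rewrite /A' mulr_gt0// area_ratio_gt0.
by rewrite [X in infty_at0 X](max_r (ltW A1)) [X in (X + _)%E]/infty_at0 (gt_eqF A1) add0e.
Qed.

Let nF p f : measurable_fun setT
    (fun q : mR * mR * mR => f (y0 q.1.1 q.1.2 q.2) (y1 q.1.1 q.1.2 q.2) (y2 q.1.1 q.1.2 q.2)) ->
  nonneg_measurable3 (fun u v w : mR =>
    lyap p f (A' u v w) (y0 u v w) (y1 u v w) (y2 u v w)).
Proof.
move=> mf; split; last by move=> *; exact: lyap_ge0.
apply: (@measurable_lyap _ (mR * mR * mR)%type p f (fun q => A' q.1.1 q.1.2 q.2)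
  (fun q => y0 q.1.1 q.1.2 q.2) (fun q => y1 q.1.1 q.1.2 q.2) (fun q => y2 q.1.1 q.1.2 q.2)) => //.
- by rewrite /A' /area_ratio; meas.
- by rewrite /y0 /seg; meas.
- by rewrite /y1 /seg; meas.
- by rewrite /y2 /seg; meas.
Qed.

(** Off the degenerate set this is the real inequality; on it both sides are +oo. *)
Let finite_or_infty (a b : R) (N1 N2 N3 : R) : 
  (N1 != 0 -> N2 != 0 -> N3 != 0 -> a <= b) ->
  (a%:E + (infty_at0 N1 + infty_at0 N2 + infty_at0 N3) <=
   b%:E + (infty_at0 N1 + infty_at0 N2 + infty_at0 N3))%E.
Proof.
move=> ab; rewrite /infty_at0.
case: (eqVneq N1 0) => n1; case: (eqVneq N2 0) => n2; case: (eqVneq N3 0) => n3 //=.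
by rewrite !adde0 lee_fin ab.
Qed.

(** AM-GM separates the dependent factors: D^p rho^(-2p) <= (D^(2p) + rho^(-4p))/2. The moments at t
    = 2p and t = 4p give the drift, as 1 + ln 4/3 = 8/3 - 2 (5/6 - ln 2/3), and the error 1152 = (64
    * 2^2 + 128 * 4^2) / 2. The condition p <= 1/16 is 4p <= 1/4. *)
Lemma lyap_step_range p : 0 <= p <= 16^-1 -> (lyap_step p (@range3 R) <=
  ((1 - p * (1 + ln 4 / 3 - pi ^+ 2 / 9) + 1152 * p ^+ 2) * c p)%:E)%E.
Proof.
move=> /andP[p0 p16]; have r0 := range3_gt0 x2 x01.
have [e1 e2 e3] := N_eq0.
pose X (u v w : mR) := expR (- (2 * p * nln (area_ratio u v w))).
pose Y (u v w : mR) := expR (4 * p * nln (range3 (y0 u v w) (y1 u v w) (y2 u v w) / r)).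
have nX : nonneg_measurable3 (fun u v w : mR => (X u v w)%:E).
  by apply: nonneg_measurable3_EFin => [|*]; [rewrite /X /area_ratio; meas|exact: expR_ge0].
have nY : nonneg_measurable3 (fun u v w : mR => (Y u v w)%:E).
  by apply: nonneg_measurable3_EFin => [|*]; [rewrite /Y /y0 /y1 /y2 /seg; meas|exact: expR_ge0].
have c0 : 0 < c p by exact: expR_gt0.
have c2 : 0 <= c p / 2 by rewrite divr_ge0// ltW.
have nFp : nonneg_measurable3 (fun u v w : mR =>
    lyap p (@range3 R) (A' u v w) (y0 u v w) (y1 u v w) (y2 u v w)).
  by apply: nF; rewrite /y0 /y1 /y2 /seg; meas.
have := uniform3_affine_le6 nFp nX nY nX nN01 nN12 nN20 c2 c2 (lexx 0).
rewrite e1 e2 e3 !adde0 mul0e adde0 => h.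
apply: le_trans (h _) _.
  move=> u v w u01 v01 w01; rewrite /lyap penalty_step// mul0e adde0 -!EFinM -!EFinD.
  apply: finite_or_infty => n1 _ _.
  have D0 := area_ratio_gt0 u01 v01 w01; have D1 := area_ratio_le1 u01 v01 w01.
  have rho0 : 0 < range3 (y0 u v w) (y1 u v w) (y2 u v w) / r.
    by rewrite divr_gt0// range3_gt0// -subr_eq0.
  have rho1 : range3 (y0 u v w) (y1 u v w) (y2 u v w) / r <= 1.
    rewrite ler_pdivrMr// mul1r range3_seg_le//.
    - by move: u01 => /andP[? ?]; rewrite !ltW.
    - by move: v01 => /andP[? ?]; rewrite !ltW.
    - by move: w01 => /andP[? ?]; rewrite !ltW.
  rewrite /X /Y !nlnE//; set D := area_ratio u v w in D0 D1 *.
  set g := range3 _ _ _ in rho0 rho1 *.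
  have g0 : 0 < g by rewrite range3_gt0// -subr_eq0.
  rewrite (ln_div g0 r0) /A' -/D (lnM A0 D0).
  have -> : p * (ln A + ln D - 2 * ln g) =
      p * (ln A - 2 * ln r) + (p * ln D + - 2 * p * (ln g - ln r)) by ring.
  rewrite expRD -/(c p) expRD.
  have -> : - (2 * p * - ln D) = p * ln D + p * ln D by ring.
  have -> : 4 * p * - (ln g - ln r) =
      - 2 * p * (ln g - ln r) + - 2 * p * (ln g - ln r) by ring.
  rewrite !expRD; set a := expR (p * ln D); set b := expR (- 2 * p * (ln g - ln r)).
  have := sqr_ge0 (a - b); have := ltW c0; move: (c p) => k k0 ab.
  have : k * (a * b) <= k * ((a * a + b * b) / 2).
    by apply: ler_wpM2l => //; move: ab; rewrite sqrrB; lra.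
  lra.
have p2 : 0 <= 2 * p by rewrite mulr_ge0.
have p4 : 0 <= 4 * p <= 4^-1 by apply/andP; split; lra.
have x02 : x0 != x2 by rewrite eq_sym.
have hX := area_moment_le p2.
have hY := range_moment_le p4 x01 x12 x02.
apply: (@le_trans _ _ ((c p / 2)%:E * (1 - 2 * p * (8 / 3 - pi ^+ 2 / 9) + 64 * (2 * p) ^+ 2)%:E
  + (c p / 2)%:E * (1 + 4 * p * (5 / 6 - ln 2 / 3) + 128 * (4 * p) ^+ 2)%:E)%E).
  by apply: leeD; apply: lee_wpmul2l; rewrite ?lee_fin.
rewrite -!EFinM -EFinD lee_fin.
have -> : ln 4 = 2 * ln 2 :> R.
  have -> : (4 : R) = 2 ^+ 2 by ring.
  by rewrite lnXn// mulr_natl.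
by rewrite le_eqVlt; apply/orP; left; apply/eqP; field.
Qed.

Lemma gap3_le_range3 a b d : gap3 a b d <= range3 a b d.
Proof. by rewrite /gap3 (le_trans _ (range3_ge a b d))// ge_min lexx. Qed.

(** Here D^p <= 1, and with g the new gap, g <= r and 2p <= 1/2 give (r/g)^(2p) <= (r/g)^(1/2). The
    inverse square root of the smallest gap is at most the sum over the three gaps, each of mean at
    most 8: hence 24. *)
Lemma lyap_step_gap p : 0 < p <= 4^-1 -> (lyap_step p gap3 <= (24 * c p)%:E)%E.
Proof.
move=> /andP[p0 p4]; have r0 := range3_gt0 x2 x01.
have [e1 e2 e3] := N_eq0.
have [i1 i2 i3] := uniform3_isqrt_gap_le x2 x01.
have nI1 : nonneg_measurable3 (fun u v w : mR => (isqrt ((y0 u v w - y1 u v w) / r))%:E).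
  by apply: nonneg_measurable3_isqrt; rewrite /y0 /y1 /seg; meas.
have nI2 : nonneg_measurable3 (fun u v w : mR => (isqrt ((y1 u v w - y2 u v w) / r))%:E).
  by apply: nonneg_measurable3_isqrt; rewrite /y1 /y2 /seg; meas.
have nI3 : nonneg_measurable3 (fun u v w : mR => (isqrt ((y2 u v w - y0 u v w) / r))%:E).
  by apply: nonneg_measurable3_isqrt; rewrite /y2 /y0 /seg; meas.
have c0 : 0 <= c p by exact: expR_ge0.
have nFp : nonneg_measurable3 (fun u v w : mR =>
    lyap p gap3 (A' u v w) (y0 u v w) (y1 u v w) (y2 u v w)).
  by apply: nF; rewrite /gap3 /y0 /y1 /y2 /seg; meas.
have := uniform3_affine_le6 nFp nI1 nI2 nI3 nN01 nN12 nN20 c0 c0 c0.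
rewrite e1 e2 e3 !adde0 => h.
apply: le_trans (h _) _; last first.
  apply: (@le_trans _ _ ((c p)%:E * 8%:E + (c p)%:E * 8%:E + (c p)%:E * 8%:E)%E).
    have c0E : (0 <= (c p)%:E)%E by rewrite lee_fin.
    exact: (leeD (leeD (lee_wpmul2l c0E i1) (lee_wpmul2l c0E i2)) (lee_wpmul2l c0E i3)).
  by rewrite -!EFinM -!EFinD lee_fin; lra.
move=> u v w u01 v01 w01; rewrite /lyap penalty_step// -!EFinM -!EFinD.
apply: finite_or_infty => n1 n2 n3.
have D0 := area_ratio_gt0 u01 v01 w01; have D1 := area_ratio_le1 u01 v01 w01.
set a := y0 u v w in n1 n3 *; set b := y1 u v w in n1 n2 *; set d := y2 u v w in n2 n3 *.
have rr : range3 a b d <= r.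
  apply: range3_seg_le.
  - by move: u01 => /andP[? ?]; rewrite !ltW.
  - by move: v01 => /andP[? ?]; rewrite !ltW.
  - by move: w01 => /andP[? ?]; rewrite !ltW.
have g0 : 0 < gap3 a b d by rewrite /gap3 !lt_min !normr_gt0 n1 n2 n3.
have gr : gap3 a b d <= r := le_trans (gap3_le_range3 a b d) rr.
set D := area_ratio u v w in D0 D1 *.
have lnD : ln D <= 0 by rewrite ln_le0.
have lng : ln (gap3 a b d) <= ln r by rewrite ler_ln ?posrE.
rewrite /A' -/D lnM ?posrE//.
have h1 : expR (p * (ln A + ln D - 2 * ln (gap3 a b d))) <=
    c p * expR ((ln r - ln (gap3 a b d)) / 2).
  rewrite /c -expRD ler_expR.
  have h2 : p * ln D <= 0 by rewrite pmulr_rle0.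
  have h3 : 2 * p * (ln r - ln (gap3 a b d)) <= 2^-1 * (ln r - ln (gap3 a b d)).
    by apply: ler_wpM2r; rewrite ?subr_ge0//; lra.
  lra.
apply: (le_trans h1); rewrite -!mulrDr; apply: ler_wpM2l => //.
have E z : z != 0 -> isqrt (z / r) = expR ((ln r - ln `|z|) / 2).
  move=> z0; rewrite /isqrt normrM normfV (gtr0_norm r0) ln_div ?posrE ?normr_gt0//.
  by congr expR; ring.
rewrite !E// /gap3; set X := `|a - b|; set Y := `|b - d|; set Z := `|d - a|.
have := expR_ge0 ((ln r - ln X) / 2); have := expR_ge0 ((ln r - ln Y) / 2).
have := expR_ge0 ((ln r - ln Z) / 2).
by case: (leP Y Z) => _; [case: (leP X Y)|case: (leP X Z)] => _ *; lra.
Qed.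

End Step.

Lemma lyap_rangeE p A x0 x1 x2 f : 0 < A -> x0 != x1 -> x1 != x2 -> x2 != x0 ->
  lyap p f A x0 x1 x2 = (expR (p * (ln A - 2 * ln (f x0 x1 x2))))%:E.
Proof.
move=> A0 x01 x12 x20; rewrite /lyap; have [h|[-> _ _ _ _]] := penaltyP A x0 x1 x2; last by rewrite adde0.
move: h; rewrite /penalty /infty_at0 max_r ?ltW// gt_eqF// !subr_eq0.
by rewrite (negbTE x01) (negbTE x12) (negbTE x20) !adde0.
Qed.

(** On a degenerate state the right side is +oo because rho > 0, so the bound holds at every state
    and can be integrated along the chain. *)
Lemma lyap_step_range_le p A x0 x1 x2 (rho : R) : 0 <= p <= 16^-1 -> 0 < rho ->
  1 - p * (1 + ln 4 / 3 - pi ^+ 2 / 9) + 1152 * p ^+ 2 <= rho ->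
  (lyap_step A x0 x1 x2 p (@range3 R) <= rho%:E * lyap p (@range3 R) A x0 x1 x2)%E.
Proof.
move=> p01 rho0 prho.
have [h|[h A0 x01 x12 x20]] := penaltyP A x0 x1 x2.
  by rewrite /lyap h addey// gt0_muley ?lte_fin// leey.
rewrite (lyap_rangeE _ _ A0)//; apply: le_trans (lyap_step_range x01 x12 A0 x20 p01) _.
by rewrite -EFinM lee_fin; apply: ler_wpM2r => //; exact: expR_ge0.
Qed.

Lemma lyap_step_gap_le p A x0 x1 x2 : 0 < p <= 4^-1 ->
  (lyap_step A x0 x1 x2 p gap3 <= 24%:E * lyap p (@range3 R) A x0 x1 x2)%E.
Proof.
move=> p01; have [h|[h A0 x01 x12 x20]] := penaltyP A x0 x1 x2.
  by rewrite /lyap h addey// gt0_muley ?lte_fin// leey.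
by rewrite (lyap_rangeE _ _ A0)// -EFinM; exact: lyap_step_gap.
Qed.

End Lyapunov.

(** * Independence *)

Section Independence.
Context d (Omega : measurableType d) (R : realType) (P : probability Omega R).
Local Notation mR := (measurableTypeR R).
Local Notation unif := (uniform_prob (@ltr01 R)).
Variables (I : choiceType) (U : I -> {RV P >-> R}).
Hypothesis U_uniform : forall k, uniform01 (U k).

Definition mfun_of d' (T : measurableType d') (X : Omega -> T)
    (mX : measurable_fun setT X) : {mfun Omega >-> T} :=
  HB.pack X (isMeasurableFun.Build _ _ _ _ X mX).

(** One event on [X] is tested against every finite subfamily indexed in [S]. For constant [X] this
    follows from mutual independence, and [indep_family_pair] lets [X] absorb one variable at a
    time. *)
Definition indep_family d' (T : measurableType d') (X : Omega -> T) (S : set I) : Prop :=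
  forall (J : {fset I}) (B : I -> set R) (A : set T), [set` J] `<=` S -> measurable A ->
    (forall i, measurable (B i)) ->
    P (X @^-1` A `&` \bigcap_(i in [set` J]) (U i @^-1` B i)) =
    (P (X @^-1` A) * \prod_(i <- J) P (U i @^-1` B i))%E.

Lemma indep_family_sub d' (T : measurableType d') (X : Omega -> T) (S S' : set I) :
  S' `<=` S -> indep_family X S -> indep_family X S'.
Proof. by move=> SS iX J B A JS; apply: iX; exact: subset_trans JS SS. Qed.

Lemma indep_family_comp d' (T : measurableType d') d'' (T' : measurableType d'')
    (X : Omega -> T) (g : T -> T') (S : set I) : measurable_fun setT g ->
  indep_family X S -> indep_family (g \o X) S.
Proof.
move=> mg iX J B A JS mA mB; rewrite comp_preimage iX//.
by rewrite -[X in measurable X]setTI; exact: mg.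
Qed.

Lemma indep_family_cst d' (T : measurableType d') (x : T) : mutually_independent U ->
  indep_family (fun _ : Omega => x) setT.
Proof.
move=> iU J B A _ mA mB; rewrite -iU//.
have [xA|xA] := pselect (A x).
  have -> : (fun _ : Omega => x) @^-1` A = setT by apply/seteqP; split.
  by rewrite setTI probability_setT mul1e.
have -> : (fun _ : Omega => x) @^-1` A = set0 by apply/seteqP; split.
by rewrite set0I measure0 mul0e.
Qed.

Section Pair.
Context d' (T : measurableType d') (X : Omega -> T) (mX : measurable_fun setT X).
Variables (S : set I) (k : I).
Hypotheses (iX : indep_family X S) (Sk : S k).

(* The library gives [R] and [measurableTypeR R] convertible sigma-algebras under
   different displays; product measures and [uniform_prob] need the latter. *)
Let measurable_unifRV : measurable_fun setT (U k : Omega -> mR).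
Proof. by move=> mT Y mY; exact: (@measurable_funPT _ _ _ _ (U k) mT Y mY). Qed.

Let V : {mfun Omega >-> mR} := mfun_of measurable_unifRV.

Let Z (w : Omega) : T * mR := (X w, U k w).

Lemma measurable_pair_RV : measurable_fun setT Z.
Proof. exact: (measurable_fun_pair mX measurable_unifRV). Qed.

Let measurable_preimageU i B : measurable B -> measurable (U i @^-1` B).
Proof. by move=> mB; rewrite -[X in measurable X]setTI; exact: measurable_funP. Qed.

Let indep1 A B : measurable A -> measurable B ->
  P (X @^-1` A `&` U k @^-1` B) = (P (X @^-1` A) * P (U k @^-1` B))%E.
Proof.
move=> mA mB.
have := iX (J := [fset k]%fset) (B := fun _ => B) (A := A).
rewrite big_seq_fset1 set_fset1 bigcap_set1; apply => //.
by move=> i /= ->.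
Qed.

(** A product measure is determined by its values on rectangles, where independence gives the
    factorisation. *)
Lemma joint_distribution C : measurable C ->
  (distribution P (mfun_of mX) \x distribution P V)%E C = P (Z @^-1` C).
Proof.
move=> mC; rewrite -[RHS]/(distribution P (mfun_of measurable_pair_RV) C).
apply: product_measure_unique => // A B mA mB; rewrite -[RHS]indep1//; congr (P _).
Qed.

(** If P(E) > 0, the conditional law of [Z] given E has product values on rectangles, so it is the
    product law, which is also the unconditional one. If P(E) = 0 both sides vanish. *)
Lemma indep_family_pair : indep_family Z (S `\ k).
Proof.
move=> J B C JS mC mB.
have kJ : k \notin J by apply/negP => kJ; case: (JS k kJ) => _; exact.
set E := \bigcap_(i in [set` J]) (U i @^-1` B i).
have mE : measurable E.
  apply: fin_bigcap_measurable; first exact: finite_fset.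
  by move=> i _; exact: measurable_preimageU.
have PE : P E = (\prod_(i <- J) P (U i @^-1` B i))%E.
  have := iX (J := J) (B := B) (A := setT).
  rewrite preimage_setT setTI probability_setT mul1e; apply => //.
  by apply: subset_trans JS _; exact: subDsetl.
rewrite -PE.
have rect A B0 : measurable A -> measurable B0 ->
    P (X @^-1` A `&` U k @^-1` B0 `&` E) = (P (X @^-1` A) * P (U k @^-1` B0) * P E)%E.
  move=> mA mB0.
  (* Overriding [B] at the fresh index k makes the event on [U k] part of a single family indexed by
     J and k. *)
  pose B' i := if i == k then B0 else B i.
  have := iX (J := (k |` J)%fset) (B := B') (A := A).
  have Bk : B' k = B0 by rewrite /B' eqxx.
  have BJ i : i \in J -> B' i = B i.
    by move=> iJ; rewrite /B' ifF//; apply: contraNF kJ => /eqP <-.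
  rewrite big_fsetU1//= Bk (eq_big_seq (fun i => P (U i @^-1` B i))); last first.
    by move=> i iJ; rewrite BJ.
  rewrite -PE muleA => <-.
  - rewrite -setIA; congr (P (_ `&` _)).
    apply/seteqP; split => w /=.
      move=> [wk wE] i /=; rewrite !inE => /orP[/eqP ->|iJ]; first by rewrite Bk.
      by rewrite BJ//; exact: wE.
    move=> h; split; first by rewrite -Bk; apply: h; rewrite /= !inE eqxx.
    by move=> i /= iJ; rewrite -BJ//; apply: h; rewrite /= !inE iJ orbT.
  - by move=> i; rewrite /= !inE => /orP[/eqP ->//|/JS[]].
  - exact: mA.
  - by move=> i; rewrite /B'; case: ifP.
have mZ A : measurable A -> measurable (Z @^-1` A).
  by move=> mA; rewrite -[X in measurable X]setTI; exact: measurable_pair_RV.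
have [PE0|PE0] := eqVneq (P E) 0%E.
  rewrite PE0 mule0; apply/eqP; rewrite eq_le measure_ge0 andbT -PE0.
  by apply: le_measure; rewrite ?inE; [exact: measurableI (mZ _ mC) mE|exact: mE|exact: subIsetr].
have PEfin : P E \is a fin_num by exact: fin_num_measure.
have q0 : 0 <= (fine (P E))^-1 by rewrite invr_ge0 fine_ge0.
have qE : ((fine (P E))^-1%:E * P E = 1)%E.
  by rewrite -[X in (_ * X)%E](fineK PEfin) -EFinM mulVf// fine_eq0.
(* [m'] is P restricted to E, pushed forward by [Z] and divided by P(E). *)
pose PEm : {measure set Omega -> \bar R} := mrestr P mE.
pose PEZ : {measure set (T * mR) -> \bar R} :=
  measure_function_pushforward__canonical__measure_function_Measure PEm measurable_pair_RV.
pose m' : {measure set (T * mR) -> \bar R} := mscale (NngNum q0) PEZ.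
have m'E A : m' A = ((fine (P E))^-1%:E * P (Z @^-1` A `&` E))%E by [].
have : (distribution P (mfun_of mX) \x distribution P V)%E C = m' C.
  apply: product_measure_unique => // A B0 mA mB0.
  have eZ : Z @^-1` (A `*` B0) = X @^-1` A `&` U k @^-1` B0 by [].
  rewrite m'E eZ rect//.
  by rewrite muleCA qE mule1.
rewrite joint_distribution// m'E => ->.
by rewrite [RHS]muleAC qE mul1e.
Qed.

(** Freezes [X] and averages over [U k] alone: the Markov property for one variable. *)
Lemma integral_pair (F : T * mR -> \bar R) : measurable_fun setT F -> (forall z, 0 <= F z)%E ->
  (\int[P]_w F (X w, U k w) = \int[P]_w \int[unif]_u F (X w, u))%E.
Proof.
move=> mF F0.
rewrite -[LHS](ge0_integral_distribution (mfun_of measurable_pair_RV) mF F0).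
transitivity (\int[(distribution P (mfun_of mX) \x distribution P V)%E]_z F z)%E.
  by apply: eq_measure_integral => A mA _; apply/esym; exact: joint_distribution.
rewrite fubini_tonelli1//.
transitivity (\int[distribution P (mfun_of mX)]_x \int[unif]_u F (x, u))%E.
  apply: eq_integral => x _; apply: eq_measure_integral => A mA _; exact: U_uniform.
rewrite ge0_integral_distribution//.
  apply: (measurable_unif (f := fun (x : T) u => F (x, u))) => //.
  by rewrite (_ : (fun p => _) = F)//; apply/funext => -[].
by move=> x; exact: integral_ge0.
Qed.

End Pair.
End Independence.

(** * The chain of flat triangles *)

Section FlatStep.
Variable R : realType.
Local Notation mR := (measurableTypeR R).
Local Notation state := (mR * mR * mR * mR)%type.

(* A state (A, x0, x1, x2) records an area, relative to that of [T0], and the values of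
   an affine functional at the three vertices. *)
Definition flat_step (q : state) (u v w : mR) : state :=
  (q.1.1.1 * area_ratio u v w, seg q.1.2 q.2 u, seg q.2 q.1.1.2 v, seg q.1.1.2 q.1.2 w).

Fixpoint flat_chain (u : nat -> 'I_3 -> R) (n : nat) : state :=
  if n is m.+1
  then flat_step (flat_chain u m) (u m (inord 0)) (u m (inord 1)) (u m (inord 2))
  else (1, 0, 1, 2).

Definition lyap_state p (f : R -> R -> R -> R) (q : state) : \bar R :=
  lyap p f q.1.1.1 q.1.1.2 q.1.2 q.2.

Lemma measurable_flat_step :
  measurable_fun setT (fun z : state * mR * mR * mR => flat_step z.1.1.1 z.1.1.2 z.1.2 z.2).
Proof. by rewrite /flat_step /area_ratio /seg; meas. Qed.

Lemma measurable_lyap_range p : measurable_fun setT (lyap_state p (@range3 R)).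
Proof. by apply: measurable_lyap; meas. Qed.

Lemma measurable_lyap_gap p : measurable_fun setT (lyap_state p (@gap3 R)).
Proof. by apply: measurable_lyap; rewrite /gap3; meas. Qed.

End FlatStep.

(** The sum of the f_n has integral at most K/(1 - q), so it is almost everywhere finite; its tails
    tend to 0, and each tail bounds its first term. *)
Lemma ae_eventually_lt1 d (T : measurableType d) (R : realType)
    (mu : {measure set T -> \bar R}) (f : nat -> T -> \bar R) (K q : R) :
  (forall n, measurable_fun setT (f n)) -> (forall n w, (0 <= f n w)%E) ->
  0 <= K -> 0 < q < 1 -> (forall n, (\int[mu]_w f n w <= (K * q ^+ n)%:E)%E) ->
  {ae mu, forall w, \forall n \near \oo, (f n w < 1)%E}.
Proof.
move=> mf f0 K0 /andP[q0 q1] fK.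
pose S w := (\sum_(0 <= n <oo) f n w)%E.
have mS : measurable_fun setT S by exact: ge0_emeasurable_sum.
have S0 w : (0 <= S w)%E by exact: nneseries_ge0.
have Sfin : (\int[mu]_w S w < +oo)%E.
  rewrite integral_nneseries//; apply: (@le_lt_trans _ _ (K / (1 - q))%:E); last exact: ltry.
  apply: lime_le; first by apply: is_cvg_nneseries => n _ _; exact: integral_ge0.
  apply: nearW => n; apply: (@le_trans _ _ (\sum_(0 <= i < n) (K * q ^+ i)%:E)%E).
    exact: lee_sum.
  by rewrite sumEFin lee_fin; apply: (geometric_le_lim n K0 q0); rewrite gtr0_norm.
have iS : mu.-integrable setT S.
  apply/integrableP; split=> //.
  by under eq_integral do rewrite gee0_abs//.
have := integrable_ae measurableT iS.
apply: filterS => w /(_ I) Sw.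
have : (S w < +oo)%E by rewrite ltey_eq Sw.
move=> /nneseries_tail_cvg /(_ (fun n _ => f0 n w)) tail.
have : \forall n \near \oo, (\sum_(n <= k <oo) f k w < 1)%E.
  have : nbhs (0%E : \bar R) [set x | (x < 1)%E].
    apply: open_nbhs_nbhs; split; first exact: open_ereal_lt_ereal.
    by rewrite /= lte01.
  exact: tail.
apply: filterS => n; apply: le_lt_trans.
apply: (le_trans _ (@nneseries_lim_ge _ (fun k => f k w) xpredT n n.+1 _)) => //.
by rewrite big_nat1.
Qed.

(** * Markov property of the flat chain, and its almost sure decay *)

Section Chain.
Context d (Omega : measurableType d) (R : realType) (P : probability Omega R).
Local Notation mR := (measurableTypeR R).
Local Notation state := (mR * mR * mR * mR)%type.
Variable U : nat * 'I_3 -> {RV P >-> R}.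
Hypotheses (U_uniform : forall k, uniform01 (U k)) (U_independent : mutually_independent U).

Let chain n (w : Omega) : state := flat_chain (fun m i => U (m, i) w) n.
(** Indices of the uniforms not yet used when [chain n] is formed. *)
Let later n : set (nat * 'I_3) := [set k | (n <= k.1)%N].

Let later_in n i : later n (n, i). Proof. by rewrite /later/=. Qed.

Let ne01 (n : nat) : (n, inord 0 : 'I_3) <> (n, inord 1).
Proof. by move=> [] /(congr1 val); rewrite /= !inordK. Qed.
Let ne02 (n : nat) : (n, inord 0 : 'I_3) <> (n, inord 2).
Proof. by move=> [] /(congr1 val); rewrite /= !inordK. Qed.
Let ne12 (n : nat) : (n, inord 1 : 'I_3) <> (n, inord 2).
Proof. by move=> [] /(congr1 val); rewrite /= !inordK. Qed.

(** The three uniforms of step n are adjoined one at a time, so that [indep_family_pair] and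
    [integral_pair] apply at each addition. *)
Let chain1 n w : state * mR := (chain n w, U (n, inord 0) w).
Let chain2 n w : state * mR * mR := (chain1 n w, U (n, inord 1) w).
Let chain3 n w : state * mR * mR * mR := (chain2 n w, U (n, inord 2) w).

Let chainS n : chain n.+1 =
  (fun z : state * mR * mR * mR => flat_step z.1.1.1 z.1.1.2 z.1.2 z.2) \o chain3 n.
Proof. by []. Qed.

Let measurable_chain n : measurable_fun setT (chain n).
Proof.
elim: n => [|n IH]; first exact: measurable_cst.
rewrite chainS; apply: measurableT_comp; first exact: measurable_flat_step.
apply: measurable_pair_RV; apply: measurable_pair_RV; exact: measurable_pair_RV.
Qed.

Let measurable_chain1 n : measurable_fun setT (chain1 n).
Proof. exact: measurable_pair_RV. Qed.

Let measurable_chain2 n : measurable_fun setT (chain2 n).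
Proof. exact: (measurable_pair_RV _ (measurable_chain1 n)). Qed.

Let indep_chain1 n : indep_family U (chain n) (later n) ->
  indep_family U (chain1 n) (later n `\ (n, inord 0)).
Proof. by move=> h; apply: indep_family_pair. Qed.

Let indep_chain2 n : indep_family U (chain n) (later n) ->
  indep_family U (chain2 n) (later n `\ (n, inord 0) `\ (n, inord 1)).
Proof.
move=> h; apply: (indep_family_pair (measurable_chain1 n) (indep_chain1 h)).
by split; [exact: later_in|move=> /= /esym; exact: ne01].
Qed.

Let indep_chain n : indep_family U (chain n) (later n).
Proof.
elim: n => [|n IH].
  apply: (@indep_family_sub _ _ _ _ _ _ _ _ _ setT) => //; exact: indep_family_cst.
rewrite chainS; apply: indep_family_comp; first exact: measurable_flat_step.
apply: (@indep_family_sub _ _ _ _ _ _ _ _ _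
   (later n `\ (n, inord 0) `\ (n, inord 1) `\ (n, inord 2))).
  move=> [m i]; rewrite /later/= => nm.
  by split; [split; [split; [exact: ltnW|]|]|] => -[mn]; rewrite mn ltnn in nm.
apply: (indep_family_pair (measurable_chain2 n) (indep_chain2 IH)).
split; first by split; [exact: later_in|move=> /= /esym; exact: ne02].
by move=> /= /esym; exact: ne12.
Qed.

Let measurable_step (L : state -> \bar R) : measurable_fun setT L ->
  measurable_fun setT (fun z : state * mR * mR * mR => L (flat_step z.1.1.1 z.1.1.2 z.1.2 z.2)).
Proof. by move=> mL; apply: (measurableT_comp mL); exact: measurable_flat_step. Qed.

Let measurable_uniform3_step (L : state -> \bar R) : measurable_fun setT L ->
  (forall q, (0 <= L q)%E) ->
  [/\ measurable_fun setT (fun z : state * mR * mR =>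
        \int[uniform_prob (@ltr01 R)]_s L (flat_step z.1.1 z.1.2 z.2 s))%E,
      measurable_fun setT (fun z : state * mR =>
        \int[uniform_prob (@ltr01 R)]_v \int[uniform_prob (@ltr01 R)]_s L (flat_step z.1 z.2 v s))%E &
      measurable_fun setT (fun q => uniform3 (fun u v s => L (flat_step q u v s)))].
Proof.
move=> mL L0; have m3 := measurable_step mL.
have m2 : measurable_fun setT (fun z : state * mR * mR =>
    \int[uniform_prob (@ltr01 R)]_s L (flat_step z.1.1 z.1.2 z.2 s))%E.
  exact: (measurable_unif (f := fun (z : state * mR * mR) s => L (flat_step z.1.1 z.1.2 z.2 s)) m3).
have m1 : measurable_fun setT (fun z : state * mR =>
    \int[uniform_prob (@ltr01 R)]_v \int[uniform_prob (@ltr01 R)]_s L (flat_step z.1 z.2 v s))%E.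
  apply: (measurable_unif (f := fun (z : state * mR) v =>
    \int[uniform_prob (@ltr01 R)]_s L (flat_step z.1 z.2 v s))%E m2).
  by move=> *; exact: integral_ge0.
split=> //.
apply: (measurable_unif (f := fun (q : state) u =>
  \int[uniform_prob (@ltr01 R)]_v \int[uniform_prob (@ltr01 R)]_s L (flat_step q u v s))%E m1).
by move=> *; apply: integral_ge0 => ? _; exact: integral_ge0.
Qed.

(** The uniforms are averaged out in the reverse order of their adjunction, the last one innermost,
    which is the order of [uniform3]. *)
Let integral_chainS (L : state -> \bar R) n : measurable_fun setT L ->
  (forall q, (0 <= L q)%E) ->
  (\int[P]_w L (chain n.+1 w) =
   \int[P]_w uniform3 (fun u v s => L (flat_step (chain n w) u v s)))%E.
Proof.
move=> mL L0; have [m2 m1 m0] := measurable_uniform3_step mL L0.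
have i0 := @indep_chain n.
transitivity (\int[P]_w \int[uniform_prob (@ltr01 R)]_s
    L (flat_step (chain n w) (U (n, inord 0) w) (U (n, inord 1) w) s))%E.
  apply: (integral_pair U_uniform (measurable_chain2 n) (indep_chain2 i0) _
    (measurable_step mL)); last by move=> z; exact: L0.
  split; first by split; [exact: later_in|move=> /= /esym; exact: ne02].
  by move=> /= /esym; exact: ne12.
transitivity (\int[P]_w \int[uniform_prob (@ltr01 R)]_v \int[uniform_prob (@ltr01 R)]_s
    L (flat_step (chain n w) (U (n, inord 0) w) v s))%E.
  apply: (integral_pair U_uniform (measurable_chain1 n) (indep_chain1 i0) _ m2).
    by split; [exact: later_in|move=> /= /esym; exact: ne01].
  by move=> *; exact: integral_ge0.
apply: (integral_pair U_uniform (measurable_chain n) i0 _ m1); first exact: later_in.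
by move=> *; apply: integral_ge0 => ? _; exact: integral_ge0.
Qed.

Let integral_range_le p rho n : 0 <= p <= 16^-1 -> 0 < rho ->
  1 - p * (1 + ln 4 / 3 - pi ^+ 2 / 9) + 1152 * p ^+ 2 <= rho ->
  (\int[P]_w lyap_state p (@range3 R) (chain n w) <=
   (rho ^+ n)%:E * lyap p (@range3 R) 1 0 1 2)%E.
Proof.
move=> p01 rho0 prho; have mL := measurable_lyap_range p.
have L0 q : (0 <= lyap_state p (@range3 R) q)%E by exact: lyap_ge0.
have [_ _ mS] := measurable_uniform3_step mL L0.
elim: n => [|n IH].
  rewrite expr0 mul1e (_ : (fun w => _) = cst (lyap p (@range3 R) 1 0 1 2))//.
  rewrite integral_cst//= probability_setT mule1//.
rewrite integral_chainS//.
apply: (@le_trans _ _ (\int[P]_w (rho%:E * lyap_state p (@range3 R) (chain n w)))%E).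
  apply: ge0_le_integral => //.
  - move=> w _; apply: integral_ge0 => u _; apply: integral_ge0 => v _; exact: integral_ge0.
  - exact: (measurableT_comp mS (measurable_chain n)).
  - apply: emeasurable_funM; first exact: measurable_cst.
    exact: (measurableT_comp mL (measurable_chain n)).
  - move=> w _; exact: (lyap_step_range_le _ _ _ _ p01 rho0 prho).
rewrite ge0_integralZl_EFin//; last 2 first.
- exact: (measurableT_comp mL (measurable_chain n)).
- exact: ltW.
rewrite exprS EFinM -muleA; apply: lee_wpmul2l => //.
by rewrite lee_fin ltW.
Qed.

Let integral_gap_le p n : 0 < p <= 4^-1 ->
  (\int[P]_w lyap_state p (@gap3 R) (chain n.+1 w) <=
   24%:E * \int[P]_w lyap_state p (@range3 R) (chain n w))%E.
Proof.
move=> p01; have mL := measurable_lyap_range p; have mG := measurable_lyap_gap p.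
have L0 q : (0 <= lyap_state p (@range3 R) q)%E by exact: lyap_ge0.
have G0 q : (0 <= lyap_state p (@gap3 R) q)%E by exact: lyap_ge0.
have [_ _ mS] := measurable_uniform3_step mG G0.
rewrite integral_chainS// -ge0_integralZl_EFin//; last first.
  exact: (measurableT_comp mL (measurable_chain n)).
apply: ge0_le_integral => //.
- move=> w _; apply: integral_ge0 => u _; apply: integral_ge0 => v _; exact: integral_ge0.
- exact: (measurableT_comp mS (measurable_chain n)).
- apply: emeasurable_funM; first exact: measurable_cst.
  exact: (measurableT_comp mL (measurable_chain n)).
- move=> w _; exact: (lyap_step_gap_le _ _ _ _ p01).
Qed.

(** As 4608 = 4 * 1152, the quadratic error 1152 p^2 is at most p delta/4, a quarter of the margin;
    then 1 + x <= e^x. *)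
Let expR_rate_ge (p delta : R) : 0 <= p -> p <= delta / 4608 ->
  1 - p * (1 + ln 4 / 3 - pi ^+ 2 / 9) + 1152 * p ^+ 2 <=
  expR (- (p * (1 + ln 4 / 3 - pi ^+ 2 / 9 - delta / 4))).
Proof.
move=> p0 pd; set c0 := _ - _ / 9; apply: le_trans (expR_ge1Dx _).
have : p * p <= p * (delta / 4608) by apply: ler_wpM2l.
by rewrite expr2; lra.
Qed.

(** The mean of e^(p c (n+1)) (A / g^2)^p at time n+1 is at most a constant times (e^(p c) rho)^n =
    e^(-3 p delta n / 4). A value below 1 forces the penalty to be 0, and p > 0 can then be divided
    out of the logarithm. *)
Lemma chain_decay c : c < 1 + ln 4 / 3 - pi ^+ 2 / 9 ->
  {ae P, forall w, \forall n \near \oo,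
    let: (A, x0, x1, x2) := flat_chain (fun m i => U (m, i) w) n in
    [/\ 0 < A, x0 != x1, x1 != x2, x2 != x0 &
      A / gap3 x0 x1 x2 ^+ 2 <= expR (- (c * n%:R))]}.
Proof.
set c0 := (X in c < X); rewrite -subr_gt0; set delta := c0 - c => d0.
pose p := Num.min (16^-1) (delta / 4608).
have p0 : 0 < p by rewrite /p lt_min; apply/andP; split; lra.
have p16 : p <= 16^-1 by rewrite /p ge_min lexx.
have pd : p <= delta / 4608 by rewrite /p ge_min lexx orbT.
clearbody p.
pose rho := expR (- (p * (c0 - delta / 4))).
have rho0 : 0 < rho by exact: expR_gt0.
have prho := expR_rate_ge (ltW p0) pd; rewrite -/c0 -/rho in prho.
have p01 : 0 <= p <= 16^-1 by rewrite ltW.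
have p02 : 0 < p <= 4^-1 by rewrite p0 (le_trans p16)//; lra.
pose k n : R := expR (p * c * n%:R).
have k0 n : 0 <= k n by exact: expR_ge0.
pose f n w := ((k n.+1)%:E * lyap_state p (@gap3 R) (chain n.+1 w))%E.
have mG := measurable_lyap_gap p.
have mf n : measurable_fun setT (f n).
  apply: emeasurable_funM; first exact: measurable_cst.
  exact: (measurableT_comp mG (measurable_chain n.+1)).
have G0 q : (0 <= lyap_state p (@gap3 R) q)%E by exact: lyap_ge0.
have f0 n w : (0 <= f n w)%E by rewrite mule_ge0// lee_fin.
have [a a0 aE] : exists2 a : R, 0 <= a & lyap p (@range3 R) 1 0 1 2 = a%:E.
  exists (expR (p * (ln 1 - 2 * ln (range3 0 1 2)))); first exact: expR_ge0.
  by apply: lyap_rangeE; rewrite ?oner_neq0 ?pnatr_eq0//; lra.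
have fle n : (\int[P]_w f n w <= (k 1%N * 24 * a * (k 1%N * rho) ^+ n)%:E)%E.
  rewrite ge0_integralZl_EFin//; last exact: (measurableT_comp mG (measurable_chain n.+1)).
  apply: (@le_trans _ _ ((k n.+1)%:E * (24%:E * ((rho ^+ n)%:E * a%:E)))%E).
    apply: lee_wpmul2l; first by rewrite lee_fin.
    apply: (le_trans (integral_gap_le n p02)); apply: lee_wpmul2l; first by rewrite lee_fin.
    by rewrite -aE; exact: integral_range_le.
  have -> : k n.+1 = k 1%N * k 1%N ^+ n.
    by rewrite -exprS /k -expRM_natl; congr expR; ring.
  by rewrite -!EFinM lee_fin le_eqVlt exprMn; apply/orP; left; apply/eqP; ring.
have K0 : 0 <= k 1%N * 24 * a by rewrite !mulr_ge0.
have q01 : 0 < k 1%N * rho < 1.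
  rewrite mulr_gt0 ?expR_gt0// /k /rho -expRD expR_lt1.
  have -> : p * c * 1 + - (p * (c0 - delta / 4)) = - (p * (delta * 3 / 4)).
    by rewrite /delta; field.
  by rewrite oppr_lt0 mulr_gt0//; lra.
apply: filterS (ae_eventually_lt1 mf f0 K0 q01 fle) => w [N _ NH].
(* Index shift: [f n] concerns [chain n.+1], as passing from range to gap takes one step. *)
exists N.+1 => // -[//|n] Nn; have := NH n Nn; rewrite /f /lyap_state /chain; cbv beta.
case: (flat_chain _ n.+1) => [[[A x0] x1] x2] /=; rewrite /lyap.
have k0' : 0 < k n.+1 by exact: expR_gt0.
have [->|[-> A0 x01 x12 x20]] := penaltyP A x0 x1 x2.
  by rewrite addey// gt0_muley ?lte_fin.
rewrite adde0 -EFinM lte_fin => H; split=> //.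
have g0 : 0 < gap3 x0 x1 x2 by rewrite /gap3 !lt_min !normr_gt0 !subr_eq0 x01 x12.
have E : A / gap3 x0 x1 x2 ^+ 2 = expR (ln A - 2 * ln (gap3 x0 x1 x2)).
  rewrite -[X in X / _](lnK A0) -[X in _ / X ^+ 2](lnK g0) expRD expRN.
  by rewrite -expRM_natl.
suff : A / gap3 x0 x1 x2 ^+ 2 <= expR (- (c * n.+1%:R)) by exact.
rewrite E; move: H; rewrite /k -expRD expR_lt1 ler_expR => H.
have : p * (c * n.+1%:R + (ln A - 2 * ln (gap3 x0 x1 x2))) < 0 by apply: le_lt_trans H; lra.
by rewrite pmulr_rlt0// => ?; lra.
Qed.

End Chain.

(** * Triangles in the plane *)

Section Plane.
Variable R : realType.
Implicit Types (u v w : 'rV[R]_2) (T : triangle R).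

Definition cross u v : R := u 0 0 * v 0 1 - u 0 1 * v 0 0.

Lemma dotrv2E u v : dotrv u v = u 0 0 * v 0 0 + u 0 1 * v 0 1.
Proof.
rewrite /dotrv mxE big_ord_recl big_ord1 !mxE.
by rewrite (_ : lift _ _ = 1)//; apply/val_inj.
Qed.

Lemma dotrvD u v w : dotrv (u + v) w = dotrv u w + dotrv v w.
Proof. by rewrite /dotrv mulmxDl mxE. Qed.

Lemma dotrvB u v w : dotrv (u - v) w = dotrv u w - dotrv v w.
Proof. by rewrite /dotrv mulmxBl !mxE. Qed.

Lemma dotrvZ k u w : dotrv (k *: u) w = k * dotrv u w.
Proof. by rewrite /dotrv -scalemxAl mxE. Qed.

Lemma dotrv_ge0 u : 0 <= dotrv u u.
Proof. by rewrite dotrv2E addr_ge0// -expr2 sqr_ge0. Qed.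

Lemma sqr_enorm u : enorm u ^+ 2 = dotrv u u.
Proof. by rewrite sqr_sqrtr// dotrv_ge0. Qed.

Lemma enorm_ge0 u : 0 <= enorm u.
Proof. exact: sqrtr_ge0. Qed.

Lemma enormN u : enorm (- u) = enorm u.
Proof. by rewrite /enorm !dotrv2E !mxE !mulrNN. Qed.

(** Lagrange's identity; it yields Cauchy-Schwarz and expresses heights and sines through the
    area. *)
Lemma dotrv_cross u v : dotrv u v ^+ 2 + cross u v ^+ 2 = dotrv u u * dotrv v v.
Proof. by rewrite !dotrv2E /cross; ring. Qed.

Lemma dotrv_sqr_le u v : dotrv u v ^+ 2 <= dotrv u u * dotrv v v.
Proof. by rewrite -dotrv_cross lerDl sqr_ge0. Qed.

(** Twice the oriented area, that is, base times height up to sign. *)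
Definition signed_area T : R :=
  cross (T (inord 1) - T (inord 0)) (T (inord 2) - T (inord 0)).

Lemma ord3P (i : 'I_3) : [\/ i = inord 0, i = inord 1 | i = inord 2].
Proof.
by case: i => [[|[|[|//]]] i3]; [apply: Or31|apply: Or32|apply: Or33];
  apply/val_inj; rewrite /= inordK.
Qed.

Lemma ordS3 : [/\ ordS (inord 0 : 'I_3) = inord 1, ordS (inord 1 : 'I_3) = inord 2 &
  ordS (inord 2 : 'I_3) = inord 0].
Proof. by split; apply/val_inj; rewrite /= !inordK. Qed.

Lemma ord_pred3 : [/\ ord_pred (inord 0 : 'I_3) = inord 2,
  ord_pred (inord 1 : 'I_3) = inord 0 & ord_pred (inord 2 : 'I_3) = inord 1].
Proof. by split; apply/val_inj; rewrite /= !inordK. Qed.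

Lemma ordSS (i : 'I_3) : ordS (ordS i) = ord_pred i.
Proof.
have [s0 s1 s2] := ordS3; have [p0 p1 p2] := ord_pred3.
by have [->|->|->] := ord3P i; rewrite ?s0 ?s1 ?s2 ?p0 ?p1 ?p2.
Qed.

Lemma ord_pred_pred (i : 'I_3) : ord_pred (ord_pred i) = ordS i.
Proof. by rewrite -[i in RHS]ord_predK -[in RHS](ord_predK (ord_pred i)) ordSS ordSK. Qed.

Lemma cross_vertex T i : cross (T (ordS i) - T i) (T (ord_pred i) - T i) = signed_area T.
Proof.
have [s0 s1 s2] := ordS3; have [p0 p1 p2] := ord_pred3.
by have [->|->|->] := ord3P i; rewrite ?s0 ?s1 ?s2 ?p0 ?p1 ?p2 /signed_area /cross !mxE; ring.
Qed.

(** The ratio depends on the uniforms alone and not on the shape of [T], which makes successive area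
    ratios independent and identically distributed. *)
Lemma signed_area_inscribed T (u : 'I_3 -> R) : signed_area (inscribed T u) =
  signed_area T * area_ratio (u (inord 0)) (u (inord 1)) (u (inord 2)).
Proof.
have [s0 s1 s2] := ordS3; have [p0 p1 p2] := ord_pred3.
rewrite /signed_area /inscribed s0 s1 s2 p0 p1 p2 /area_ratio /cross !mxE; ring.
Qed.

Section Flat.
Variables (T : triangle R) (m : R).
Hypotheses (m0 : 0 < m)
  (sides_ge : forall i j : 'I_3, i != j -> m <= dotrv (T i - T j) (T i - T j)).

Let neqS (i : 'I_3) : ordS i != i.
Proof.
have [s0 s1 s2] := ordS3.
by have [->|->|->] := ord3P i; rewrite ?s0 ?s1 ?s2 -val_eqE/= !inordK.
Qed.

Let neqP (i : 'I_3) : ord_pred i != i.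
Proof.
have [s0 s1 s2] := ord_pred3.
by have [->|->|->] := ord3P i; rewrite ?s0 ?s1 ?s2 -val_eqE/= !inordK.
Qed.

Let neqPS (i : 'I_3) : ord_pred i != ordS i.
Proof.
have [s0 s1 s2] := ordS3; have [p0 p1 p2] := ord_pred3.
by have [->|->|->] := ord3P i; rewrite ?s0 ?s1 ?s2 ?p0 ?p1 ?p2 -val_eqE/= !inordK.
Qed.

(** Base times height is |[signed_area T]|, so the flatness is that number over the squared side.
    The height is computed from the foot by Pythagoras and Lagrange's identity. *)
Lemma flatness_le : flatness T <= `|signed_area T| / m.
Proof.
rewrite /flatness; set i := largest_side T.
set e := T (ord_pred i) - T (ordS i); set b := T i - T (ordS i).
have em : m <= dotrv e e by exact: sides_ge.
have e0 : 0 < dotrv e e by exact: lt_le_trans em.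
have sE : side T i ^+ 2 = dotrv e e by exact: sqr_enorm.
have s0 : 0 < side T i by rewrite lt_neqAle enorm_ge0 andbT eq_sym -sqrf_eq0 sE gt_eqF.
have hE : height T i = `|signed_area T| / side T i.
  apply/eqP; rewrite -(@eqrXn2 _ 2)//; last 2 first.
  - exact: enorm_ge0.
  - by rewrite divr_ge0// ltW.
  rewrite expr_div_n sE real_normK ?num_real// /height sqr_enorm.
  rewrite (_ : T i - _ = b - (dotrv b e / dotrv e e) *: e); last first.
    by rewrite /altitude_foot -/e -/b opprD addrA.
  rewrite -(cross_vertex T i) (_ : cross _ _ = - cross b e); last first.
    by rewrite /cross /b /e !mxE; ring.
  rewrite sqrrN; apply/eqP; rewrite -[LHS](mulfK (lt0r_neq0 e0)).
  congr (_ / _).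
  set k := _ / _; have ke : k * dotrv e e = dotrv b e by rewrite /k divfK ?gt_eqF.
  have -> : dotrv (b - k *: e) (b - k *: e) = dotrv b b - 2 * k * dotrv b e + k * (k * dotrv e e).
    by rewrite !dotrv2E !mxE; ring.
  rewrite ke -[cross b e ^+ 2](addKr (dotrv b e ^+ 2)) dotrv_cross -ke; ring.
rewrite hE -mulrA -invfM -expr2 sE ler_wpM2l// lef_pV2 ?posrE//.
Qed.

Let cosine i := dotrv (T (ordS i) - T i) (T (ord_pred i) - T i) /
  (enorm (T (ordS i) - T i) * enorm (T (ord_pred i) - T i)).

Let adjacent_sides_gt0 i :
  0 < enorm (T (ordS i) - T i) * enorm (T (ord_pred i) - T i).
Proof.
by rewrite mulr_gt0// sqrtr_gt0; apply: lt_le_trans m0 _; apply: sides_ge.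
Qed.

Let sqr_adjacent_sides i :
  (enorm (T (ordS i) - T i) * enorm (T (ord_pred i) - T i)) ^+ 2 =
  dotrv (T (ordS i) - T i) (T (ordS i) - T i) *
  dotrv (T (ord_pred i) - T i) (T (ord_pred i) - T i).
Proof. by rewrite exprMn !sqr_enorm. Qed.

Let sqr_cosine i : cosine i ^+ 2 <= 1.
Proof.
rewrite expr_div_n sqr_adjacent_sides ler_pdivrMr ?mul1r ?dotrv_sqr_le//.
by rewrite -sqr_adjacent_sides exprn_gt0.
Qed.

Let cosine_itv i : -1 <= cosine i <= 1.
Proof. by rewrite -ler_norml -(@expr_le1 _ 2)// real_normK ?num_real. Qed.

Lemma max_angle_itv : max_angle T \in `[0, pi].
Proof.
rewrite in_itv/=; apply/andP; split; first exact: bigmax_ge_id.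
by apply: bigmax_le => [|i _]; [exact: pi_ge0|exact: (acos_lepi (cosine_itv i))].
Qed.

(* The law of cosines gives cosine at most 1/2 opposite to the largest side, so there
   [1 + cos] is at most twice [1 - cos ^ 2], the square of the sine. *)
Lemma cos_max_angle_le : 1 + cos (max_angle T) <= 2 * (signed_area T / m) ^+ 2.
Proof.
set i := largest_side T.
have side_max j : side T j <= side T i.
  by rewrite /i /largest_side; case: arg_maxP => // k _ /(_ j isT).
apply: (@le_trans _ _ (1 + cosine i)).
  have ai : acos (cosine i) \in `[0, pi].
    by rewrite in_itv/= (acos_ge0 (cosine_itv i)) (acos_lepi (cosine_itv i)).
  rewrite lerD2l -[leRHS](acosK (cosine_itv i)) leNgt ltr_cos ?max_angle_itv// -leNgt.
  exact: (le_bigmax _ (angle T)).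
have c2 : 1 - cosine i ^+ 2 <= (signed_area T / m) ^+ 2.
  rewrite -(cross_vertex T i) /cosine; set u := T (ordS i) - T i; set v := T (ord_pred i) - T i.
  have um : m <= dotrv u u by exact: sides_ge.
  have vm : m <= dotrv v v by exact: sides_ge.
  have uv0 : 0 < dotrv u u * dotrv v v by rewrite mulr_gt0// (lt_le_trans m0).
  rewrite !expr_div_n sqr_adjacent_sides -/u -/v.
  have -> : 1 - dotrv u v ^+ 2 / (dotrv u u * dotrv v v) =
      cross u v ^+ 2 / (dotrv u u * dotrv v v).
    by rewrite -[1](divff (lt0r_neq0 uv0)) -mulrBl -dotrv_cross addrAC subrr add0r.
  rewrite ler_wpM2l ?sqr_ge0// lef_pV2 ?posrE ?exprn_gt0//.
  by rewrite expr2 ler_pM// ltW.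
have chalf : cosine i <= 2^-1.
  rewrite /cosine ler_pdivrMr//; set u := T (ordS i) - T i; set v := T (ord_pred i) - T i.
  have [lu lv] : enorm u <= side T i /\ enorm v <= side T i.
    have := side_max (ord_pred i); have := side_max (ordS i).
    rewrite {1 3}/side ordSK ord_predK ord_pred_pred ordSS => lv lu; split=> //.
    by rewrite -enormN opprB.
  have : dotrv u v = (enorm u ^+ 2 + enorm v ^+ 2 - side T i ^+ 2) / 2.
    by rewrite /side !sqr_enorm /u /v !dotrv2E !mxE; field.
  have u0 := enorm_ge0 u; have v0 := enorm_ge0 v.
  move: (enorm u) (enorm v) (side T i) lu lv u0 v0 => x y z xz yz x0 y0 ->.
  have x2 : x ^+ 2 <= z ^+ 2 by rewrite lerXn2r// nnegrE (le_trans x0).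
  have y2 : y ^+ 2 <= z ^+ 2 by rewrite lerXn2r// nnegrE (le_trans y0).
  have [xy|/ltW yx] := leP x y.
    by have := ler_wpM2l x0 xy; rewrite -expr2; lra.
  by have := ler_wpM2r y0 yx; rewrite -expr2; lra.
have := cosine_itv i => /andP[c1 _].
have : 0 <= (1 + cosine i) * (2^-1 - cosine i) by rewrite mulr_ge0//; lra.
by rewrite expr2 in c2 *; lra.
Qed.

End Flat.
End Plane.

(** * Projection of the plane triangles onto the flat chain *)

Section Coordinate.
Variables (R : realType) (T0 : triangle R).

(** The columns b1, b2 of a right inverse of the matrix of edge vectors form the dual basis; b1 + 2
    b2 takes the prescribed values. *)
Lemma nondegenerate_coordinate : nondegenerate T0 -> exists c : 'rV[R]_2,
  dotrv (T0 (inord 1) - T0 (inord 0)) c = 1 /\ dotrv (T0 (inord 2) - T0 (inord 0)) c = 2.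
Proof.
move=> /row_freeP[B]; rewrite mul_col_mx => MB.
have E1 j : ((T0 (inord 1) - T0 (inord 0)) *m B) 0 j = (1%:M : 'M[R]_(1 + 1)) (lshift 1 0) j.
  by rewrite -MB col_mxEu.
have E2 j : ((T0 (inord 2) - T0 (inord 0)) *m B) 0 j = (1%:M : 'M[R]_(1 + 1)) (rshift 1 0) j.
  by rewrite -MB col_mxEd.
have dE (e : 'rV[R]_2) j : dotrv e (col j B)^T = (e *m B) 0 j.
  by rewrite /dotrv trmxK !mxE; apply: eq_bigr => k _; rewrite !mxE.
have dC (e f h : 'rV[R]_2) : dotrv e (f + 2 *: h) = dotrv e f + 2 * dotrv e h.
  by rewrite !dotrv2E !mxE; ring.
exists ((col (lshift 1 0) B)^T + 2 *: (col (rshift 1 0) B)^T).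
rewrite !dC !dE !E1 !E2 !mxE; split.
  by rewrite eqxx mulr0 addr0.
by rewrite eqxx add0r mulr1.
Qed.

Variable c : 'rV[R]_2.
Hypothesis c1 : dotrv (T0 (inord 1) - T0 (inord 0)) c = 1.
Hypothesis c2 : dotrv (T0 (inord 2) - T0 (inord 0)) c = 2.

(** Affine functionals commute with taking points on the sides, and area ratios multiply, so the
    plane sequence projects exactly onto the flat chain driven by the same uniforms. *)
Lemma flat_chainE (u : nat -> 'I_3 -> R) n :
  let T := triangle_seq T0 u n in
  let x i := dotrv (T (inord i) - T0 (inord 0)) c in
  signed_area T = signed_area T0 * (flat_chain u n).1.1.1 /\
  flat_chain u n = ((flat_chain u n).1.1.1, x 0%N, x 1%N, x 2).
Proof.
elim: n => [|n [aE qE]] /=.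
  by rewrite mulr1 c1 c2 subrr /dotrv mul0mx mxE.
have [s0 s1 s2] := ordS3; have [p0 p1 p2] := ord_pred3.
split; first by rewrite signed_area_inscribed aE mulrA.
set A := (flat_chain u n).1.1.1 in qE *; rewrite /flat_step qE /= /inscribed s0 s1 s2 p0 p1 p2.
by rewrite /seg; congr (_, _, _, _); rewrite !dotrvB dotrvD dotrvZ !dotrvB; ring.
Qed.

End Coordinate.

Lemma gap3_le (R : realType) (x : 'I_3 -> R) i j : i != j ->
  gap3 (x (inord 0)) (x (inord 1)) (x (inord 2)) <= `|x i - x j|.
Proof.
set a := x (inord 0); set b := x (inord 1); set e := x (inord 2); set g := gap3 a b e.
have g1 : g <= `|a - b| by rewrite ge_min lexx.
have g2 : g <= `|b - e| by rewrite !ge_min lexx orbT.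
have g3 : g <= `|e - a| by rewrite !ge_min lexx !orbT.
by have [->|->|->] := ord3P i; have [->|->|->] := ord3P j;
  rewrite ?eqxx// => _; rewrite -/a -/b -/e // distrC.
Qed.

(** By Cauchy-Schwarz |x_i - x_j| <= |c| |T_i - T_j|, so every squared side is at least g^2/|c|^2,
    which serves as m in [flatness_le] and [cos_max_angle_le]. *)
Lemma triangle_seq_flat (R : realType) (T0 : triangle R) : nondegenerate T0 ->
  exists2 C, 0 < C & forall u n,
    let: (A, x0, x1, x2) := flat_chain u n in
    0 < A -> x0 != x1 -> x1 != x2 -> x2 != x0 ->
    let T := triangle_seq T0 u n in
    let s := C * (A / gap3 x0 x1 x2 ^+ 2) in
    [/\ flatness T <= s, max_angle T \in `[0, pi] & 1 + cos (max_angle T) <= 2 * s ^+ 2].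
Proof.
move=> /nondegenerate_coordinate[c [c1 c2]].
have K0 : 0 < dotrv c c.
  rewrite lt_neqAle dotrv_ge0 andbT eq_sym; apply/eqP => K0.
  by have := dotrv_sqr_le (T0 (inord 1) - T0 (inord 0)) c; rewrite c1 K0; lra.
(* The summand 1 secures C > 0. *)
exists ((`|signed_area T0| + 1) * dotrv c c) => [|u n].
  by rewrite mulr_gt0// ltr_wpDl.
have [aE qE] := flat_chainE c1 c2 u n; move: aE qE; set A := (flat_chain u n).1.1.1 => aE ->.
move: aE; set T := triangle_seq T0 u n => aE A0 x01 x12 x20.
pose x i := dotrv (T i - T0 (inord 0)) c.
set g := gap3 _ _ _.
have g0 : 0 < g by rewrite /g /gap3 !lt_min !normr_gt0 !subr_eq0 x01 x12.
have m0 : 0 < g ^+ 2 / dotrv c c by rewrite divr_gt0// exprn_gt0.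
have sides i j : i != j -> g ^+ 2 / dotrv c c <= dotrv (T i - T j) (T i - T j).
  move=> ij; rewrite ler_pdivrMr//; apply: le_trans (dotrv_sqr_le _ _).
  have -> : dotrv (T i - T j) c = x i - x j by rewrite /x !dotrvB; ring.
  rewrite -(real_normK (num_real (x i - x j))) lerXn2r ?nnegrE ?(ltW g0)//.
  exact: (gap3_le x ij).
have aA : `|signed_area T| / (g ^+ 2 / dotrv c c) <=
    (`|signed_area T0| + 1) * dotrv c c * (A / g ^+ 2).
  rewrite aE normrM (gtr0_norm A0) invfM invrK.
  have -> : `|signed_area T0| * A * (g ^- 2 * dotrv c c) =
    `|signed_area T0| * (dotrv c c * (A / g ^+ 2)) by ring.
  rewrite -mulrA ler_wpM2r ?mulr_ge0 ?invr_ge0 ?exprn_ge0 ?ltW//.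
  by rewrite ltrDl.
split; [exact: le_trans (flatness_le m0 sides) aA|exact: (max_angle_itv m0 sides)|].
apply: (le_trans (cos_max_angle_le m0 sides)); rewrite ler_wpM2l//.
rewrite -(real_normK (num_real (_ / _))) lerXn2r ?nnegrE//.
  by apply: le_trans aA; rewrite divr_ge0// ltW.
by rewrite normrM normfV (gtr0_norm m0).
Qed.

(** cos is strictly decreasing on [0, pi], so an angle at most pi - e' would keep 1 + cos above the
    positive number 1 + cos(pi - e'). *)
Lemma cvg_pi_of_cos (R : realType) (theta : R ^nat) (r : R ^nat) : r @ \oo --> 0 ->
  (\forall n \near \oo, theta n \in `[0, pi] /\ 1 + cos (theta n) <= r n) ->
  theta @ \oo --> (pi : R).
Proof.
move=> r0 H; apply/cvgrPdist_lt => e e0.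
(* Capped at pi so that pi - e' stays in [0, pi]. *)
pose e' := Num.min e pi.
have e'0 : 0 < e' by rewrite lt_min e0 pi_gt0.
have e'pi : e' <= pi by rewrite ge_min lexx orbT.
have pie : pi - e' \in `[0, pi] by rewrite in_itv/=; apply/andP; split; lra.
have d0 : 0 < 1 + cos (pi - e').
  have : cos pi < cos (pi - e') by rewrite ltr_cos//; [lra|rewrite in_itv/= pi_ge0 lexx].
  by rewrite cospi; lra.
near=> n.
have [tn rn] : theta n \in `[0, pi] /\ 1 + cos (theta n) <= r n by near: n.
have rd : r n < 1 + cos (pi - e') by near: n; exact: (cvgr_lt 0 r0).
have : cos (theta n) < cos (pi - e') by lra.
rewrite ltr_cos// => ?; move: tn; rewrite in_itv/= => /andP[_ tpi].
rewrite ger0_norm ?subr_ge0//; apply: (@lt_le_trans _ _ e'); first lra.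
by rewrite ge_min lexx.
Unshelve. all: by end_near. Qed.

(** ln 4 = -2 ln(1 - 1/2) >= 1 and pi < 17/5 leave at least 4/3 - 289/225 > 0. This gives the angle
    statement a positive rate to work with. *)
Lemma decay_rate_gt0 (R : realType) : 0 < 1 + ln 4 / 3 - pi ^+ 2 / 9 :> R.
Proof.
have l4 : 1 <= ln (4 : R).
  have -> : (4 : R) = (1 + - 2^-1) ^- 2 by field.
  rewrite lnV ?posrE ?exprn_gt0//; last by lra.
  rewrite lnXn; last by lra.
  have : ln (1 + - 2^-1 : R) <= - 2^-1 by apply: le_ln1Dx; lra.
  by rewrite -mulr_natl; lra.
have p0 := pi_gt0 R; have p1 := @pi_lt R.
have : pi ^+ 2 <= (17 / 5 : R) ^+ 2 by rewrite lerXn2r ?nnegrE// ltW//; lra.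
by rewrite expr2; lra.
Qed.

Theorem theorem4 (R : realType) (d : measure_display)
    (Omega : measurableType d) (P : probability Omega R)
    (T0 : triangle R) (U : nat * 'I_3 -> {RV P >-> R})
    (T0_nondegenerate : nondegenerate T0)
    (U_uniform : forall k : nat * 'I_3, uniform01 (U k))
    (U_independent : mutually_independent U) :
  let T := fun (n : nat) (w : Omega) =>
    triangle_seq T0 (fun (m : nat) (i : 'I_3) => U (m, i) w) n in
  {ae P, forall w : Omega, (fun n : nat => max_angle (T n w)) @ \oo --> (pi : R)} /\
  (forall c : R, c < 1 + ln 4 / 3 - pi ^+ 2 / 9 ->
    {ae P, forall w : Omega,
      \forall n \near \oo, flatness (T n w) <= expR (- (c * n%:R))}).
Proof.
move=> T; have [C C0 flat] := triangle_seq_flat T0_nondegenerate.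
have decay c : c < 1 + ln 4 / 3 - pi ^+ 2 / 9 ->
    {ae P, forall w, \forall n \near \oo, let s := C * expR (- (c * n%:R)) in
      [/\ flatness (T n w) <= s, max_angle (T n w) \in `[0, pi] &
          1 + cos (max_angle (T n w)) <= 2 * s ^+ 2]}.
  move=> /(chain_decay U_uniform U_independent).
  apply: filterS => w; apply: filterS => n.
  have := flat (fun m i => U (m, i) w) n; rewrite -/(T n w).
  case: (flat_chain _ n) => -[[A x0] x1] x2 H [A0 x01 x12 x20 le_exp].
  have [f_le pi_itv cos_le] := H A0 x01 x12 x20.
  have s_le := ler_wpM2l (ltW C0) le_exp.
  split=> //; first exact: le_trans f_le s_le.
  apply: (le_trans cos_le); rewrite ler_wpM2l// lerXn2r// nnegrE.
    by exact: (mulr_ge0 (ltW C0) (divr_ge0 (ltW A0) (sqr_ge0 _))).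
  by rewrite mulr_ge0 ?expR_ge0 ?ltW.
have rate0 := decay_rate_gt0 R; set c0 := (X in 0 < X) in rate0; split.
  (* At half the limiting rate, the bound on 1 + cos, which is quadratic, is geometric with ratio
     e^(-c0) < 1. *)
  have c2 : c0 / 2 < c0 by lra.
  apply: filterS (decay _ c2) => w H.
  pose r (n : nat) : R := 2 * (C * expR (- (c0 / 2 * n%:R))) ^+ 2.
  apply: (@cvg_pi_of_cos _ _ r); last by apply: filterS H => n [_ ? ?].
  have -> : r = geometric (2 * C ^+ 2) (expR (- c0)).
    apply/funext => n; rewrite /r /= exprMn -!expRM_natl mulrA; congr (_ * expR _).
    by field.
  by apply: cvg_geometric; rewrite ger0_norm ?expR_ge0// expR_lt1 oppr_lt0.
(* A rate strictly between c and c0 absorbs the constant: C e^(-c' n) <= e^(-c n) once n >= ln C /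
   (c' - c). *)
move=> c cc0; pose c' := (c + c0) / 2.
have c'c0 : c' < c0 by rewrite /c'; rewrite -/c0 in cc0; lra.
have cc' : 0 < c' - c by rewrite /c'; rewrite -/c0 in cc0; lra.
apply: filterS (decay _ c'c0) => w H.
near=> n.
have [f_le _ _] : let s := C * expR (- (c' * n%:R)) in
    [/\ flatness (T n w) <= s, max_angle (T n w) \in `[0, pi] &
        1 + cos (max_angle (T n w)) <= 2 * s ^+ 2] by near: n.
apply: (le_trans f_le); rewrite -[C](lnK C0) -expRD ler_expR.
have : ln C / (c' - c) <= n%:R by near: n; exact: nbhs_infty_ger.
by rewrite ler_pdivrMr//; lra.
Unshelve. all: by end_near. Qed.
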